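(* Let $\mathcal F\subset H^2(\mathbb C^m)$ be a non-trivial nearly $S^*$-invariant subspace, let $(g_1,\dots,g_r)$ be an orthonormal basis of $W:=\mathcal F\cap(\mathcal F\cap zH^2(\mathbb C^m))^{\perp}$, let $G=[g_1,\dots,g_r]\in H^2(\mathbb C^r\to\mathbb C^m)$, and let $B\in H^\infty(\mathbb C^r\to\mathbb C^r)$ be the function associated with $G$ as in the context. Let $U\in H^\infty(\mathbb C^r\to\mathbb C^r)$ be an inner function of rank $r$ with $U(0)=0$, and let $K_U=H^2(\mathbb C^r)\ominus UH^2(\mathbb C^r)$. Then the following are equivalent: (i) $T_G|_{K_U}$ is an isometry, i.e. $\|Gh\|_{H^2(\mathbb C^m)}=\|h\|_{H^2(\mathbb C^r)}$ for all $h\in K_U$; (ii) $T_{B^*}K_U=\{0\}$; (iii) $BH^2(\mathbb C^r)\subset UH^2(\mathbb C^r)$.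
   Context: $H^2(\mathbb C^m)$ is the Hardy space of $\mathbb C^m$-valued functions on the unit disc $\mathbb D$; $H^2(\mathbb C^r\to\mathbb C^m)$ and $H^\infty(\mathbb C^r\to\mathbb C^m)$ denote the corresponding spaces of $m\times r$ matrix-valued functions; functions are identified with their boundary values on $\mathbb T$. $S$ is multiplication by $z$, $S^*$ its adjoint. A closed subspace $\mathcal F\subset H^2(\mathbb C^m)$ is nearly $S^*$-invariant if $f\in\mathcal F$, $f(0)=0$ imply $S^*f\in\mathcal F$. (It is known that then $r=\dim W\le m$.) $G=[g_1,\dots,g_r]$ is the matrix function with columns $g_1,\dots,g_r$. For a matrix symbol $\varphi$, $T_\varphi f=p_+(\varphi f)$, where $p_+$ is the Fourier (Riesz) projection discarding the negative Fourier coefficients (also applied to $L^1$ functions); so $T_Gh=Gh$ for $h\in H^2(\mathbb C^r)$, possibly an unbounded operator. The function $B$ associated with $G$: for $z\in\mathbb D$, $$F(z):=\frac1{2\pi}\int_0^{2\pi}\frac{e^{i\theta}+z}{e^{i\theta}-z}\,G(e^{i\theta})^*G(e^{i\theta})\,d\theta,\qquad B(z):=(F(z)+Id_r)^{-1}(F(z)-Id_r).$$ Then $F(0)=Id_r$, $B(0)=0$, and $B$ lies in the unit ball of $H^\infty(\mathbb C^r\to\mathbb C^r)$. $U\in H^\infty(\mathbb C^r\to\mathbb C^r)$ is inner if its boundary values $U(\xi)$ are partial isometries for a.e. $\xi\in\mathbb T$, with kernel and range independent of $\xi$ a.e.; its rank is the a.e. constant rank of $U(\xi)$ (so rank $r$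 means unitary a.e.). *)

(* Defs.v *)
From HB Require Import structures.
From mathcomp Require Import all_boot all_order all_algebra.
From mathcomp Require Import all_classical all_reals all_analysis.
From mathcomp Require Import complex.

Set Implicit Arguments.
Unset Strict Implicit.
Unset Printing Implicit Defensive.

Import Order.TTheory GRing.Theory Num.Theory.
Import numFieldNormedType.Exports.
Import sesquilinear.

Local Open Scope classical_set_scope.
Local Open Scope ring_scope.
Local Open Scope complex_scope.
Local Open Scope sesquilinear_scope.

(* A function on the unit circle T is represented by its pullback along
   t |-> e^{it}; only its values on [0, 2 pi], up to a.e. equality, matter.
   The Hardy spaces are taken on the circle (elements are boundary values);
   [disc f] recovers the associated holomorphic function on the unit disc. *)
Definition circle_fun (R : realType) (m n : nat) := R -> 'M[R[i]]_(m, n).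

Section Circle.
Context {R : realType}.
Local Notation C := R[i].
Local Notation mu := (@lebesgue_measure R).

Definition circle_arc : set R := `[0, 2 * pi].

Definition cis (t : R) : C := cos t +i* sin t.

Definition cmean (f : R -> C) : C :=
  ((2 * pi)^-1 * \int[mu]_(t in circle_arc) complex.Re (f t)) +i*
  ((2 * pi)^-1 * \int[mu]_(t in circle_arc) complex.Im (f t)).

Definition cmeasurable (f : R -> C) : Prop :=
  measurable_fun circle_arc (fun t => complex.Re (f t)) /\
  measurable_fun circle_arc (fun t => complex.Im (f t)).

Definition normsq (z : C) : R := complex.Re z ^+ 2 + complex.Im z ^+ 2.

Definition ae_on_circle (P : R -> Prop) : Prop :=
  {ae mu, forall t, circle_arc t -> P t}.

Section Shape.
Context {m n : nat}.
Implicit Types f g : circle_fun R m n.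

Definition ae_equal f g : Prop := ae_on_circle (fun t => f t = g t).

Definition mxmean f : 'M[C]_(m, n) := \matrix_(i, j) cmean (fun t => f t i j).

Definition L1 f : Prop := forall i j,
  mu.-integrable circle_arc (fun t => (complex.Re (f t i j))%:E) /\
  mu.-integrable circle_arc (fun t => (complex.Im (f t i j))%:E).

Definition L2 f : Prop := forall i j,
  cmeasurable (fun t => f t i j) /\
  mu.-integrable circle_arc (fun t => (normsq (f t i j))%:E).

Definition Linf f : Prop := forall i j,
  cmeasurable (fun t => f t i j) /\
  exists M : R, ae_on_circle (fun t => normsq (f t i j) <= M).

Definition fourier f (k : int) : 'M[C]_(m, n) :=
  mxmean (fun t => cis (- (k%:~R * t)) *: f t).

Definition analytic f : Prop := forall k : int, k < 0 -> fourier f k = 0.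

Definition H2 f : Prop := L2 f /\ analytic f.
Definition Hinf f : Prop := Linf f /\ analytic f.

(* Cauchy's formula: f(z) = 1/(2 pi i) \oint f(xi) / (xi - z) dxi. *)
Definition disc f (z : C) : 'M[C]_(m, n) :=
  mxmean (fun t => (1 - z * cis (- t))^-1 *: f t).

Definition is_riesz_proj f g : Prop :=
  [/\ L1 f, L1 g &
      forall k : int, fourier g k = if 0 <= k then fourier f k else 0].

Definition zshift f : circle_fun R m n := fun t => cis t *: f t.

End Shape.

(* normalized inner product of L^2(T; C^m), linear in the first argument *)
Definition inner_prod m (f g : circle_fun R m 1) : C :=
  cmean (fun t => ((g t)^t* *m f t) 0 0).

Definition L2norm m (f : circle_fun R m 1) : R :=
  Num.sqrt (complex.Re (inner_prod f f)).

Definition mxmulf p m n (A : circle_fun R p m) (h : circle_fun R m n) :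
  circle_fun R p n := fun t => A t *m h t.

Definition mxadjf m n (A : circle_fun R m n) : circle_fun R n m :=
  fun t => (A t)^t*.

(* [is_toeplitz phi h g] means T_phi h = g, with T_phi h = p_+ (phi h). *)
Definition is_toeplitz p m (phi : circle_fun R p m) (h : circle_fun R m 1)
  (g : circle_fun R p 1) : Prop := is_riesz_proj (mxmulf phi h) g.

Definition is_Sstar m (f g : circle_fun R m 1) : Prop :=
  [/\ H2 f, H2 g &
      forall h, H2 h -> inner_prod (zshift h) f = inner_prod h g].

Definition closed_subspace m (F : set (circle_fun R m 1)) : Prop :=
  [/\ F `<=` H2,
      F (fun=> 0),
      (forall (a : C) f g, F f -> F g -> F (fun t => a *: f t + g t)) &
      (forall (u : nat -> circle_fun R m 1) f,
          (forall k, F (u k)) -> H2 f ->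
          L2norm (fun t => u k t - f t) @[k --> \oo] --> (0 : R) -> F f)].

Definition nearly_Sstar_invariant m (F : set (circle_fun R m 1)) : Prop :=
  closed_subspace F /\
  forall f g, F f -> disc f 0 = 0 -> is_Sstar f g -> F g.

Definition nontrivial m (F : set (circle_fun R m 1)) : Prop :=
  exists2 f, F f & ~ ae_equal f (fun=> 0).

Definition zH2 m : set (circle_fun R m 1) :=
  [set f | exists2 h, H2 h & ae_equal f (zshift h)].

(* E `&` A^perp *)
Definition ominus m (E A : set (circle_fun R m 1)) : set (circle_fun R m 1) :=
  [set f | E f /\ forall g, A g -> inner_prod f g = 0].

Definition wandering m (F : set (circle_fun R m 1)) :=
  ominus F (F `&` zH2 (m := m)).

Definition orthonormal_basis m r (g : 'I_r -> circle_fun R m 1)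
  (W : set (circle_fun R m 1)) : Prop :=
  [/\ forall i, W (g i),
      forall i j, inner_prod (g i) (g j) = (i == j)%:R &
      forall w, W w -> exists c : 'I_r -> C,
        ae_equal w (fun t => \sum_i c i *: g i t)].

Definition of_columns m r (g : 'I_r -> circle_fun R m 1) : circle_fun R m r :=
  fun t => \matrix_(i, j) g j t i 0.

Definition herglotz m r (G : circle_fun R m r) (z : C) : 'M[C]_r :=
  mxmean (fun t => ((cis t + z) / (cis t - z)) *: ((G t)^t* *m G t)).

Definition assoc_B m r (G : circle_fun R m r) (z : C) : 'M[C]_r :=
  invmx (herglotz G z + 1%:M) *m (herglotz G z - 1%:M).

(* B in H^infty (given by its boundary values) is the function on the disc
   associated with G *)
Definition associated m r (G : circle_fun R m r) (B : circle_fun R r r) : Prop :=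
  Hinf B /\ forall z : C, `|z| < 1 -> disc B z = assoc_B G z.

Definition partial_isometry p m (A : 'M[C]_(p, m)) : Prop :=
  forall v : 'cV[C]_m,
    (forall w : 'cV[C]_m, A *m w = 0 -> w^t* *m v = 0) ->
    (A *m v)^t* *m (A *m v) = v^t* *m v.

Definition inner_of_rank r (U : circle_fun R r r) (k : nat) : Prop :=
  Hinf U /\
  exists K E : set 'cV[C]_r, ae_on_circle (fun t =>
    [/\ partial_isometry (U t),
        [set v | U t *m v = 0] = K,
        range (fun v : 'cV[C]_r => U t *m v) = E &
        \rank (U t) = k]).

(* the set A H^2(C^r) *)
Definition mulH2 r (A : circle_fun R r r) : set (circle_fun R r 1) :=
  [set f | exists2 h, H2 h & ae_equal f (mxmulf A h)].

Definition model_space r (U : circle_fun R r r) : set (circle_fun R r 1) :=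
  ominus H2 (mulH2 U).

End Circle.

(* Main.v *)
Require Import Defs.
From HB Require Import structures.
From mathcomp Require Import all_boot all_order all_algebra.
From mathcomp Require Import all_classical all_reals all_analysis.
From mathcomp Require Import complex.
From mathcomp Require Import finmap measurable_realfun zify ring lra.

(** Let A_k be the Fourier coefficients of G^* G and b_k the Taylor coefficients
of 1 - B.  Orthonormality of the columns of G says A_0 = 1, so F = 2 P - 1 with
P(z) the sum of the A_k z^k over k >= 0, and the definition of B turns into
(1 - B) P = 1, that is, a convolution identity between (b_k) and (A_k)
([assoc_coef]).

For an analytic polynomial x let y = x - T_{B*} x.  That identity says that y
solves a triangular Toeplitz system with coefficients A_k and right-hand side x
([backsolE]), and expanding the square of G y gives the defect identity
<<
  || G y ||^2 = || x ||^2 - || T_{B*} x ||^2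
>>
([defect]).  The equivalence of (i) and (ii) is this identity applied to the
partial Fourier sums x_N of h in K_U, with y_N = x_N - T_{B*} x_N.

From (ii) to (i): T_{B*} x_N tends to 0 because T_{B*} h = 0, so y_N tends to h.
The defect identity also bounds G (y_K - y_N) by x_K - x_N, whence G y_N is a
Cauchy sequence and the norm identity passes to the limit.  As G is unbounded,
the limit is identified with G h through bounded cutoffs of G ([L2_of_cutmx],
[toeplitz_ker_isometry]).

From (i) to (ii): U(0) = 0 puts the constants in K_U, and K_U is invariant under
the backward shift.  Polarizing the isometry against constants, for all backward
shifts of h, shows that the k-th coefficient of G^* G h is that of P h
([gramapp_coef]); with the triangular system this makes the pairing of G h with
G y_N equal to || x_N ||^2.  Expanding || G h - G y_N ||^2 >= 0 then yields
|| T_{B*} x_N ||^2 <= || h ||^2 - || x_N ||^2, which tends to 0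
([isometry_toeplitz]).

For (iii), U is unitary almost everywhere, so B f lies in U H^2 exactly when
U^* B f is analytic.  Its negative coefficients are pairings of B f with
backward shifts of columns of U, and these shifts lie in K_U; so (ii) gives
(iii) ([toeplitz_mulH2]).  Conversely h in K_U is orthogonal to B H^2 as soon as
B H^2 is contained in U H^2 ([mulH2_toeplitz]).

Convergence of x_N to h is the completeness of the characters in L^2 of the
circle.  It is obtained here from the Fejer kernel ([fejer_korovkin]), which
approximates arcs, followed by the passage from arcs to Borel sets and from
Borel sets to square-integrable functions ([approx_L2]). *)

Set Implicit Arguments.
Unset Strict Implicit.
Unset Printing Implicit Defensive.

Import Order.TTheory GRing.Theory Num.Theory.
Import numFieldNormedType.Exports.
Import sesquilinear.

Local Open Scope classical_set_scope.
Local Open Scope ring_scope.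
Local Open Scope complex_scope.
Local Open Scope sesquilinear_scope.

(** * Integrals and almost everywhere equality *)

Section AeIntegral.
Import HBNNSimple.
Local Open Scope ereal_scope.
Context d (T : measurableType d) (R : realType) (mu : {measure set T -> \bar R}).

(** The integral of f is a supremum over the simple functions below it; cutting
such a function off a measurable null set outside which f = g leaves its integral
unchanged and puts it below g.  In this form the lemma covers functions that are
merely a.e. equal to a measurable one, as the members of [mulH2 U] are. *)
Lemma ge0_ae_le_integral (D : set T) (f g : T -> \bar R) :
  (forall x, D x -> 0 <= f x) -> (forall x, D x -> 0 <= g x) ->
  {ae mu, forall x, D x -> f x = g x} ->
  \int[mu]_(x in D) f x <= \int[mu]_(x in D) g x.
Proof.
move=> f0 g0 [N [mN N0 fgN]]; rewrite ge0_integralE// ge0_integralE//.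
apply: ge_ereal_sup => _ [h /= hf <-]; apply: ereal_sup_ubound.
have mCN : measurable (~` N) by exact: measurableC.
exists (proj_nnsfun h mCN).
  move=> x /=; rewrite mindicE; case: (boolP (x \in ~` N)) => xN.
    rewrite mulr1 (le_trans (hf x))// /patch; case: ifPn => // /set_mem Dx.
    have -> // : f x = g x.
    by move: xN => /set_mem xN; apply: contrapT => fg; apply: xN; apply: fgN => /(_ Dx).
  by rewrite mulr0 /patch; case: ifPn => // /set_mem /g0.
rewrite -[LHS]integralT_nnsfun -[RHS]integralT_nnsfun.
apply: ae_eq_integral => //.
- by apply/measurable_EFinP; exact: measurable_funP.
- by apply/measurable_EFinP; exact: measurable_funP.
exists N; split => // x /= xN; apply: contrapT => Nx; apply: xN => _.
by rewrite mindicE mem_set// mulr1.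
Qed.

Lemma eq_integral_ae (D : set T) (f g : T -> \bar R) :
  {ae mu, forall x, D x -> f x = g x} ->
  \int[mu]_(x in D) f x = \int[mu]_(x in D) g x.
Proof.
move=> fg; have FF := ae_filter_ringOfSetsType mu.
have gf : {ae mu, forall x, D x -> g x = f x}.
  by apply: (@filterS _ _ FF) fg => x h /h.
have le (u v : T -> \bar R) : (forall x, 0 <= u x) -> (forall x, 0 <= v x) ->
    {ae mu, forall x, D x -> u x = v x} -> {ae mu, forall x, D x -> v x = u x} ->
    \int[mu]_(x in D) u x = \int[mu]_(x in D) v x.
  by move=> u0 v0 uv vu; apply/eqP; rewrite eq_le !ge0_ae_le_integral.
rewrite integralE [RHS]integralE; congr (_ - _); apply: le.
all: try exact: funepos_ge0.
all: try exact: funeneg_ge0.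
- by apply: (@filterS _ _ FF) fg => x h Dx; rewrite !funeposE h.
- by apply: (@filterS _ _ FF) gf => x h Dx; rewrite !funeposE h.
- by apply: (@filterS _ _ FF) fg => x h Dx; rewrite !funenegE h.
- by apply: (@filterS _ _ FF) gf => x h Dx; rewrite !funenegE h.
Qed.

End AeIntegral.

Section RealMean.
Context {R : realType}.
Local Notation mu := (@lebesgue_measure R).
Local Notation D := (@circle_arc R).
Implicit Types f g : R -> R.

Definition intR f : Prop := mu.-integrable D (EFin \o f).

Definition rmean f : R := (2 * pi)^-1 * \int[mu]_(t in D) f t.

Lemma mcircle : measurable (D : set (measurableTypeR R)).
Proof. exact: measurable_itv. Qed.
#[local] Hint Resolve mcircle : core.

Lemma twopi_gt0 : 0 < 2 * pi :> R.
Proof. by rewrite mulr_gt0 ?pi_gt0. Qed.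

Lemma mu_circle : mu D = (2 * pi)%:E.
Proof.
by rewrite /circle_arc lebesgue_measure_itv /= lte_fin twopi_gt0 sube0.
Qed.

Lemma intR_meas f : intR f -> measurable_fun D f.
Proof. by move=> /integrableP[/measurable_EFinP]. Qed.

Lemma intR_bounded f M : measurable_fun D f -> (forall t, D t -> `|f t| <= M) ->
  intR f.
Proof.
move=> mf fM; apply: measurable_bounded_integrable => //.
  by move: mu_circle => /= ->; rewrite ltry.
exists M; split; first exact: num_real.
by move=> x /ltW Mx t Dt /=; rewrite (le_trans (fM _ Dt)).
Qed.

Lemma intR_cst c : intR (fun=> c).
Proof. by apply: (@intR_bounded _ `|c|) => //; exact: measurable_cst. Qed.

Lemma intRD f g : intR f -> intR g -> intR (fun t => f t + g t).
Proof. by move=> fi gi; exact: (integrableD mcircle fi gi). Qed.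

Lemma intRZ c f : intR f -> intR (fun t => c * f t).
Proof. by move=> fi; exact: (integrableZl mcircle c fi). Qed.

Lemma intRN f : intR f -> intR (fun t => - f t).
Proof. by move=> fi; exact: (integrableN fi). Qed.

Lemma intRB f g : intR f -> intR g -> intR (fun t => f t - g t).
Proof. by move=> fi gi; apply: intRD => //; exact: intRN. Qed.

Lemma intR_norm f : intR f -> intR (fun t => `|f t|).
Proof. exact: integrable_norm. Qed.

Lemma intR_le f g : measurable_fun D f ->
  (forall t, D t -> `|f t| <= g t) -> intR g -> intR f.
Proof.
move=> mf fg; apply: le_integrable => //; first exact/measurable_EFinP.
move=> t Dt /=; rewrite lee_fin (le_trans (fg _ Dt))//; exact: ler_norm.
Qed.

Lemma ae_circleS (P Q : R -> Prop) : (forall t, D t -> P t -> Q t) ->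
  ae_on_circle P -> ae_on_circle Q.
Proof.
move=> PQ; have FF := ae_filter_ringOfSetsType mu.
by apply: (@filterS _ _ FF) => t h Dt; exact: PQ (h Dt).
Qed.

Lemma ae_circleI (P Q : R -> Prop) : ae_on_circle P -> ae_on_circle Q ->
  ae_on_circle (fun t => P t /\ Q t).
Proof.
have FF := ae_filter_ringOfSetsType mu.
by apply: (@filterS2 _ _ FF) => t hP hQ Dt; split; [exact: hP|exact: hQ].
Qed.

Lemma ae_circleT (P : R -> Prop) : (forall t, D t -> P t) -> ae_on_circle P.
Proof. by move=> h; exact: aeW. Qed.

Lemma intR_le_ae f g : measurable_fun D f ->
  ae_on_circle (fun t => `|f t| <= g t) -> intR g -> intR f.
Proof.
move=> mf fg /integrableP[mg goo]; apply/integrableP; split.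
  exact/measurable_EFinP.
apply: le_lt_trans goo; apply: ae_ge0_le_integral => //=.
- by apply/measurable_EFinP; apply: measurableT_comp => //; exact/measurable_EFinP.
- by apply/measurable_EFinP; apply: measurableT_comp => //; exact/measurable_EFinP.
- apply: (ae_circleS (Q := fun t => (`|f t|%:E <= `|g t|%:E)%E)) fg => t Dt h.
  by rewrite lee_fin (le_trans h)// ler_norm.
Qed.

Lemma rmeanD f g : intR f -> intR g ->
  rmean (fun t => f t + g t) = rmean f + rmean g.
Proof. by move=> fi gi; rewrite /rmean RintegralD// mulrDr. Qed.

Lemma rmeanZ c f : intR f -> rmean (fun t => c * f t) = c * rmean f.
Proof. by move=> fi; rewrite /rmean RintegralZl// mulrCA. Qed.

Lemma rmeanN f : intR f -> rmean (fun t => - f t) = - rmean f.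
Proof.
move=> fi; rewrite -mulN1r -rmeanZ//; congr (_ * _).
by apply: eq_Rintegral => t _; rewrite mulN1r.
Qed.

Lemma rmeanB f g : intR f -> intR g ->
  rmean (fun t => f t - g t) = rmean f - rmean g.
Proof. by move=> fi gi; rewrite rmeanD ?rmeanN//; exact: intRN. Qed.

Lemma rmean_cst c : rmean (fun=> c) = c.
Proof.
rewrite /rmean Rintegral_cst//; move: mu_circle => /= ->; rewrite /= mulrCA mulVf ?mulr1//.
by rewrite gt_eqF// twopi_gt0.
Qed.

Lemma eq_rmean f g : (forall t, D t -> f t = g t) -> rmean f = rmean g.
Proof.
by move=> fg; congr (_ * _); apply: eq_Rintegral => t /set_mem /fg.
Qed.

Lemma rmean_ge0 f : (forall t, D t -> 0 <= f t) -> 0 <= rmean f.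
Proof.
by move=> f0; rewrite mulr_ge0 ?invr_ge0 ?(ltW twopi_gt0)//; exact: Rintegral_ge0.
Qed.

Lemma rmean_le f g : intR f -> intR g -> (forall t, D t -> f t <= g t) ->
  rmean f <= rmean g.
Proof.
move=> fi gi fg; rewrite /rmean ler_pM2l ?invr_gt0 ?twopi_gt0//.
exact: le_Rintegral.
Qed.

Lemma ae_eq_rmean f g : ae_on_circle (fun t => f t = g t) -> rmean f = rmean g.
Proof.
move=> fg; congr (_ * fine _); apply: eq_integral_ae.
by apply: (ae_circleS (Q := fun t => (f t)%:E = (g t)%:E)) fg => t Dt /= ->.
Qed.

Lemma rmean_le_ae f g : intR f -> intR g -> ae_on_circle (fun t => f t <= g t) ->
  rmean f <= rmean g.
Proof.
move=> fi gi fg.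
have mf := intR_meas fi; have mg := intR_meas gi.
have mm : measurable_fun D (fun t => Num.min (f t) (g t)).
  exact: measurable_minr.
rewrite (@ae_eq_rmean f (fun t => Num.min (f t) (g t))); last first.
  by apply: ae_circleS fg => t Dt h; rewrite min_l.
apply: rmean_le => //; last by move=> t _; rewrite ge_min lexx orbT.
have iu : intR (fun t => `|f t| + `|g t|) by apply: intRD; exact: intR_norm.
by apply: intR_le iu => // t Dt; case: (leP (f t) (g t)) => _; rewrite ?lerDl ?lerDr.
Qed.

Lemma rmean_dominated_cvg0 (f_ : nat -> R -> R) g :
  (forall n, measurable_fun D (f_ n)) -> intR g ->
  (forall t, D t -> f_ ^~ t @ \oo --> 0) ->
  (forall n t, D t -> `|f_ n t| <= g t) ->
  rmean (f_ n) @[n --> \oo] --> 0.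
Proof.
move=> mf gi f0 fg.
have [|||||_ _] := @dominated_convergence _ _ R mu D mcircle
  (fun n => EFin \o f_ n) (cst 0%E) (EFin \o g).
- by move=> n; apply/measurable_EFinP; exact: mf.
- exact: measurable_cst.
- by apply: aeW => t Dt; apply/fine_cvgP; split; [near=> n|exact: f0].
- exact: gi.
- by apply: aeW => t n Dt /=; rewrite lee_fin fg.
rewrite integral0 => /fine_cvgP[_ /= h].
by rewrite -(mulr0 (2 * pi)^-1); apply: cvgMr h.
Unshelve. all: by end_near. Qed.

End RealMean.

(** * Complex means and characters *)

Section ComplexMean.
Context {R : realType}.
Local Notation C := R[i].
Local Notation D := (@circle_arc R).
Local Notation Re := complex.Re.
Local Notation Im := complex.Im.
Local Notation conjC := (@Num.conj C).
Implicit Types (f g : R -> C) (z w : C).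

Lemma ReM z w : Re (z * w) = Re z * Re w - Im z * Im w.
Proof. by case: z w => [a b] [c d]. Qed.

Lemma ImM z w : Im (z * w) = Re z * Im w + Im z * Re w.
Proof. by case: z w => [a b] [c d]. Qed.

Lemma ReD z w : Re (z + w) = Re z + Re w.
Proof. by case: z w => [a b] [c d]. Qed.

Lemma ImD z w : Im (z + w) = Im z + Im w.
Proof. by case: z w => [a b] [c d]. Qed.

Lemma ReN z : Re (- z) = - Re z.
Proof. by case: z. Qed.

Lemma ImN z : Im (- z) = - Im z.
Proof. by case: z. Qed.

Lemma Re_conj z : Re (conjC z) = Re z.
Proof. by case: z. Qed.

Lemma Im_conj z : Im (conjC z) = - Im z.
Proof. by case: z. Qed.

Lemma complexP z w : Re z = Re w -> Im z = Im w -> z = w.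
Proof. by case: z w => [a b] [c d] /= -> ->. Qed.

Lemma Re_sum (I : Type) (s : seq I) (P : pred I) (F : I -> C) :
  Re (\sum_(i <- s | P i) F i) = \sum_(i <- s | P i) Re (F i).
Proof. by elim/big_rec2: _ => // i _ y _ <-; rewrite ReD. Qed.

Lemma normsq_ge0 z : 0 <= normsq z.
Proof. by rewrite addr_ge0 ?sqr_ge0. Qed.

Lemma normsqM z w : normsq (z * w) = normsq z * normsq w.
Proof. by rewrite /normsq ReM ImM; ring. Qed.

Lemma normsq_conj z : normsq (conjC z) = normsq z.
Proof. by rewrite /normsq Re_conj Im_conj sqrrN. Qed.

Lemma normsqN z : normsq (- z) = normsq z.
Proof. by rewrite /normsq ReN ImN !sqrrN. Qed.

Lemma normsqD_le z w : normsq (z + w) <= 2 * normsq z + 2 * normsq w.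
Proof.
rewrite /normsq ReD ImD; case: z w => [a b] [c d] /=.
by have := sqr_ge0 (a - c); have := sqr_ge0 (b - d); nra.
Qed.

Lemma normsqE z : z * conjC z = (normsq z)%:C.
Proof.
by apply: complexP; rewrite ?ReM ?ImM Re_conj Im_conj /= /normsq; ring.
Qed.

Lemma ReM_le z w : `|Re (z * w)| <= normsq z + normsq w.
Proof.
rewrite ReM ler_norml /normsq; case: z w => [a b] [c d] /=.
have := sqr_ge0 (a - c); have := sqr_ge0 (a + c).
by have := sqr_ge0 (b - d); have := sqr_ge0 (b + d); nra.
Qed.

Lemma ImM_le z w : `|Im (z * w)| <= normsq z + normsq w.
Proof.
rewrite ImM ler_norml /normsq; case: z w => [a b] [c d] /=.
have := sqr_ge0 (a - d); have := sqr_ge0 (a + d).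
by have := sqr_ge0 (b - c); have := sqr_ge0 (b + c); nra.
Qed.

Definition cint f : Prop := intR (fun t => Re (f t)) /\ intR (fun t => Im (f t)).

Lemma cmeas_cst z : cmeasurable (fun=> z).
Proof. by split; exact: measurable_cst. Qed.

Lemma cmeasD f g : cmeasurable f -> cmeasurable g ->
  cmeasurable (fun t => f t + g t).
Proof.
move=> [mf1 mf2] [mg1 mg2]; split.
  by under eq_fun do rewrite ReD; exact: measurable_funD.
by under eq_fun do rewrite ImD; exact: measurable_funD.
Qed.

Lemma cmeasM f g : cmeasurable f -> cmeasurable g ->
  cmeasurable (fun t => f t * g t).
Proof.
move=> [mf1 mf2] [mg1 mg2]; split.
  by under eq_fun do rewrite ReM; apply: measurable_funB; exact: measurable_funM.
by under eq_fun do rewrite ImM; apply: measurable_funD; exact: measurable_funM.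
Qed.

Lemma cmeas_conj f : cmeasurable f -> cmeasurable (fun t => conjC (f t)).
Proof.
move=> [mf1 mf2]; split; first by under eq_fun do rewrite Re_conj.
by under eq_fun do rewrite Im_conj; exact: measurableT_comp.
Qed.

Lemma cmeas_sum (I : Type) (s : seq I) (F : I -> R -> C) :
  (forall i, cmeasurable (F i)) -> cmeasurable (fun t => \sum_(i <- s) F i t).
Proof.
move=> h; elim: s => [|i s ih].
  by under eq_fun do rewrite big_nil; exact: cmeas_cst.
by under eq_fun do rewrite big_cons; exact: cmeasD.
Qed.

Lemma meas_normsq f : cmeasurable f -> measurable_fun D (fun t => normsq (f t)).
Proof.
move=> [mf1 mf2]; rewrite /normsq; apply: measurable_funD;
  exact: measurable_funX.
Qed.

Lemma cint_meas f : cint f -> cmeasurable f.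
Proof. by move=> [/intR_meas ? /intR_meas]. Qed.

Lemma cintD f g : cint f -> cint g -> cint (fun t => f t + g t).
Proof.
move=> [if1 if2] [ig1 ig2]; split.
  by under eq_fun do rewrite ReD; exact: intRD.
by under eq_fun do rewrite ImD; exact: intRD.
Qed.

Lemma cint_cst z : cint (fun=> z).
Proof. by split; exact: intR_cst. Qed.

Lemma cintZ z f : cint f -> cint (fun t => z * f t).
Proof.
move=> [if1 if2]; split.
  by under eq_fun do rewrite ReM; apply: intRB; exact: intRZ.
by under eq_fun do rewrite ImM; apply: intRD; exact: intRZ.
Qed.

Lemma cint_sum (I : Type) (s : seq I) (F : I -> R -> C) :
  (forall i, cint (F i)) -> cint (fun t => \sum_(i <- s) F i t).
Proof.
move=> h; elim: s => [|i s ih].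
  by under eq_fun do rewrite big_nil; exact: cint_cst.
by under eq_fun do rewrite big_cons; exact: cintD.
Qed.

Lemma cmeanE f :
  cmean f = rmean (fun t => Re (f t)) +i* rmean (fun t => Im (f t)).
Proof. by []. Qed.

Lemma eq_cmean f g : (forall t, D t -> f t = g t) -> cmean f = cmean g.
Proof.
by move=> fg; rewrite !cmeanE; congr (_ +i* _); apply: eq_rmean => t /fg ->.
Qed.

Lemma ae_eq_cmean f g : ae_on_circle (fun t => f t = g t) -> cmean f = cmean g.
Proof.
move=> fg; rewrite !cmeanE; congr (_ +i* _);
  by apply: ae_eq_rmean; apply: ae_circleS fg => t _ ->.
Qed.

Lemma cmeanD f g : cint f -> cint g ->
  cmean (fun t => f t + g t) = cmean f + cmean g.
Proof.
move=> [if1 if2] [ig1 ig2]; rewrite !cmeanE; apply: complexP => /=.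
  by rewrite -rmeanD//; apply: eq_rmean => t _; rewrite ReD.
by rewrite -rmeanD//; apply: eq_rmean => t _; rewrite ImD.
Qed.

Lemma cmeanZ z f : cint f -> cmean (fun t => z * f t) = z * cmean f.
Proof.
move=> [if1 if2]; apply: complexP; rewrite ?ReM ?ImM /=.
  rewrite -[X in _ - X]rmeanZ// -[X in X - _]rmeanZ// -rmeanB; try exact: intRZ.
  by apply: eq_rmean => t _; rewrite ReM.
rewrite -[X in _ + X]rmeanZ// -[X in X + _]rmeanZ// -rmeanD; try exact: intRZ.
by apply: eq_rmean => t _; rewrite ImM.
Qed.

Lemma cmean_cst z : cmean (fun=> z) = z.
Proof. by rewrite cmeanE !rmean_cst; case: z. Qed.

Lemma cmean_conj f : cint f -> cmean (fun t => conjC (f t)) = conjC (cmean f).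
Proof.
move=> [if1 if2]; apply: complexP; rewrite ?Re_conj ?Im_conj /=.
  by apply: eq_rmean => t _; rewrite Re_conj.
by rewrite -rmeanN//; apply: eq_rmean => t _; rewrite Im_conj.
Qed.

Lemma cmean_sum (I : Type) (s : seq I) (F : I -> R -> C) :
  (forall i, cint (F i)) ->
  cmean (fun t => \sum_(i <- s) F i t) = \sum_(i <- s) cmean (F i).
Proof.
move=> h; elim: s => [|i s ih].
  rewrite big_nil -[RHS](cmean_cst 0).
  by apply: eq_cmean => t _; rewrite big_nil.
rewrite big_cons -ih -cmeanD//; last exact: cint_sum.
by apply: eq_cmean => t _; rewrite big_cons.
Qed.

Definition sL2 f : Prop := cmeasurable f /\ intR (fun t => normsq (f t)).

Lemma sL2D f g : sL2 f -> sL2 g -> sL2 (fun t => f t + g t).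
Proof.
move=> [mf if_] [mg ig]; split; first exact: cmeasD.
have i2 : intR (fun t => 2 * normsq (f t) + 2 * normsq (g t)).
  by apply: intRD; exact: intRZ.
apply: intR_le i2; first by apply: meas_normsq; exact: cmeasD.
by move=> t _; rewrite ger0_norm ?normsq_ge0// normsqD_le.
Qed.

Lemma sL2_mul b f M : cmeasurable b -> ae_on_circle (fun t => normsq (b t) <= M) ->
  sL2 f -> sL2 (fun t => b t * f t).
Proof.
move=> mb bM [mf if_]; split; first exact: cmeasM.
have i2 := intRZ M if_.
apply: intR_le_ae i2; first by apply: meas_normsq; exact: cmeasM.
apply: ae_circleS bM => t _ bM; rewrite ger0_norm ?normsq_ge0// normsqM.
by rewrite ler_wpM2r ?normsq_ge0.
Qed.

Lemma sL2_cst z : sL2 (fun=> z).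
Proof. by split; [exact: cmeas_cst|exact: intR_cst]. Qed.

Lemma sL2Z z f : sL2 f -> sL2 (fun t => z * f t).
Proof.
by apply: (@sL2_mul _ _ (normsq z)); [exact: cmeas_cst|exact: ae_circleT].
Qed.

Lemma sL2B f g : sL2 f -> sL2 g -> sL2 (fun t => f t - g t).
Proof.
move=> if_ ig; under eq_fun do rewrite -mulN1r.
by apply: sL2D => //; exact: sL2Z.
Qed.

Lemma sL2_conj f : sL2 f -> sL2 (fun t => conjC (f t)).
Proof.
move=> [mf if_]; split; first exact: cmeas_conj.
by under eq_fun do rewrite normsq_conj.
Qed.

Lemma sL2_sum (I : Type) (s : seq I) (F : I -> R -> C) :
  (forall i, sL2 (F i)) -> sL2 (fun t => \sum_(i <- s) F i t).
Proof.
move=> h; elim: s => [|i s ih].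
  by under eq_fun do rewrite big_nil; exact: sL2_cst.
by under eq_fun do rewrite big_cons; exact: sL2D.
Qed.

Lemma cintM f g : sL2 f -> sL2 g -> cint (fun t => f t * g t).
Proof.
move=> [mf if_] [mg ig].
have i2 : intR (fun t => normsq (f t) + normsq (g t)) by exact: intRD.
have [m1 m2] := cmeasM mf mg.
by split; apply: intR_le i2 => // t _; [exact: ReM_le|exact: ImM_le].
Qed.

Lemma sL2_cint f : sL2 f -> cint f.
Proof.
move=> h; have := cintM (sL2_cst 1) h.
by under eq_fun do rewrite mul1r.
Qed.

Lemma cisD (a b : R) : cis (a + b) = cis a * cis b.
Proof. by apply: complexP; rewrite ?ReM ?ImM /= ?cosD ?sinD //; ring. Qed.

Lemma cis0 : cis (0 : R) = 1.
Proof. by rewrite /cis cos0 sin0. Qed.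

Lemma conj_cis (a : R) : conjC (cis a) = cis (- a).
Proof. by apply: complexP; rewrite ?Re_conj ?Im_conj /= ?cosN ?sinN. Qed.

Lemma normsq_cis (a : R) : normsq (cis a) = 1.
Proof. by rewrite /normsq /= cos2Dsin2. Qed.

Lemma cmeas_cis (k : R) : cmeasurable (fun t => cis (k * t)).
Proof.
have mc : measurable_fun setT (@cos R).
  by apply: continuous_measurable_fun => x; exact: continuous_cos.
have ms : measurable_fun setT (@sin R).
  by apply: continuous_measurable_fun => x; exact: continuous_sin.
by split => /=; apply: measurableT_comp => //; exact: measurable_funM.
Qed.

Lemma sL2_cis (k : R) : sL2 (fun t => cis (k * t)).
Proof.
split; first exact: cmeas_cis.
by under eq_fun do rewrite normsq_cis; exact: intR_cst.
Qed.

(** The mean of a derivative of a periodic function vanishes; this computes the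
means of the characters. *)
Lemma rmean_derive (F f : R -> R) : (forall x : R, is_derive x 1 F (f x)) ->
  continuous f -> F (2 * pi) = F 0 -> rmean f = 0.
Proof.
move=> dF cf F0; rewrite /rmean /Rintegral (@continuous_FTC2 _ f F)//=.
- by rewrite F0 subrr mulr0.
- exact: twopi_gt0.
- exact: continuous_subspaceT.
- have cF : continuous F.
    move=> x; apply: differentiable_continuous; apply/derivable1_diffP.
    by have [] := dF x.
  split; [by move=> x _; have [] := dF x| |].
    exact/cvg_at_right_filter/cF.
  exact/cvg_at_left_filter/cF.
- by move=> x _; rewrite derive1E; have [_ ->] := dF x.
Qed.

Lemma cos_sin_2pin (n : nat) :
  cos (n%:R * (2 * pi)) = 1 :> R /\ sin (n%:R * (2 * pi)) = 0 :> R.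
Proof.
elim: n => [|n [IHc IHs]]; first by rewrite mul0r cos0 sin0.
have e : n.+1%:R * (2 * pi) = n%:R * (2 * pi) + pi *+ 2 :> R.
  by rewrite -natr1 mulrDl mul1r (mulr_natl pi 2).
by rewrite e cosD2pi sinD2pi IHc IHs.
Qed.

Lemma cis_2piz (k : int) : cis (k%:~R * (2 * pi)) = 1 :> C.
Proof.
have [n [-> | ->]] : exists n : nat, k = n%:Z \/ k = - n%:Z.
- by case: k => n; [exists n; left|exists n.+1; right; rewrite NegzE].
- by have [h1 h2] := cos_sin_2pin n; rewrite -pmulrn /cis h1 h2.
- have [h1 h2] := cos_sin_2pin n.
  by rewrite intrN mulNr -pmulrn -conj_cis /cis h1 h2; apply: complexP;
    rewrite ?Re_conj ?Im_conj /= ?oppr0.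
Qed.

Lemma cmean_cis (k : int) :
  cmean (fun t => cis (k%:~R * t)) = (k == 0)%:R :> C.
Proof.
have [->|k0] := eqVneq k 0.
  by rewrite -(cmean_cst 1); apply: eq_cmean => t _; rewrite mul0r cis0.
have kr0 : k%:~R != 0 :> R by rewrite intr_eq0.
have dk (x : R) : is_derive x 1 (fun t : R => k%:~R * t) (k%:~R).
  have := @is_deriveZ R R R id k%:~R x 1 1 _.
  by rewrite /GRing.scale /= mulr1; apply.
have dcomp (c : R) (f f' : R -> R) (x : R) : (forall y : R, is_derive y 1 f (f' y)) ->
    is_derive x 1 (fun t => c / k%:~R * f (k%:~R * t)) (c * f' (k%:~R * x)).
  move=> df; have d1 := @is_derive1_comp _ f _ x _ _ (df _) (dk x).
  have -> : c * f' (k%:~R * x) = (c / k%:~R) * (f' (k%:~R * x) * k%:~R).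
    by rewrite mulrACA mulVf// mulr1.
  exact: (@is_deriveZ R R R _ (c / k%:~R) x 1 _ d1).
have ck (f : R -> R) : continuous f -> continuous (fun t : R => f (k%:~R * t)).
  move=> cf x; apply: continuous_comp; last exact: cf.
  exact: mulrl_continuous.
have /eqP := cis_2piz k; rewrite eq_complex /= => /andP[/eqP c1 /eqP s0].
rewrite cmeanE; apply: complexP => /=.
  apply: (@rmean_derive (fun t => 1 / k%:~R * sin (k%:~R * t))).
  - by move=> x; rewrite -[cos _]mul1r; apply: dcomp => y; exact: is_derive_sin.
  - by apply: ck => x; exact: continuous_cos.
  - by rewrite s0 !mulr0 sin0 mulr0.
apply: (@rmean_derive (fun t => -1 / k%:~R * cos (k%:~R * t))).
- move=> x; rewrite (_ : sin _ = -1 * (- sin (k%:~R * x))); last first.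
    by rewrite mulN1r opprK.
  by apply: (dcomp _ _ (fun x => - sin x)) => y; exact: is_derive_cos.
- by apply: ck => x; exact: continuous_sin.
- by rewrite c1 mulr0 cos0.
Qed.

End ComplexMean.

(** * Density of trigonometric polynomials *)

Section Fejer.
Context {R : realType}.
Local Notation C := R[i].
Local Notation D := (@circle_arc R).
Local Notation Re := complex.Re.
Implicit Types (f g p : R -> C) (z w : C).

Definition nsq f : R := rmean (fun t => normsq (f t)).

Lemma nsq_ge0 f : 0 <= nsq f.
Proof. by apply: rmean_ge0 => t _; exact: normsq_ge0. Qed.

Lemma nsqD_le f g : sL2 f -> sL2 g ->
  nsq (fun t => f t + g t) <= 2 * nsq f + 2 * nsq g.
Proof.
move=> hf hg; have [_ i1] := sL2D hf hg; case: hf hg => [_ if_] [_ ig].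
rewrite /nsq -(rmeanZ 2 if_) -(rmeanZ 2 ig) -rmeanD; try exact: intRZ.
apply: rmean_le => //; first by apply: intRD; exact: intRZ.
by move=> t _; exact: normsqD_le.
Qed.

Lemma nsqZ z f : sL2 f -> nsq (fun t => z * f t) = normsq z * nsq f.
Proof.
move=> [_ if_]; rewrite /nsq -rmeanZ//; apply: eq_rmean => t _.
by rewrite normsqM.
Qed.

Lemma ae_eq_nsq f g : ae_on_circle (fun t => f t = g t) -> nsq f = nsq g.
Proof. by move=> fg; apply: ae_eq_rmean; apply: ae_circleS fg => t _ ->. Qed.

Definition trig p : Prop := exists s : seq (int * C),
  p = fun t => \sum_(kc <- s) kc.2 * cis (kc.1%:~R * t).

Lemma trig_mono z (k : int) : trig (fun t => z * cis (k%:~R * t)).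
Proof. by exists [:: (k, z)]; apply/funext => t; rewrite big_seq1. Qed.

Lemma trigD p q : trig p -> trig q -> trig (fun t => p t + q t).
Proof.
by move=> [s ->] [s' ->]; exists (s ++ s'); apply/funext => t; rewrite big_cat.
Qed.

Lemma trig0 : trig (fun=> 0).
Proof. by exists [::]; apply/funext => t; rewrite big_nil. Qed.

Lemma trigZ z p : trig p -> trig (fun t => z * p t).
Proof.
move=> [s ->]; exists [seq (kc.1, z * kc.2) | kc <- s]; apply/funext => t.
by rewrite mulr_sumr big_map; apply: eq_bigr => kc _; rewrite mulrA.
Qed.

Lemma trig_sum (I : Type) (s : seq I) (F : I -> R -> C) :
  (forall i, trig (F i)) -> trig (fun t => \sum_(i <- s) F i t).
Proof.
move=> h; elim: s => [|i s ih].
  by under eq_fun do rewrite big_nil; exact: trig0.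
by under eq_fun do rewrite big_cons; exact: trigD.
Qed.

Lemma trig_sL2 p : trig p -> sL2 p.
Proof. by move=> [s ->]; apply: sL2_sum => kc; apply: sL2Z; exact: sL2_cis. Qed.

Definition approximable f : Prop :=
  sL2 f /\ forall e, 0 < e -> exists2 p, trig p & nsq (fun t => f t - p t) < e.

Lemma trig_approx p : trig p -> approximable p.
Proof.
move=> tp; split; first exact: trig_sL2.
move=> e e0; exists p => //; rewrite /nsq (_ : rmean _ = 0)//.
rewrite -[RHS](rmean_cst 0); apply: eq_rmean => t _.
by rewrite subrr /normsq /= expr0n /= addr0.
Qed.

Lemma approx_lim f : sL2 f ->
  (forall e, 0 < e -> exists2 g, approximable g & nsq (fun t => f t - g t) < e) ->
  approximable f.
Proof.
move=> hf h; split => // e e0.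
have e4 : 0 < e / 4 by rewrite divr_gt0.
have [g [hg ag] fg] := h _ e4; have [p tp gp] := ag _ e4.
exists p => //.
have h1 : sL2 (fun t => f t - g t) by exact: sL2B.
have h2 : sL2 (fun t => g t - p t) by apply: sL2B => //; exact: trig_sL2.
have := nsqD_le h1 h2.
rewrite (_ : (fun t => f t - g t + (g t - p t)) = (fun t => f t - p t)); last first.
  by apply/funext => t; rewrite addrA subrK.
by move=> /le_lt_trans; apply; lra.
Qed.

Lemma approxD f g : approximable f -> approximable g ->
  approximable (fun t => f t + g t).
Proof.
move=> [hf af] [hg ag]; split; first exact: sL2D.
move=> e e0; have e4 : 0 < e / 4 by rewrite divr_gt0.
have [p tp fp] := af _ e4; have [q tq gq] := ag _ e4.
exists (fun t => p t + q t); first exact: trigD.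
have h1 : sL2 (fun t => f t - p t) by apply: sL2B => //; exact: trig_sL2.
have h2 : sL2 (fun t => g t - q t) by apply: sL2B => //; exact: trig_sL2.
have := nsqD_le h1 h2.
rewrite (_ : (fun t => f t - p t + (g t - q t)) =
  (fun t => f t + g t - (p t + q t))); last first.
  by apply/funext => t; rewrite opprD addrACA.
by move=> /le_lt_trans; apply; lra.
Qed.

Lemma approxZ z f : approximable f -> approximable (fun t => z * f t).
Proof.
move=> [hf af]; split; first exact: sL2Z.
move=> e e0; have n0 : 0 < normsq z + 1 by rewrite ltr_wpDl ?normsq_ge0.
have e1 : 0 < e / (normsq z + 1) by rewrite divr_gt0.
have [p tp fp] := af _ e1; exists (fun t => z * p t); first exact: trigZ.
under [X in nsq X]eq_fun do rewrite -mulrBr.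
rewrite nsqZ; last by apply: sL2B => //; exact: trig_sL2.
move: fp; rewrite ltr_pdivlMr// => fp; apply: le_lt_trans fp.
by rewrite mulrDr mulr1 mulrC lerDl nsq_ge0.
Qed.

Lemma approx_sum (I : Type) (s : seq I) (F : I -> R -> C) :
  (forall i, approximable (F i)) -> approximable (fun t => \sum_(i <- s) F i t).
Proof.
move=> h; elim: s => [|i s ih].
  by under eq_fun do rewrite big_nil; apply: trig_approx; exact: trig0.
by under eq_fun do rewrite big_cons; exact: approxD.
Qed.

(** Every limit passage from approximable functions to larger classes below
(arcs, countable unions, simple functions) is pointwise and dominated. *)
Lemma approx_dominated (f_ : nat -> R -> C) f (g : R -> R) :
  (forall n, approximable (f_ n)) -> sL2 f -> intR g ->
  (forall t, D t -> normsq (f t - f_ n t) @[n --> \oo] --> 0) ->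
  (forall n t, D t -> normsq (f t - f_ n t) <= g t) -> approximable f.
Proof.
move=> af hf ig cv dom; apply: approx_lim => // e e0.
have m n : measurable_fun D (fun t => normsq (f t - f_ n t)).
  by have [h _] := af n; have [m _] := sL2B hf h; exact: meas_normsq.
have dom' n t : D t -> `|normsq (f t - f_ n t)| <= g t.
  by move=> Dt; rewrite ger0_norm ?normsq_ge0// dom.
have := rmean_dominated_cvg0 m ig cv dom'.
move=> /cvgrPdist_lt /(_ e e0) [N _ /(_ N (leqnn _))].
rewrite sub0r normrN ger0_norm ?nsq_ge0// => h.
by exists (f_ N).
Qed.

(** The positive kernel |1 + ... + e^{ins}|^2 / (n + 1). *)
Definition fejer (n : nat) (s : R) : R :=
  n.+1%:R^-1 * normsq (\sum_(j < n.+1) cis (j%:R * s)).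

Lemma fejer_ge0 n s : 0 <= fejer n s.
Proof. by rewrite mulr_ge0 ?normsq_ge0 // invr_ge0. Qed.

Lemma fejerE n s : (fejer n s)%:C = n.+1%:R^-1 *
  \sum_(j < n.+1) \sum_(l < n.+1) cis ((j%:Z - l%:Z)%:~R * s).
Proof.
rewrite /fejer rmorphM fmorphV rmorph_nat /= -normsqE; congr (_ * _).
rewrite rmorph_sum mulr_suml; apply: eq_bigr => j _.
rewrite mulr_sumr; apply: eq_bigr => l _.
by rewrite /= conj_cis -cisD -mulNr -mulrDl intrB.
Qed.

Lemma cmean_cis_diff (k : int) (x : R) :
  cmean (fun t => cis (k%:~R * (x - t))) = (k == 0)%:R :> C.
Proof.
have -> : cmean (fun t => cis (k%:~R * (x - t))) =
    cis (k%:~R * x) * cmean (fun t => cis ((- k)%:~R * t)) :> C.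
  rewrite -cmeanZ; last by apply: sL2_cint; exact: sL2_cis.
  by apply: eq_cmean => t _; rewrite -cisD mulrBr intrN mulNr.
rewrite cmean_cis oppr_eq0; have [->|_] := eqVneq k 0; last by rewrite mulr0.
by rewrite mul0r cis0 mulr1.
Qed.

Lemma sL2_cis_diff (k : int) (x : R) : sL2 (fun t => cis (k%:~R * (x - t)) : C).
Proof.
have -> : (fun t => cis (k%:~R * (x - t))) =
    (fun t => cis (k%:~R * x) * cis ((- k)%:~R * t)) :> (R -> C).
  by apply/funext => t; rewrite -cisD mulrBr intrN mulNr.
by apply: sL2Z; exact: sL2_cis.
Qed.

Lemma cmean_cis_fejer (k : int) n (x : R) :
  cmean (fun t => cis (k%:~R * (x - t)) * (fejer n (x - t))%:C) =
  n.+1%:R^-1 * \sum_(j < n.+1) \sum_(l < n.+1) (k + (j%:Z - l%:Z) == 0)%:R.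
Proof.
rewrite (@eq_cmean _ _ (fun t => n.+1%:R^-1 * \sum_(j < n.+1) \sum_(l < n.+1)
    cis ((k + (j%:Z - l%:Z))%:~R * (x - t)))); last first.
  move=> t _; rewrite fejerE mulrCA; congr (_ * _).
  rewrite mulr_sumr; apply: eq_bigr => j _; rewrite mulr_sumr.
  by apply: eq_bigr => l _; rewrite -cisD -mulrDl -intrD.
have ci j l := sL2_cint (sL2_cis_diff (k + (Posz j - Posz l)) x).
rewrite cmeanZ; last by apply: cint_sum => j; apply: cint_sum => l; exact: ci.
rewrite cmean_sum; last by move=> j; apply: cint_sum => l; exact: ci.
congr (_ * _); apply: eq_bigr => j _; rewrite cmean_sum; last by move=> l; exact: ci.
by apply: eq_bigr => l _; exact: cmean_cis_diff.
Qed.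

Lemma rmean_fejer n (x : R) : rmean (fun t => fejer n (x - t)) = 1.
Proof.
have := cmean_cis_fejer 0 n x.
rewrite (@eq_cmean _ _ (fun t => (fejer n (x - t))%:C)); last first.
  by move=> t _; rewrite mul0r cis0 mul1r.
rewrite cmeanE /= (eq_bigr (fun=> 1)); last first.
  move=> j _; rewrite (bigD1 j)//= subrr addr0 eqxx big1 ?addr0// => l lj.
  by rewrite add0r subr_eq0 eqz_nat eq_sym -[_ == _]/(l == j) (negbTE lj).
rewrite sumr_const card_ord mulVf ?pnatr_eq0//.
by move=> /(congr1 (@complex.Re R)).
Qed.

Lemma rmean_cos_fejer n (x : R) :
  rmean (fun t => cos (x - t) * fejer n (x - t)) = n%:R / n.+1%:R.
Proof.
have -> : rmean (fun t => cos (x - t) * fejer n (x - t)) =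
    Re (cmean (fun t => cis (1%:~R * (x - t)) * (fejer n (x - t))%:C)).
  by apply: eq_rmean => t _; rewrite ReM /= mul1r mulr0 subr0.
rewrite cmean_cis_fejer.
rewrite (eq_bigr (fun j : 'I_n.+1 => ((j < n)%N)%:R)); last first.
  move=> j _; under eq_bigr do rewrite addrA subr_eq0 -PoszD eqz_nat add1n.
  have [jn|jn] := ltnP j n.
    rewrite (bigD1 (Ordinal (jn : (j.+1 < n.+1)%N)))//= eqxx big1 ?addr0// => l lj.
    by have /negbTE := lj; rewrite -val_eqE /= eq_sym => ->.
  rewrite big1// => l _; rewrite gtn_eqF//.
  by rewrite (leq_trans (ltn_ord l)).
rewrite big_ord_recr /= ltnn addr0 (eq_bigr (fun=> 1)); last by move=> j _; rewrite ltn_ord.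
rewrite sumr_const card_ord mulrC.
by rewrite -(rmorph_nat (real_complex R) n) -(rmorph_nat (real_complex R) n.+1)
  -fmorphV -rmorphM.
Qed.

Lemma meas_fejer n (x : R) : measurable_fun D (fun t => fejer n (x - t)).
Proof.
apply: measurable_funM => //; apply: meas_normsq; apply: cmeas_sum => j.
by have [] := sL2_cis_diff j x.
Qed.

Lemma intR_fejer n (x : R) : intR (fun t => fejer n (x - t)).
Proof.
have [+ _] : cint (fun t => n.+1%:R^-1 *
    \sum_(j < n.+1) \sum_(l < n.+1) cis ((j%:Z - l%:Z)%:~R * (x - t)) : C).
  apply: cintZ; apply: cint_sum => j; apply: cint_sum => l.
  by apply: sL2_cint; exact: sL2_cis_diff.
by under eq_fun do rewrite -fejerE.
Qed.

Lemma rmean_norm_le (f g : R -> R) : intR f -> intR g ->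
  (forall t, D t -> `|f t| <= g t) -> `|rmean f| <= rmean g.
Proof.
move=> if_ ig fg; rewrite ler_norml -rmeanN//; apply/andP; split;
  apply: rmean_le => //; try exact: intRN; move=> t /fg; rewrite ler_norml;
  by case/andP.
Qed.

(** Korovkin's argument: convolving f with the Fejer kernel produces trigonometric
polynomials, and the error at x is a mean of |f x - f t| against a positive kernel
of mean 1.  Where |f x - f t| is controlled by 1 - cos (x - t), so is the error,
because the mean of 1 - cos against the kernel is 1 / (n + 1). *)
Lemma fejer_korovkin (f : R -> R) M : measurable_fun D f ->
  (forall t, D t -> `|f t| <= M) ->
  (forall e, 0 < e -> exists2 c, 0 <= c & forall x t, D x -> D t ->
     `|f x - f t| <= e + c * (1 - cos (x - t))) ->
  approximable (fun t => (f t)%:C).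
Proof.
move=> mf fM fmod.
have mfC : cmeasurable (fun t => (f t)%:C) by split => //; exact: measurable_cst.
have f2 : sL2 (fun t => (f t)%:C).
  split=> //; apply: (@intR_bounded _ _ (M ^+ 2)); first exact: meas_normsq.
  move=> t Dt; rewrite ger0_norm ?normsq_ge0// /normsq /= expr0n addr0.
  by rewrite -(real_normK (num_real _)); apply: lerXn2r; rewrite ?nnegrE ?fM// (le_trans _ (fM _ Dt)).
have ifK n x : intR (fun t => f t * fejer n (x - t)).
  have i1 := intRZ M (intR_fejer n x); apply: intR_le i1.
    by apply: measurable_funM => //; exact: meas_fejer.
  by move=> t Dt; rewrite normrM (ger0_norm (fejer_ge0 _ _)) ler_wpM2r ?fejer_ge0 ?fM.
pose g n x := (rmean (fun t => f t * fejer n (x - t)))%:C.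
have tg n : trig (g n).
  have ci k x : cint (fun t => (f t)%:C * (cis (k%:~R * (x - t)))).
    by apply: cintM => //; exact: sL2_cis_diff.
  have -> : g n = (fun x => n.+1%:R^-1 * \sum_(j < n.+1) \sum_(l < n.+1)
      cmean (fun t => (f t)%:C * cis ((- (j%:Z - l%:Z))%:~R * t)) *
      cis ((j%:Z - l%:Z)%:~R * x)).
    apply/funext => x; rewrite /g.
    have -> : (rmean (fun t => f t * fejer n (x - t)))%:C =
        cmean (fun t => (f t)%:C * (fejer n (x - t))%:C).
      rewrite cmeanE; apply: (congr2 (@Complex R)).
        by apply: eq_rmean => t _; rewrite ReM /= mulr0 subr0.
      rewrite -[LHS](rmean_cst 0); apply: eq_rmean => t _.
      by rewrite ImM /= mulr0 mul0r addr0.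
    rewrite (@eq_cmean _ _ (fun t => n.+1%:R^-1 * \sum_(j < n.+1) \sum_(l < n.+1)
        (f t)%:C * cis ((j%:Z - l%:Z)%:~R * (x - t)))); last first.
      move=> t _; rewrite fejerE mulrCA; congr (_ * _).
      by rewrite mulr_sumr; apply: eq_bigr => j _; rewrite mulr_sumr.
    rewrite cmeanZ; last by apply: cint_sum => j; apply: cint_sum => l; exact: ci.
    rewrite cmean_sum; last by move=> j; apply: cint_sum => l; exact: ci.
    congr (_ * _); apply: eq_bigr => j _; rewrite cmean_sum; last by move=> l; exact: ci.
    apply: eq_bigr => l _; rewrite [RHS]mulrC -cmeanZ; last first.
      by apply: cintM => //; exact: sL2_cis.
    apply: eq_cmean => t _; rewrite mulrCA -cisD; congr (_ * cis _).
    by rewrite intrN mulrBr mulNr.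
  apply: trigZ; apply: trig_sum => j; apply: trig_sum => l; exact: trig_mono.
apply: approx_lim => // e e0.
(* chosen so that (2 e')^2 <= e / 2 *)
pose e' := Num.min (1 / 2) (e / 4).
have e'0 : 0 < e' by rewrite lt_min; apply/andP; split; lra.
have e'1 : e' <= 1 / 2 by rewrite ge_min lexx.
have e'2 : e' <= e / 4 by rewrite ge_min lexx orbT.
have [c c0 fc] := fmod _ e'0.
have [n nc] : exists n, c / n.+1%:R <= e'.
  exists (Num.truncn (c / e')); rewrite ler_pdivrMr// mulrC -ler_pdivrMr//.
  by apply: ltW; apply: Num.Theory.truncnS_gt; rewrite divr_ge0// ltW.
exists (g n); first exact: trig_approx.
have bnd x : D x -> normsq ((f x)%:C - g n x) <= (e' + e') ^+ 2.
  move=> Dx; rewrite /normsq /= subr0 expr0n addr0 -(real_normK (num_real _)).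
  have ee0 : 0 <= e' + e' by rewrite addr_ge0// ltW.
  apply: lerXn2r; rewrite ?nnegrE//.
  have -> : f x - rmean (fun t => f t * fejer n (x - t)) =
      rmean (fun t => (f x - f t) * fejer n (x - t)).
    rewrite -[X in X - _]mulr1 -(rmean_fejer n x) -rmeanZ; last exact: intR_fejer.
    rewrite -rmeanB//; last by apply: intRZ; exact: intR_fejer.
    by apply: eq_rmean => t _; rewrite mulrBl.
  have icK : intR (fun t => cos (x - t) * fejer n (x - t)).
    apply: intR_le (intR_fejer n x).
      apply: measurable_funM; last exact: meas_fejer.
      by have [[]] := sL2_cis_diff 1 x; under eq_fun do rewrite mul1r.
    move=> t _; rewrite normrM (ger0_norm (fejer_ge0 _ _)) ler_piMl ?fejer_ge0//.
    by rewrite ler_norml cos_geN1 cos_le1.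
  have iK := intR_fejer n x.
  have -> : e' + e' = e' * 1 + e' by rewrite mulr1.
  apply: (@le_trans _ _ (e' * 1 + c * (1 - n%:R / n.+1%:R))); last first.
    rewrite lerD2l (le_trans _ nc)// -[X in X - _](@divff _ n.+1%:R) ?pnatr_eq0//.
    by rewrite -mulrBl -natr1 addrAC subrr add0r mul1r.
  have -> : e' * 1 + c * (1 - n%:R / n.+1%:R) = rmean (fun t =>
      e' * fejer n (x - t) +
      c * (fejer n (x - t) - cos (x - t) * fejer n (x - t))).
    rewrite rmeanD; [|exact: intRZ|by apply: intRZ; exact: intRB].
    rewrite (rmeanZ e' iK) (rmeanZ c (intRB iK icK)).
    by rewrite rmeanB// rmean_fejer rmean_cos_fejer.
  apply: rmean_norm_le.
  - under eq_fun do rewrite mulrBl.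
    by apply: intRB => //; exact: intRZ.
  - by apply: intRD; [exact: intRZ|apply: intRZ; exact: intRB].
  - move=> t Dt; rewrite normrM (ger0_norm (fejer_ge0 _ _)).
    have -> : e' * fejer n (x - t) +
        c * (fejer n (x - t) - cos (x - t) * fejer n (x - t)) =
        (e' + c * (1 - cos (x - t))) * fejer n (x - t) by ring.
    by rewrite ler_wpM2r ?fejer_ge0// fc.
have [_ i1] := sL2B f2 (trig_sL2 (tg n)).
apply: (@le_lt_trans _ _ (rmean (fun=> (e' + e') ^+ 2))).
  by apply: rmean_le => //; exact: intR_cst.
by rewrite rmean_cst; nra.
Qed.

End Fejer.

Section Arcs.
Context {R : realType}.
Local Notation C := R[i].
Local Notation D := (@circle_arc R).
Implicit Types (f g p : R -> C) (z w : C).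

Lemma approx_ae f g : approximable f -> cmeasurable g ->
  ae_on_circle (fun t => f t = g t) -> approximable g.
Proof.
move=> [[mf if_] af] mg fg; split.
  split=> //; apply: intR_le_ae if_; first exact: meas_normsq.
  by apply: ae_circleS fg => t _ ->; rewrite ger0_norm ?normsq_ge0.
move=> e /af[p tp pe]; exists p => //.
rewrite -(@ae_eq_nsq _ (fun t => f t - p t))//.
by apply: ae_circleS fg => t _ ->.
Qed.

Lemma ae_circle_neq (a : R) : ae_on_circle (fun t => t != a).
Proof.
exists [set a]; split => //; first by rewrite lebesgue_measure_set1.
by move=> t /= /not_implyP[_ /negP]; rewrite negbK => /eqP.
Qed.

Lemma meas_indic_circle (A : set R) : measurable A ->
  cmeasurable (fun t => (\1_A t)%:C).
Proof.
move=> mA; split => /=; last exact: measurable_cst.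
exact: measurable_indic.
Qed.

Lemma sL2_indic (A : set R) : measurable A -> sL2 (fun t => (\1_A t : R)%:C).
Proof.
move=> mA; have m := meas_indic_circle mA; split => //.
apply: (@intR_bounded _ _ 1); first exact: meas_normsq.
move=> t _; rewrite ger0_norm ?normsq_ge0// /normsq /= expr0n addr0 indicE.
by case: (_ \in _); rewrite ?expr1n ?expr0n.
Qed.

Definition clip (x : R) : R := Num.max 0 (Num.min 1 x).

Lemma clip_lip x y : `|clip x - clip y| <= `|x - y|.
Proof.
have mono (u v : R) : u <= v -> 0 <= clip v - clip u <= v - u.
  rewrite /clip => uv; case: (leP 1 u) => u1; case: (leP 1 v) => v1;
    rewrite ?(max_r ler01); case: (leP 0 u) => u0; case: (leP 0 v) => v0;
    apply/andP; split; lra.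
have [xy|/ltW xy] := leP x y.
  rewrite distrC [X in _ <= X]distrC; have /andP[h1 h2] := mono _ _ xy.
  by rewrite (ger0_norm h1) ger0_norm ?subr_ge0.
by have /andP[h1 h2] := mono _ _ xy; rewrite (ger0_norm h1) ger0_norm ?subr_ge0.
Qed.

Lemma clip_itv x : 0 <= clip x <= 1.
Proof.
by rewrite /clip; case: (leP 1 x) => x1; rewrite ?(max_r ler01) ?lexx ?ler01//;
  case: (leP 0 x) => x0; apply/andP; split; lra.
Qed.

(** Functions that are Lipschitz for the chordal distance satisfy the hypothesis of
[fejer_korovkin]: the squared chord is 2 (1 - cos), and n d <= e + (n d)^2 / (4 e). *)
Lemma arc_fun_lip (n c x t : R) : 0 <= n ->
  forall e, 0 < e -> n * `|cos (x - c) - cos (t - c)| <=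
     e + n ^+ 2 / (2 * e) * (1 - cos (x - t)).
Proof.
move=> n0 e e0.
set d := `|_|.
have d2 : d ^+ 2 <= 2 * (1 - cos (x - t)).
  rewrite /d real_normK ?num_real//.
  rewrite (_ : x - t = (x - c) - (t - c)); last by ring.
  rewrite (cosB (x - c) (t - c)); have := cos2Dsin2 (x - c); have := cos2Dsin2 (t - c).
  have := sqr_ge0 (sin (x - c) - sin (t - c)); nra.
apply: (@le_trans _ _ (e + n ^+ 2 / (2 * e) * (d ^+ 2 / 2))); last first.
  rewrite lerD2l ler_wpM2l//; last lra.
  by rewrite mulr_ge0 ?sqr_ge0// invr_ge0; lra.
have -> : e + n ^+ 2 / (2 * e) * (d ^+ 2 / 2) =
  (e ^+ 2 + (n * d / 2) ^+ 2) / e by field; rewrite gt_eqF.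
rewrite ler_pdivlMr//; have := sqr_ge0 (e - n * d / 2); nra.
Qed.

Lemma arc_signE (a t : R) :
  cos (a / 2) - cos (t - a / 2) = 2 * (sin (t / 2) * sin ((t - a) / 2)).
Proof.
have -> : a / 2 = t / 2 - (t - a) / 2 by field.
have -> : t - (t / 2 - (t - a) / 2) = t / 2 + (t - a) / 2 by field.
by rewrite cosB cosD; ring.
Qed.

(** The function cos (a / 2) - cos (t - a / 2) is positive exactly on the open arc
from a to 2 pi, so its multiples by n, clipped to the unit interval, converge
pointwise to the indicator of the arc. *)
Lemma approx_arc (a : R) : 0 <= a < 2 * pi ->
  approximable (fun t => (\1_(`]a, (2 * pi)[%classic) t : R)%:C).
Proof.
move=> /andP[a0 a2].
pose h t := cos (a / 2) - cos (t - a / 2).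
have mh : measurable_fun D h.
  apply: measurable_funB => //; apply: measurableT_comp.
    by apply: continuous_measurable_fun => x; exact: continuous_cos.
  exact: measurable_funB.
have cl n t : 0 <= clip (n%:R * h t) <= 1 by exact: clip_itv.
apply: (@approx_dominated R (fun n t => (clip (n%:R * h t))%:C) _ (fun=> 1)).
- move=> n; apply: (@fejer_korovkin R _ 1).
  + apply: measurable_maxr => //; apply: measurable_minr => //.
    exact: measurable_funM.
  + by move=> t _; rewrite ger0_norm; case/andP: (cl n t).
  + move=> e e0; exists (n%:R ^+ 2 / (2 * e)).
      by rewrite mulr_ge0 ?sqr_ge0// invr_ge0; lra.
    move=> x t _ _; apply: le_trans (clip_lip _ _) _.
    apply: le_trans (arc_fun_lip (a / 2) x t (ler0n _ n) e0).
    rewrite -mulrBr normrM ger0_norm// ler_wpM2l// /h opprB addrCA addrAC.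
    by rewrite subrr add0r distrC.
- exact: sL2_indic.
- exact: intR_cst.
- move=> t; rewrite /circle_arc /= in_itv /= => /andP[t0 t2].
  have [at2|at2] := boolP (a < t < 2 * pi).
    have h0 : 0 < h t.
      case/andP: at2 => at1 t2'.
      rewrite /h arc_signE !mulr_gt0// sin_gt0_pi//; apply/andP; split; lra.
    apply: cvg_near_cst; near=> n.
    have n1 : 1 <= n%:R * h t.
      rewrite -ler_pdivrMr// div1r; near: n; exact: nbhs_infty_ger.
    rewrite indicE mem_set /=; last by rewrite in_itv.
    by rewrite /clip (min_l n1) max_r// subrr /normsq /= expr0n addr0.
  have h0 : h t <= 0.
    rewrite /h arc_signE; move: at2; rewrite negb_and -!leNgt => /orP[ta|t2'].
      have s1 : 0 <= sin (t / 2) by rewrite sin_ge0_pi//; apply/andP; split; lra.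
      have s2 : 0 <= sin ((a - t) / 2).
        by rewrite sin_ge0_pi//; apply/andP; split; lra.
      rewrite -[t - a]opprB mulNr sinN; nra.
    have -> : t = 2 * pi by apply/eqP; rewrite eq_le t2 t2'.
    rewrite (_ : 2 * pi / 2 = pi); last by field.
    by rewrite sinpi mul0r mulr0.
  apply: cvg_near_cst; near=> n.
  rewrite indicE memNset /=; last by rewrite in_itv /=; apply/negP.
  rewrite /clip; have n0 : n%:R * h t <= 0 by rewrite mulr_ge0_le0.
  rewrite min_r; last by rewrite (le_trans n0).
  by rewrite max_l// subrr /normsq /= expr0n addr0.
- move=> n t _; rewrite /normsq /= subrr expr0n addr0 indicE.
  have /andP[c0 c1] := cl n t; case: (_ \in _) => /=; nra.
Unshelve. all: by end_near. Qed.

Lemma approx_ray (a : R) : approximable (fun t => (\1_(`]a, +oo[%classic) t : R)%:C).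
Proof.
have m1 : measurable (`]a, +oo[%classic : set R) by exact: measurable_itv.
have [a0|a0] := ltP a 0.
  apply: (@approx_ae (fun=> 1)); last 2 first.
  - exact: meas_indic_circle.
  - apply: ae_circleT => t; rewrite /circle_arc /= in_itv /= => /andP[t0 t2].
    by rewrite indicE mem_set //= in_itv /= andbT (lt_le_trans a0).
  have := trig_approx (trig_mono (R := R) 1 0).
  by under eq_fun do rewrite mul0r cis0 mulr1.
have [a2|a2] := ltP a (2 * pi); last first.
  apply: (@approx_ae (fun=> 0)); last 2 first.
  - exact: meas_indic_circle.
  - apply: ae_circleT => t; rewrite /circle_arc /= in_itv /= => /andP[t0 t2].
    rewrite indicE memNset //= in_itv /= andbT; apply/negP.
    by rewrite -leNgt (le_trans t2).
  by apply: trig_approx; exact: trig0.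
apply: (approx_ae (f := fun t => (\1_(`]a, (2 * pi)[%classic) t : R)%:C)).
- by apply: approx_arc; rewrite a0.
- exact: meas_indic_circle.
- apply: ae_circleS (ae_circle_neq (2 * pi)) => t.
  rewrite /circle_arc /= in_itv /= => /andP[t0 t2] tn2; congr (_%:C).
  rewrite !indicE; congr (_%:R); congr (nat_of_bool _).
  by apply/idP/idP; rewrite !mem_setE !in_itv /= ?andbT ?lt_neqAle ?tn2 ?t2 ?andbT.
Qed.

End Arcs.

Section BorelSets.
Context {R : realType}.
Local Notation C := R[i].
Local Notation D := (@circle_arc R).
Implicit Types (f g p : R -> C) (z w : C).

(** The sets with approximable indicator form a Dynkin system, and it contains the
rays, which generate the Borel sets and are stable under intersection. *)
Lemma approx_indic (A : set R) : measurable A ->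
  approximable (fun t => (\1_A t : R)%:C).
Proof.
move=> mA; have {mA} : <<s @RGenOInfty.G R >> A.
  by have <- : (@measurable _ (measurableTypeR R)) = <<s @RGenOInfty.G R >>
    := @RGenOInfty.measurableE R.
move: A; apply: (@dynkin_induction _ (measurableTypeR R) (@RGenOInfty.G R)
  [set A | approximable (fun t => (\1_A t : R)%:C)]).
- exact: RGenOInfty.measurableE.
- move=> _ _ [x ->] [y ->]; exists (Num.max x y).
  apply/seteqP; split => t; rewrite /= !in_itv /= !andbT gt_max.
    by move=> [-> ->].
  by move=> /andP.
- rewrite /=; apply: (approx_ae (trig_approx (trig_mono (R := R) 1 0))).
    exact: meas_indic_circle.
  by apply: ae_circleT => t _; rewrite mul0r cis0 mulr1 indicT.
- by move=> _ [x ->]; exact: approx_ray.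
- move=> S mS aS /=.
  apply: (approx_ae (approxD (trig_approx (trig_mono (R := R) 1 0)) (approxZ (-1) aS))).
    by apply: meas_indic_circle; exact: measurableC.
  apply: ae_circleT => t _; rewrite mul0r cis0 mulr1 !indicE in_setC.
  by case: (t \in S); rewrite ?mulr1 ?mulr0 ?subrr ?addr0.
- move=> F mF tF aF /=.
  have sumE n t : \sum_(k < n) (\1_(F k) t : R)%:C =
      (\1_(\big[setU/set0]_(k < n) F k) t)%:C.
    elim: n => [|n IH]; first by rewrite !big_ord0 indic0.
    rewrite !big_ord_recr /= IH -rmorphD; congr (_%:C).
    rewrite !indicE in_setU; have [tn|] := boolP (t \in F n); last by rewrite orbF addr0.
    rewrite (_ : t \in _ = false) ?add0r//; apply/negbTE; rewrite notin_setE.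
    rewrite -bigcup_mkord => -[k /= kn Fkt].
    have /(_ k n) := tF; rewrite /= => h.
    have := h I I (ex_intro _ t (conj Fkt (set_mem tn))) => kE.
    by rewrite kE ltnn in kn.
  apply: (@approx_dominated R
    (fun n t => \sum_(k < n) (\1_(F k) t : R)%:C) _ (fun=> 1)).
  + by move=> n; apply: approx_sum => k; exact: aF.
  + by apply: sL2_indic; apply: bigcup_measurable => k _; exact: mF.
  + exact: intR_cst.
  + move=> t _.
    have [N hN] : exists N, forall n, (N <= n)%N ->
        (\1_(\bigcup_k F k) t : R) = \1_(\big[setU/set0]_(k < n) F k) t.
      have [[k _ Fkt]|nt] := pselect ((\bigcup_k F k) t).
        exists k.+1 => n kn; rewrite !indicE !mem_set//; last by exists k.
        by rewrite -bigcup_mkord; exists k.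
      exists 0%N => n _; rewrite !indicE !memNset// -bigcup_mkord => -[k _ Fkt].
      by apply: nt; exists k.
    apply: cvg_near_cst; near=> n; rewrite sumE -hN.
      by rewrite subrr /normsq /= expr0n addr0.
    by near: n; exact: nbhs_infty_ge.
  + move=> n t _; rewrite sumE -rmorphB /normsq /= expr0n addr0.
    by rewrite !indicE; do 2 case: (_ \in _); rewrite ?subrr ?subr0 ?sub0r ?sqrrN ?expr1n ?expr0n.
Unshelve. all: by end_near. Qed.

Import HBSimple.
Import HBNNSimple.

Lemma approx_nonneg (h : R -> R) : measurable_fun D h ->
  intR (fun t => h t ^+ 2) -> (forall t, 0 <= h t) ->
  approximable (fun t => (h t)%:C).
Proof.
move=> mh ih h0.
have mhE : measurable_fun D (EFin \o h) by exact/measurable_EFinP.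
have h0E t : D t -> (0 <= (EFin \o h) t)%E by move=> _; rewrite lee_fin.
pose a n t : R := nnsfun_approx (mcircle (R := R)) mhE n t.
have a0 n t : 0 <= a n t by [].
have ah n t : D t -> a n t <= h t.
  by move=> Dt; rewrite -lee_fin /a nnsfun_approxE; exact: (le_approx n h0E Dt).
have acv t : D t -> a n t @[n --> \oo] --> h t.
  by move=> Dt; have /fine_cvgP[_] := cvg_nnsfun_approx (mcircle (R := R)) mhE h0E Dt.
apply: (@approx_dominated R (fun n t => (a n t)%:C) _ (fun t => h t ^+ 2)) => //.
- move=> n.
  have -> : (fun t => (a n t)%:C) = (fun t =>
      \sum_(y <- fset_set (range (a n))) y%:C * (\1_(a n @^-1` [set y]) t)%:C).
    apply/funext => t; rewrite /a [in LHS]fimfunE fsbig_finite// rmorph_sum /=.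
    by apply: eq_bigr => i _; rewrite rmorphM.
  apply: approx_sum => i; apply: approxZ; apply: approx_indic.
  exact: (measurable_funPTI (nnsfun_approx (mcircle (R := R)) mhE n) (measurable_set1 i)).
- split; first by split => //; exact: measurable_cst.
  by under eq_fun do rewrite /normsq /= expr0n addr0.
- move=> t Dt.
  have c0 : (h t - a n t) @[n --> \oo] --> 0.
    by rewrite -(subrr (h t)); apply: cvgB; [exact: cvg_cst|exact: acv].
  have c2 : ((h t - a n t) * (h t - a n t)) @[n --> \oo] --> 0.
    by rewrite -[X in _ --> X](mulr0 0); exact: cvgM.
  apply: cvg_trans c2; apply: near_eq_cvg; near=> n.
  by rewrite /normsq /= subrr expr0n addr0 expr2.
- move=> n t Dt; rewrite /normsq /= subrr expr0n addr0.
  by have := a0 n t; have := ah n _ Dt; nra.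
Unshelve. all: by end_near. Qed.

(** Completeness of the characters. *)
Lemma approx_L2 f : sL2 f -> approximable f.
Proof.
move=> [[m1 m2] if_].
have real (h : R -> R) : measurable_fun D h ->
    (forall t, h t ^+ 2 <= normsq (f t)) -> approximable (fun t => (h t)%:C).
  move=> mh hf.
  have pos (k : R -> R) : measurable_fun D k ->
      (forall t, k t ^+ 2 <= normsq (f t)) ->
      approximable (fun t => (Num.max (k t) 0)%:C).
    move=> mk kf.
    have mm : measurable_fun D (fun t => Num.max (k t) 0).
      by apply: measurable_maxr.
    apply: approx_nonneg => //; last by move=> t; rewrite le_max lexx orbT.
    apply: intR_le if_; first exact: measurable_funX.
    move=> t _; rewrite ger0_norm ?sqr_ge0// (le_trans _ (kf t))//.
    by case: (leP (k t) 0) => // _; rewrite expr0n sqr_ge0.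
  have ap := pos _ mh hf.
  have an : approximable (fun t => (Num.max (- h t) 0)%:C).
    by apply: pos => [|t]; [exact: measurableT_comp|rewrite sqrrN].
  have := approxD ap (approxZ (-1) an).
  congr (approximable _); apply/funext => t; rewrite mulN1r -rmorphB; congr (_%:C).
  by case: (leP (h t) 0) => h0; case: (leP (- h t) 0) => h1; lra.
have a1 := real _ m1; have a2 := real _ m2.
have := approxD (a1 _) (approxZ 'i (a2 _)).
rewrite (_ : (fun t => _) = f); last first.
  by apply/funext => t; apply: complexP;
    rewrite ?ReD ?ImD ?ReM ?ImM /=; ring.
by apply => t; rewrite /normsq ?lerDl ?lerDr ?sqr_ge0.
Qed.

End BorelSets.

(** * Fourier coefficients of matrix functions *)

Section VectorL2.
Context {R : realType}.
Local Notation C := R[i].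
Local Notation D := (@circle_arc R).

Section Shape.
Context {m n : nat}.
Implicit Types f g : circle_fun R m n.

Lemma L2P f : L2 f <-> forall i j, sL2 (fun t => f t i j).
Proof. by []. Qed.

Lemma L1P f : L1 f <-> forall i j, cint (fun t => f t i j).
Proof. by []. Qed.

Lemma L2D f g : L2 f -> L2 g -> L2 (fun t => f t + g t).
Proof.
move=> hf hg; apply/L2P => i j; under eq_fun do rewrite mxE; exact: sL2D.
Qed.

Lemma L2Z (z : C) f : L2 f -> L2 (fun t => z *: f t).
Proof.
move=> hf; apply/L2P => i j; under eq_fun do rewrite mxE; exact: sL2Z.
Qed.

Lemma L2N f : L2 f -> L2 (fun t => - f t).
Proof. by move=> /(L2Z (-1)); under eq_fun do rewrite scaleN1r. Qed.

Lemma L2B f g : L2 f -> L2 g -> L2 (fun t => f t - g t).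
Proof. by move=> hf hg; apply: L2D => //; exact: L2N. Qed.

Lemma L2_cst (A : 'M[C]_(m, n)) : L2 (fun=> A).
Proof. by move=> i j; exact: sL2_cst. Qed.

Lemma L2_sum (I : Type) (s : seq I) (F : I -> circle_fun R m n) :
  (forall i, L2 (F i)) -> L2 (fun t => \sum_(i <- s) F i t).
Proof.
move=> h; elim: s => [|i s ih].
  by under eq_fun do rewrite big_nil; exact: L2_cst.
by under eq_fun do rewrite big_cons; exact: L2D.
Qed.

Lemma L2_cisM (k : R) f : L2 f -> L2 (fun t => cis (k * t) *: f t).
Proof.
move=> hf; apply/L2P => i j; under eq_fun do rewrite mxE.
apply: (@sL2_mul _ _ _ 1) => //; first exact: cmeas_cis.
by apply: ae_circleT => t _; rewrite normsq_cis.
Qed.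

Lemma L2_L1 f : L2 f -> L1 f.
Proof. by move=> hf i j; exact: sL2_cint. Qed.

Lemma cint_cisM (k : R) (h : R -> C) : cint h -> cint (fun t => cis (k * t) * h t).
Proof.
move=> ih; have mh := cint_meas ih; case: ih => i1 i2.
have [m1 m2] := cmeasM (cmeas_cis k) mh.
have i3 := intRD (intR_norm i1) (intR_norm i2).
have c1 t : `|cos (k * t)| <= 1 by rewrite ler_norml cos_geN1 cos_le1.
have s1 t : `|sin (k * t)| <= 1 by rewrite ler_norml sin_geN1 sin_le1.
split; apply: intR_le i3 => // t _; rewrite ?ReM ?ImM /=.
  apply: le_trans (ler_normB _ _) _; rewrite !normrM.
  by apply: lerD; rewrite ler_piMl.
apply: le_trans (ler_normD _ _) _; rewrite !normrM addrC.
by apply: lerD; rewrite ler_piMl.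
Qed.

Lemma L1D f g : L1 f -> L1 g -> L1 (fun t => f t + g t).
Proof.
move=> hf hg; apply/L1P => i j; under eq_fun do rewrite mxE.
by apply: cintD; [exact: hf|exact: hg].
Qed.

Lemma L1Z z f : L1 f -> L1 (fun t => z *: f t).
Proof.
move=> hf; apply/L1P => i j; under eq_fun do rewrite mxE.
by apply: cintZ; exact: hf.
Qed.

Lemma L1B f g : L1 f -> L1 g -> L1 (fun t => f t - g t).
Proof.
move=> hf hg; under eq_fun do rewrite -scaleN1r.
by apply: L1D => //; exact: L1Z.
Qed.

Lemma L1_cisM (k : R) f : L1 f -> L1 (fun t => cis (k * t) *: f t).
Proof. by move=> hf; apply/L1P => i j; under eq_fun do rewrite mxE; apply: cint_cisM; exact: hf. Qed.

Lemma mxmeanD f g : L1 f -> L1 g ->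
  mxmean (fun t => f t + g t) = mxmean f + mxmean g.
Proof.
move=> hf hg; apply/matrixP => i j; rewrite !mxE -cmeanD; try exact: hf; try exact: hg.
by apply: eq_cmean => t _; rewrite mxE.
Qed.

Lemma mxmeanZ z f : L1 f -> mxmean (fun t => z *: f t) = z *: mxmean f.
Proof.
move=> hf; apply/matrixP => i j; rewrite !mxE -cmeanZ; try exact: hf.
by apply: eq_cmean => t _; rewrite mxE.
Qed.

Lemma mxmean_cst (A : 'M[C]_(m, n)) : mxmean (fun=> A) = A.
Proof. by apply/matrixP => i j; rewrite !mxE cmean_cst. Qed.

Lemma eq_mxmean f g : (forall t, D t -> f t = g t) -> mxmean f = mxmean g.
Proof.
move=> fg; apply/matrixP => i j; rewrite !mxE.
by apply: eq_cmean => t /fg ->.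
Qed.

Lemma mxmeanB f g : L1 f -> L1 g ->
  mxmean (fun t => f t - g t) = mxmean f - mxmean g.
Proof.
move=> hf hg; rewrite -[in RHS]scaleN1r -mxmeanZ// -mxmeanD//; last exact: L1Z.
by apply: eq_mxmean => t _; rewrite scaleN1r.
Qed.

Lemma ae_eq_mxmean f g : ae_equal f g -> mxmean f = mxmean g.
Proof.
move=> fg; apply/matrixP => i j; rewrite !mxE; apply: ae_eq_cmean.
by apply: ae_circleS fg => t _ ->.
Qed.

Lemma fourierD f g k : L1 f -> L1 g ->
  fourier (fun t => f t + g t) k = fourier f k + fourier g k.
Proof.
move=> hf hg; rewrite /fourier.
under eq_fun do rewrite -mulNr -intrN.
rewrite -[in RHS]mxmeanD//; last 2 first.
- by under eq_fun do rewrite -mulNr; exact: L1_cisM.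
- by under eq_fun do rewrite -mulNr; exact: L1_cisM.
by apply: eq_mxmean => t _; rewrite scalerDr intrN mulNr.
Qed.

Lemma fourierZ z f k : L1 f -> fourier (fun t => z *: f t) k = z *: fourier f k.
Proof.
move=> hf; rewrite /fourier -mxmeanZ; last first.
  by under eq_fun do rewrite -mulNr; exact: L1_cisM.
by apply: eq_mxmean => t _; rewrite !scalerA mulrC.
Qed.

Lemma fourierB f g k : L1 f -> L1 g ->
  fourier (fun t => f t - g t) k = fourier f k - fourier g k.
Proof.
move=> hf hg; have := fourierD k hf (L1Z (-1) hg).
rewrite (fourierZ _ _ hg) scaleN1r => <-.
by apply: eq_mxmean => t _; rewrite scaleN1r.
Qed.

Lemma fourier0 k : fourier (fun=> 0 : 'M[C]_(m, n)) k = 0.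
Proof.
rewrite -[RHS]mxmean_cst; apply: eq_mxmean => t _; by rewrite scaler0.
Qed.

Lemma fourier_sum (I : Type) (s : seq I) (F : I -> circle_fun R m n) k :
  (forall i, L1 (F i)) ->
  fourier (fun t => \sum_(i <- s) F i t) k = \sum_(i <- s) fourier (F i) k.
Proof.
move=> h; have L1s (s' : seq I) : L1 (fun t => \sum_(i <- s') F i t).
  apply/L1P => a b; under eq_fun do rewrite summxE.
  by apply: cint_sum => i; exact: h.
elim: s => [|i s ih].
  by rewrite big_nil; under eq_fun do rewrite big_nil; exact: fourier0.
by rewrite big_cons -ih -fourierD//; under eq_fun do rewrite big_cons.
Qed.

Lemma fourier_cisM (l : int) f k :
  fourier (fun t => cis (l%:~R * t) *: f t) k = fourier f (k - l).
Proof.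
apply: eq_mxmean => t _; rewrite scalerA -cisD; congr (cis _ *: _).
by rewrite intrB mulrBl opprB addrC.
Qed.

Lemma fourier_cst (A : 'M[C]_(m, n)) k : fourier (fun=> A) k = (k == 0)%:R *: A.
Proof.
apply/matrixP => i j; rewrite !mxE.
under eq_fun do rewrite mxE mulrC -mulNr -intrN.
rewrite cmeanZ; last by apply: sL2_cint; exact: sL2_cis.
by rewrite cmean_cis oppr_eq0 mulrC.
Qed.

Lemma ae_eq_fourier f g k : ae_equal f g -> fourier f k = fourier g k.
Proof. by move=> fg; apply: ae_eq_mxmean; apply: ae_circleS fg => t _ ->. Qed.

End Shape.

Lemma L1_mulmx m n p f (A : 'M[C]_(n, p)) :
  @L1 R m n f -> L1 (fun t => f t *m A).
Proof.
move=> hf; apply/L1P => i j; under eq_fun do rewrite mxE.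
by apply: cint_sum => k; under eq_fun do rewrite mulrC; apply: cintZ; exact: hf.
Qed.

Lemma mxmean_mulmx m n p (f : circle_fun R m n) (A : 'M[C]_(n, p)) :
  L1 f -> mxmean (fun t => f t *m A) = mxmean f *m A.
Proof.
move=> hf; apply/matrixP => i j; rewrite !mxE; under eq_fun do rewrite mxE.
rewrite cmean_sum; last by move=> k; under eq_fun do rewrite mulrC; apply: cintZ; exact: hf.
apply: eq_bigr => k _; rewrite mxE mulrC -cmeanZ; last exact: hf.
by apply: eq_cmean => t _; rewrite mulrC.
Qed.

Lemma mxmean_mulmxl m n p (f : circle_fun R m n) (A : 'M[C]_(p, m)) :
  L1 f -> mxmean (fun t => A *m f t) = A *m mxmean f.
Proof.
move=> hf; apply/matrixP => i j; rewrite !mxE; under eq_fun do rewrite mxE.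
rewrite cmean_sum; last by move=> k; apply: cintZ; exact: hf.
by apply: eq_bigr => k _; rewrite mxE -cmeanZ; last exact: hf.
Qed.

Lemma fourier_mulmx m n p (f : circle_fun R m n) (A : 'M[C]_(n, p)) k :
  L1 f -> fourier (fun t => f t *m A) k = fourier f k *m A.
Proof.
move=> hf; rewrite /fourier -mxmean_mulmx; last first.
  by under eq_fun do rewrite -mulNr; exact: L1_cisM.
by apply: eq_mxmean => t _; rewrite scalemxAl.
Qed.

Lemma L2_mulmx m n p f (A : 'M[C]_(n, p)) :
  @L2 R m n f -> L2 (fun t => f t *m A).
Proof.
move=> hf; apply/L2P => i j; under eq_fun do rewrite mxE.
by apply: sL2_sum => k; under eq_fun do rewrite mulrC; exact: sL2Z.
Qed.

Lemma L2_adj m n (f : circle_fun R m n) : L2 f -> L2 (mxadjf f).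
Proof.
move=> hf; apply/L2P => i j; rewrite /mxadjf; under eq_fun do rewrite !mxE.
exact: sL2_conj.
Qed.

Lemma L1_mul m n p (f : circle_fun R m n) (g : circle_fun R n p) :
  L2 f -> L2 g -> L1 (mxmulf f g).
Proof.
move=> hf hg; apply/L1P => i j; rewrite /mxmulf; under eq_fun do rewrite mxE.
by apply: cint_sum => k; exact: cintM.
Qed.

Lemma L2_Linf_mul m n p (A : circle_fun R m n) (g : circle_fun R n p) :
  Linf A -> L2 g -> L2 (mxmulf A g).
Proof.
move=> hA hg; apply/L2P => i j; rewrite /mxmulf; under eq_fun do rewrite mxE.
apply: sL2_sum => k; have [mA [M bM]] := hA i k.
exact: (sL2_mul mA bM).
Qed.

Lemma Linf_L2 m n (A : circle_fun R m n) : Linf A -> L2 A.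
Proof.
move=> hA i j; have [mA [M bM]] := hA i j; rewrite -/(sL2 _).
by have := sL2_mul mA bM (sL2_cst 1); under eq_fun do rewrite mulr1.
Qed.

Lemma Linf_adj m n (A : circle_fun R m n) : Linf A -> Linf (mxadjf A).
Proof.
move=> hA i j; have [mA [M bM]] := hA j i; rewrite /mxadjf.
under eq_fun do rewrite !mxE; split; first exact: cmeas_conj.
by exists M; apply: ae_circleS bM => t _; rewrite !mxE normsq_conj.
Qed.

Lemma fourier_adj m n (A : circle_fun R m n) k : L1 A ->
  fourier (mxadjf A) k = (fourier A (- k))^t*.
Proof.
move=> hA; apply/matrixP => i j; rewrite !mxE -cmean_conj; last first.
  have h1 : L1 (fun t => cis (- ((- k)%:~R * t)) *: A t).
    by under eq_fun do rewrite -mulNr; exact: L1_cisM.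
  exact: h1.
apply: eq_cmean => t _; rewrite !mxE rmorphM /= conj_cis; congr (cis _ * _).
by rewrite intrN mulNr opprK.
Qed.

End VectorL2.

(** * The inner product of square-integrable functions *)

(** The squared L2 norm.  It is locked so that comparing the norms of two different
functions never unfolds the underlying integrals. *)
HB.lock Definition sqnorm {R : realType} {m} (f : circle_fun R m 1) : R :=
  complex.Re (inner_prod f f).

Section InnerProduct.
Context {R : realType}.
Local Notation C := R[i].
Local Notation Re := complex.Re.
Local Notation conjC := (@Num.conj C).

Section Columns.
Context {m : nat}.
Implicit Types f g h : circle_fun R m 1.

Lemma sqnorm_def f : sqnorm f = Re (inner_prod f f).
Proof. by rewrite sqnorm.unlock. Qed.

Lemma dotE (u v : 'cV[C]_m) : (v^t* *m u) 0 0 = \sum_i conjC (v i 0) * u i 0.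
Proof. by rewrite mxE; apply: eq_bigr => i _; rewrite !mxE. Qed.

Lemma dot_conj (u v : 'cV[C]_m) : (u^t* *m v) 0 0 = conjC ((v^t* *m u) 0 0).
Proof.
rewrite !dotE rmorph_sum; apply: eq_bigr => i _.
by rewrite rmorphM /= conjCK mulrC.
Qed.

Lemma dot_self (u : 'cV[C]_m) : (u^t* *m u) 0 0 = (\sum_i normsq (u i 0))%:C.
Proof.
by rewrite dotE rmorph_sum; apply: eq_bigr => i _; rewrite mulrC normsqE.
Qed.

Lemma ip_cint f g : L2 f -> L2 g -> cint (fun t => ((g t)^t* *m f t) 0 0).
Proof.
move=> hf hg; under eq_fun do rewrite dotE.
apply: cint_sum => i; apply: cintM; last exact: hf.
by apply: sL2_conj; exact: hg.
Qed.

Lemma ipDl f g h : L2 f -> L2 g -> L2 h ->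
  inner_prod (fun t => f t + g t) h = inner_prod f h + inner_prod g h.
Proof.
move=> hf hg hh; rewrite /inner_prod -cmeanD; try exact: ip_cint.
by apply: eq_cmean => t _; rewrite mulmxDr mxE.
Qed.

Lemma ipZl (z : C) f h : L2 f -> L2 h ->
  inner_prod (fun t => z *: f t) h = z * inner_prod f h.
Proof.
move=> hf hh; rewrite /inner_prod -cmeanZ; try exact: ip_cint.
by apply: eq_cmean => t _; rewrite -scalemxAr mxE.
Qed.

Lemma ipC f g : L2 f -> L2 g -> inner_prod g f = conjC (inner_prod f g).
Proof.
move=> hf hg; rewrite /inner_prod -cmean_conj; last exact: ip_cint.
by apply: eq_cmean => t _; rewrite dot_conj.
Qed.

Lemma ipDr f g h : L2 f -> L2 g -> L2 h ->
  inner_prod h (fun t => f t + g t) = inner_prod h f + inner_prod h g.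
Proof.
move=> hf hg hh; rewrite ipC; [|exact: L2D|by []].
by rewrite ipDl// rmorphD /= -!ipC.
Qed.

Lemma ipZr (z : C) f h : L2 f -> L2 h ->
  inner_prod h (fun t => z *: f t) = conjC z * inner_prod h f.
Proof.
move=> hf hh; rewrite ipC; [|exact: L2Z|by []].
by rewrite ipZl// rmorphM /= -ipC.
Qed.

Lemma ipBl f g h : L2 f -> L2 g -> L2 h ->
  inner_prod (fun t => f t - g t) h = inner_prod f h - inner_prod g h.
Proof.
move=> hf hg hh; have := ipDl hf (L2Z (-1) hg) hh.
rewrite ipZl// mulN1r => <-; apply: eq_cmean => t _; by rewrite scaleN1r.
Qed.

Lemma ipBr f g h : L2 f -> L2 g -> L2 h ->
  inner_prod h (fun t => f t - g t) = inner_prod h f - inner_prod h g.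
Proof.
move=> hf hg hh; rewrite ipC; [|exact: L2B|by []].
by rewrite ipBl// rmorphB /= -!ipC.
Qed.

Lemma ip0l h : inner_prod (fun=> 0) h = 0.
Proof.
by rewrite -[RHS](cmean_cst 0); apply: eq_cmean => t _; rewrite mulmx0 mxE.
Qed.

Lemma ip_suml (I : Type) (s : seq I) (F : I -> circle_fun R m 1) h :
  (forall i, L2 (F i)) -> L2 h ->
  inner_prod (fun t => \sum_(i <- s) F i t) h = \sum_(i <- s) inner_prod (F i) h.
Proof.
move=> hF hh; elim: s => [|i s ih].
  by rewrite big_nil -[RHS](ip0l h); apply: eq_cmean => t _; rewrite big_nil.
rewrite big_cons -ih -ipDl//; last exact: L2_sum.
by apply: eq_cmean => t _; rewrite big_cons.
Qed.

Lemma ip_sumr (I : Type) (s : seq I) (F : I -> circle_fun R m 1) h :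
  (forall i, L2 (F i)) -> L2 h ->
  inner_prod h (fun t => \sum_(i <- s) F i t) = \sum_(i <- s) inner_prod h (F i).
Proof.
move=> hF hh; rewrite ipC//; last exact: L2_sum.
rewrite ip_suml// rmorph_sum; apply: eq_bigr => i _.
by rewrite /= -ipC.
Qed.

Lemma ip_self f : inner_prod f f = (sqnorm f)%:C.
Proof.
rewrite sqnorm_def /inner_prod cmeanE; apply: complexP => //.
rewrite [RHS]/= -[RHS](rmean_cst 0); apply: eq_rmean => t _.
by rewrite dot_self.
Qed.

Lemma sqnormE f : L2 f -> sqnorm f = \sum_i nsq (fun t => f t i 0).
Proof.
move=> hf; apply: complexI; rewrite -ip_self rmorph_sum /= /inner_prod.
under eq_fun do rewrite dotE.
rewrite cmean_sum; last first.
  by move=> i; apply: cintM; [apply: sL2_conj|]; exact: hf.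
apply: eq_bigr => i _; rewrite cmeanE; apply: (congr2 (@Complex R)).
  by apply: eq_rmean => t _; rewrite mulrC normsqE.
by rewrite -[RHS](rmean_cst 0); apply: eq_rmean => t _; rewrite mulrC normsqE.
Qed.

Lemma sqnorm_ge0 f : 0 <= sqnorm f.
Proof.
by rewrite sqnorm_def; apply: rmean_ge0 => t _; rewrite dot_self /= sumr_ge0// => i _; exact: normsq_ge0.
Qed.

Lemma ipE f g : inner_prod f g = cmean (fun t => ((g t)^t* *m f t) 0 0).
Proof. by []. Qed.

Local Opaque inner_prod.

Lemma sqnormD f g : L2 f -> L2 g ->
  sqnorm (fun t => f t + g t) = sqnorm f + sqnorm g + 2 * Re (inner_prod f g).
Proof.
move=> hf hg; have hD := L2D hf hg.
rewrite !sqnorm_def (ipDl hf hg hD) (ipDr hf hg hf) (ipDr hf hg hg) (ipC hf hg).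
rewrite !ReD Re_conj.
move: (inner_prod f g).
move: (inner_prod f f).
move: (inner_prod g g) => a b c.
lra.
Qed.

Lemma sqnormZ z f : L2 f -> sqnorm (fun t => z *: f t) = normsq z * sqnorm f.
Proof.
move=> hf; apply: complexI.
have -> : (normsq z * sqnorm f)%:C = (normsq z)%:C * (sqnorm f)%:C by exact: rmorphM.
have h := ip_self (fun t => z *: f t).
rewrite -h (ipZl z hf (L2Z z hf)) (ipZr z hf hf) mulrA -ip_self.
by congr (_ * _); exact: normsqE.
Qed.

Lemma sqnormB f g : L2 f -> L2 g ->
  sqnorm (fun t => f t - g t) = sqnorm f + sqnorm g - 2 * Re (inner_prod f g).
Proof.
move=> hf hg; have := sqnormD hf (L2Z (-1) hg); rewrite sqnormZ// ipZr//.
have -> : conjC (-1) = -1 by rewrite rmorphN rmorph1.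
have -> : normsq (-1 : C) = 1 by rewrite normsqN /normsq /= expr1n expr0n addr0.
rewrite mulN1r ReN mul1r mulrN => <-.
by congr sqnorm; apply/funext => t; rewrite scaleN1r.
Qed.

Lemma sqnormBC f g : sqnorm (fun t => f t - g t) = sqnorm (fun t => g t - f t).
Proof.
rewrite !sqnorm_def; apply: (f_equal (@complex.Re R)).
rewrite (ipE (fun t => f t - g t)) (ipE (fun t => g t - f t)).
apply: eq_cmean => t _.
rewrite (dot_self (f t - g t)) (dot_self (g t - f t)); congr (_%:C).
by apply: eq_bigr => i _; rewrite -opprB mxE normsqN.
Qed.

Lemma cauchy_schwarz f g : L2 f -> L2 g ->
  normsq (inner_prod f g) <= sqnorm f * sqnorm g.
Proof.
move=> hf hg; set z := inner_prod f g.
(* || f - s z g ||^2 >= 0, used at s = 1 / || g ||^2, or at a large s if || g || = 0 *)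
have q (s : R) : 0 <= sqnorm f - 2 * s * normsq z + s ^+ 2 * normsq z * sqnorm g.
  have := sqnorm_ge0 (fun t => f t - (s%:C * z) *: g t).
  rewrite sqnormB//; last exact: L2Z.
  rewrite ipZr// -/z rmorphM /= sqnormZ// normsqM.
  have -> : normsq (s%:C) = s ^+ 2 by rewrite /normsq /= expr0n addr0.
  have -> : Re (conjC s%:C * conjC z * z) = s * normsq z.
    rewrite -mulrA [_ * z]mulrC normsqE -[conjC s%:C]/((s%:C)^*%C) conjc_real.
    by rewrite ReM /=; ring.
  move: (normsq z) (sqnorm f) (sqnorm g) => nz a b h; apply: le_trans h _.
  by rewrite le_eqVlt; apply/orP; left; apply/eqP; ring.
have z0 := normsq_ge0 z; have f0 := sqnorm_ge0 f.
have [g0|g0] := eqVneq (sqnorm g) 0.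
  rewrite g0 mulr0 leNgt; apply/negP => zp.
  have := q ((sqnorm f + 1) / (2 * normsq z)); rewrite g0 mulr0 addr0.
  have -> : 2 * ((sqnorm f + 1) / (2 * normsq z)) * normsq z = sqnorm f + 1.
    by field; rewrite gt_eqF.
  lra.
have gp : 0 < sqnorm g by rewrite lt_def g0 sqnorm_ge0.
have := q ((sqnorm g)^-1).
have -> : sqnorm f - 2 * (sqnorm g)^-1 * normsq z + (sqnorm g)^-1 ^+ 2 * normsq z * sqnorm g =
  (sqnorm f * sqnorm g - normsq z) / sqnorm g by field.
by rewrite pmulr_lge0 ?invr_gt0// subr_ge0.
Qed.

Definition cvL2 (u : nat -> circle_fun R m 1) f : Prop :=
  forall e, 0 < e -> exists N, forall n, (N <= n)%N ->
    sqnorm (fun t => u n t - f t) < e.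

(** A continuous linear functional that is eventually equal to c along a convergent
sequence takes the value c at the limit. *)
Lemma ip_lim u f g (c : C) : (forall n, L2 (u n)) -> L2 f -> L2 g -> cvL2 u f ->
  (exists N, forall n, (N <= n)%N -> inner_prod (u n) g = c) ->
  inner_prod f g = c.
Proof.
move=> hu hf hg uf [N0 h].
have small e : 0 < e -> normsq (c - inner_prod f g) <= e * sqnorm g.
  move=> /uf[N hN]; pose n := maxn N N0.
  rewrite -(h n); last exact: leq_maxr.
  rewrite -ipBl//; apply: le_trans (cauchy_schwarz _ _) _ => //; first exact: L2B.
  by rewrite ler_wpM2r ?sqnorm_ge0// ltW// hN// leq_maxl.
have z0 : normsq (c - inner_prod f g) <= 0.
  rewrite leNgt; apply/negP => zp.
  have g0 := sqnorm_ge0 g.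
  have e0 : 0 < normsq (c - inner_prod f g) / (2 * (sqnorm g + 1)).
    by rewrite divr_gt0//; lra.
  have := small _ e0; rewrite -mulrA ler_pMr//.
  by rewrite mulrC ler_pdivlMr; lra.
have : normsq (c - inner_prod f g) = 0 by apply/eqP; rewrite eq_le z0 normsq_ge0.
move=> /eqP; rewrite /normsq paddr_eq0 ?sqr_ge0// !sqrf_eq0 => /andP[/eqP h1 /eqP h2].
by apply/esym/eqP; rewrite -subr_eq0; apply/eqP/complexP.
Qed.

(** The cross term is bounded by expanding || (g - f) + s f ||^2 >= 0 and
|| (g - f) - s f ||^2 >= 0 at s = e. *)
Lemma sqnorm_near f g e : 0 < e -> L2 f -> L2 g -> sqnorm (fun t => g t - f t) < e ^+ 2 ->
  `|sqnorm g - sqnorm f| <= e * (2 * sqnorm f + 1) + e ^+ 2.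
Proof.
move=> e0 hf hg ne; have hB := L2B hg hf.
have -> : sqnorm g = sqnorm (fun t => (g t - f t) + f t).
  by congr sqnorm; apply/funext => t; rewrite subrK.
rewrite sqnormD//; set d := sqnorm (fun t => g t - f t) in ne *.
set x := Re _; have d0 : 0 <= d by exact: sqnorm_ge0.
have f0 := sqnorm_ge0 f.
have e1 (s : R) : 0 < s -> 0 <= d + s ^+ 2 * sqnorm f + 2 * (s * x).
  move=> s0; have := sqnorm_ge0 (fun t => (g t - f t) + s%:C *: f t).
  rewrite sqnormD//; last exact: L2Z.
  rewrite sqnormZ// ipZr// -[conjC s%:C]/((s%:C)^*%C) conjc_real ReM /= mul0r subr0.
  by rewrite -/d -/x /normsq /= expr0n addr0.
have e2 (s : R) : 0 < s -> 0 <= d + s ^+ 2 * sqnorm f - 2 * (s * x).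
  move=> s0; have := sqnorm_ge0 (fun t => (g t - f t) - s%:C *: f t).
  rewrite sqnormB//; last exact: L2Z.
  rewrite sqnormZ// ipZr// -[conjC s%:C]/((s%:C)^*%C) conjc_real ReM /= mul0r subr0.
  by rewrite -/d -/x /normsq /= expr0n addr0.
have q (s : R) : 0 < s -> `|2 * x| <= d / s + s * sqnorm f.
  move=> s0; have := e1 _ s0; have := e2 _ s0.
  move: (sqnorm f) => F h2 h1; rewrite ler_norml; apply/andP; split.
    have : 0 <= s * (2 * x + (d / s + s * F)).
      rewrite (_ : s * _ = d + s ^+ 2 * F + 2 * (s * x))//.
      by field; rewrite gt_eqF.
    by rewrite pmulr_rge0// => h; lra.
  have : 0 <= s * ((d / s + s * F) - 2 * x).
    rewrite (_ : s * _ = d + s ^+ 2 * F - 2 * (s * x))//.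
    by field; rewrite gt_eqF.
  by rewrite pmulr_rge0// => h; lra.
have := q e e0; have de : d / e <= e by rewrite ler_pdivrMr// -expr2 ltW.
rewrite !ler_norml => /andP[h1 h2]; clearbody x d.
move: (sqnorm f) f0 h1 h2 => F f0 h1 h2; rewrite expr2 in ne *.
by apply/andP; split; nra.
Qed.

Lemma sqnorm_lim u f : (forall n, L2 (u n)) -> L2 f -> cvL2 u f ->
  sqnorm (u n) @[n --> \oo] --> sqnorm f.
Proof.
move=> hu hf uf; apply/cvgrPdist_le => e e0; have f0 := sqnorm_ge0 f.
pose d := Num.min 1 (e / (2 * sqnorm f + 2)).
have d0 : 0 < d by rewrite lt_min ltr01 divr_gt0//; lra.
have [N hN] := uf _ (exprn_gt0 2 d0).
exists N => // n /= Nn; have := sqnorm_near d0 hf (hu n) (hN n Nn).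
rewrite distrC => /le_trans; apply.
have d1 : d <= 1 by rewrite ge_min lexx.
have d2 : d * (2 * sqnorm f + 2) <= e.
  by rewrite -ler_pdivlMr ?ge_min ?lexx ?orbT//; lra.
nra.
Qed.

Lemma ae_eq_ip f f' g g' : ae_equal f f' -> ae_equal g g' ->
  inner_prod f g = inner_prod f' g'.
Proof.
move=> ff' gg'; rewrite !ipE; apply: ae_eq_cmean.
by apply: ae_circleS (ae_circleI ff' gg') => t _ [-> ->].
Qed.

End Columns.

Lemma ip_adj m p (A : circle_fun R p m) (f : circle_fun R m 1)
    (g : circle_fun R p 1) :
  inner_prod (mxmulf A f) g = inner_prod f (mxmulf (mxadjf A) g).
Proof.
rewrite !ipE; apply: eq_cmean => t _; rewrite /mxmulf /mxadjf.
by rewrite trmx_mul map_mxM trmxCK mulmxA.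
Qed.

(** The constant 2 ^ k comes from iterating the two-term bound. *)
Lemma normsq_sum_le k (z : 'I_k -> C) :
  normsq (\sum_i z i) <= 2 ^+ k * \sum_i normsq (z i).
Proof.
elim: k z => [|k IH] z.
  by rewrite !big_ord0 mulr0 /normsq /= expr0n addr0.
rewrite !big_ord_recl; apply: le_trans (normsqD_le _ _) _.
have := IH (fun i => z (lift ord0 i)); have := normsq_ge0 (z ord0).
have : 0 <= \sum_i normsq (z (lift ord0 i)) by apply: sumr_ge0 => i _; exact: normsq_ge0.
have : 1 <= 2 ^+ k :> R by rewrite exprn_ege1// ler1n.
rewrite exprS; nra.
Qed.

Lemma nsq_mul_le (b f : R -> C) M : cmeasurable b ->
  ae_on_circle (fun t => normsq (b t) <= M) -> sL2 f ->
  nsq (fun t => b t * f t) <= M * nsq f.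
Proof.
move=> mb bM hf; have [_ i1] := sL2_mul mb bM hf; have [_ i2] := hf.
rewrite /nsq -rmeanZ//; apply: rmean_le_ae => //; first exact: intRZ.
apply: ae_circleS bM => t _ bM; rewrite normsqM.
by rewrite ler_wpM2r ?normsq_ge0.
Qed.

(** Multiplication by a bounded matrix function is a bounded operator. *)
Lemma Linf_bounded m p (A : circle_fun R p m) : Linf A ->
  exists2 K, 0 <= K & forall f, L2 f -> sqnorm (mxmulf A f) <= K * sqnorm f.
Proof.
move=> hA.
have /choice[M hM] : forall ij : 'I_p * 'I_m, exists M : R,
    0 <= M /\ ae_on_circle (fun t => normsq (A t ij.1 ij.2) <= M).
  move=> [i j]; have [_ [M bM]] := hA i j; exists `|M|; split => //=.
  by apply: ae_circleS bM => t _ /le_trans; apply; exact: ler_norm.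
exists (2 ^+ m * \sum_i \sum_j M (i, j)).
  rewrite mulr_ge0 ?exprn_ge0// sumr_ge0// => i _; apply: sumr_ge0 => j _.
  by case: (hM (i, j)).
move=> f hf; rewrite sqnormE; last exact: L2_Linf_mul.
rewrite -mulrA mulr_suml mulr_sumr; apply: ler_sum => i _.
have sA j : sL2 (fun t => A t i j * f t j 0).
  by have [mA _] := hA i j; have [_ bM] := hM (i, j); exact: (sL2_mul mA bM).
apply: (@le_trans _ _ (2 ^+ m * \sum_j nsq (fun t => A t i j * f t j 0))).
  have iS (s : seq 'I_m) : intR (fun t => \sum_(j <- s) normsq (A t i j * f t j 0)).
    elim: s => [|j s ih]; first by under eq_fun do rewrite big_nil; exact: intR_cst.
    under eq_fun do rewrite big_cons; apply: intRD => //.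
    by have [] := sA j.
  have es (s : seq 'I_m) : \sum_(j <- s) nsq (fun t => A t i j * f t j 0) =
      rmean (fun t => \sum_(j <- s) normsq (A t i j * f t j 0)).
    elim: s => [|j s ih].
      by rewrite big_nil -[LHS](rmean_cst 0); apply: eq_rmean => t _; rewrite big_nil.
    rewrite big_cons ih /nsq -rmeanD//; last by have [] := sA j.
    by apply: eq_rmean => t _; rewrite big_cons.
  rewrite es -rmeanZ//; apply: rmean_le; last first.
  - move=> t _; rewrite /mxmulf mxE; exact: normsq_sum_le.
  - exact: intRZ.
  - by have [] := L2_Linf_mul hA hf i 0.
rewrite ler_wpM2l ?exprn_ge0// mulr_suml; apply: ler_sum => j _.
have [mA _] := hA i j; have [M0 bM] := hM (i, j).
apply: le_trans (nsq_mul_le mA bM (hf j 0)) _; rewrite ler_wpM2l//.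
rewrite sqnormE// (bigD1 j)//= lerDl sumr_ge0// => k _; exact: nsq_ge0.
Qed.

Lemma cvL2_Linf m p (A : circle_fun R p m) u f : Linf A -> (forall n, L2 (u n)) ->
  L2 f -> cvL2 u f -> cvL2 (fun n => mxmulf A (u n)) (mxmulf A f).
Proof.
move=> hA hu hf uf e e0; have [K K0 hK] := Linf_bounded hA.
have [|N hN] := uf (e / (K + 1)); first by rewrite divr_gt0//; lra.
exists N => n Nn.
rewrite (_ : (fun t => _) = mxmulf A (fun t => u n t - f t)); last first.
  by apply/funext => t; rewrite /mxmulf mulmxBr.
apply: le_lt_trans (hK _ (L2B (hu n) hf)) _.
have := hN n Nn; rewrite ltr_pdivlMr; last lra.
by have := sqnorm_ge0 (fun t => u n t - f t); nra.
Qed.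

End InnerProduct.

(** * Hardy functions and their partial Fourier sums *)

Section Hardy.
Context {R : realType}.
Local Notation C := R[i].
Local Opaque inner_prod.

Section Columns.
Context {m : nat}.
Implicit Types (f g h : circle_fun R m 1) (e v : 'cV[C]_m) (y : nat -> 'cV[C]_m).

Definition mono (k : int) e : circle_fun R m 1 := fun t => cis (k%:~R * t) *: e.

Definition pol (N : nat) y : circle_fun R m 1 :=
  fun t => \sum_(k < N) mono k%:Z (y k) t.

(** The partial Fourier sum; only nonnegative frequencies enter because it is used
for Hardy functions. *)
Definition psum f (N : nat) : circle_fun R m 1 := pol N (fun k => fourier f k%:Z).

Definition vnsq v : R := \sum_i normsq (v i 0).

Lemma L2_mono k e : L2 (mono k e).
Proof. by apply: L2_cisM; exact: L2_cst. Qed.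

Lemma L2_pol N y : L2 (pol N y).
Proof. by apply: L2_sum => k; exact: L2_mono. Qed.

Lemma ip_mono f k e : L1 f ->
  inner_prod f (mono k e) = (e^t* *m fourier f k) 0 0.
Proof.
move=> hf.
have h1 : L1 (fun t => cis (- (k%:~R * t)) *: f t).
  by under eq_fun do rewrite -mulNr; exact: L1_cisM.
rewrite /fourier -mxmean_mulmxl// [RHS]mxE ipE; apply: eq_cmean => t _.
rewrite /mono !mxE; apply: eq_bigr => i _.
by rewrite !mxE rmorphM /= conj_cis mulrCA mulrA.
Qed.

Lemma fourier_mono l e k : fourier (mono l e) k = (k == l)%:R *: e.
Proof. by rewrite /mono fourier_cisM fourier_cst subr_eq0. Qed.

Lemma ip_pol f N y : L2 f ->
  inner_prod f (pol N y) = \sum_(k < N) ((y k)^t* *m fourier f k%:Z) 0 0.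
Proof.
move=> hf; rewrite ip_sumr//; last by move=> k; exact: L2_mono.
by apply: eq_bigr => k _; rewrite ip_mono//; exact: L2_L1.
Qed.

Lemma fourier_pol N y (k : int) :
  fourier (pol N y) k = \sum_(l < N) (k == l%:Z)%:R *: y l.
Proof.
rewrite /pol fourier_sum; last by move=> l; apply: L2_L1; exact: L2_mono.
by apply: eq_bigr => l _; rewrite fourier_mono.
Qed.

Lemma fourier_pol_nat N y (k : nat) :
  fourier (pol N y) k%:Z = if (k < N)%N then y k else 0.
Proof.
rewrite fourier_pol; case: ltnP => kN.
  rewrite (bigD1 (Ordinal kN))//= eqxx scale1r big1 ?addr0// => l lk.
  by have /negbTE := lk; rewrite -val_eqE /= eqz_nat eq_sym => ->; rewrite scale0r.
rewrite big1// => l _; rewrite eqz_nat gtn_eqF ?scale0r//.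
exact: leq_trans (ltn_ord l) kN.
Qed.

Lemma fourier_pol_neg N y (k : int) : k < 0 -> fourier (pol N y) k = 0.
Proof.
move=> k0; rewrite fourier_pol big1// => l _.
by rewrite lt_eqF ?scale0r// (lt_le_trans k0).
Qed.

Lemma pol_widen N K y : (N <= K)%N ->
  (forall k, (N <= k)%N -> y k = 0) -> pol K y = pol N y.
Proof.
move=> NK y0; apply/funext => t; rewrite /pol.
rewrite -(big_mkord xpredT (fun k => mono k%:Z (y k) t)).
rewrite -(big_mkord xpredT (fun k => mono k%:Z (y k) t)).
rewrite (big_cat_nat (leq0n N) NK) /= [X in _ + X]big_nat_cond [X in _ + X]big1 ?addr0// => k.
by move=> /andP[/andP[Nk _] _]; rewrite /mono y0// scaler0.
Qed.

Lemma polB N (x y : nat -> 'cV[C]_m) :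
  pol N (fun k => x k - y k) = fun t => pol N x t - pol N y t.
Proof.
apply/funext => t; rewrite /pol -sumrB; apply: eq_bigr => k _.
by rewrite /mono scalerBr.
Qed.

Lemma vnsqE v : (v^t* *m v) 0 0 = (vnsq v)%:C.
Proof. exact: dot_self. Qed.

Lemma vnsq_ge0 v : 0 <= vnsq v.
Proof. by apply: sumr_ge0 => i _; exact: normsq_ge0. Qed.

Lemma vnsqD_le (u v : 'cV[C]_m) : vnsq (u + v) <= 2 * vnsq u + 2 * vnsq v.
Proof.
rewrite /vnsq !mulr_sumr -big_split /=; apply: ler_sum => i _.
by rewrite mxE; exact: normsqD_le.
Qed.

Lemma vnsqN (u : 'cV[C]_m) : vnsq (- u) = vnsq u.
Proof. by apply: eq_bigr => i _; rewrite mxE normsqN. Qed.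

Lemma vnsq_eq0 (u : 'cV[C]_m) : vnsq u = 0 -> u = 0.
Proof.
move=> u0; apply/matrixP => i j; rewrite ord1 [RHS]mxE.
have : normsq (u i 0) = 0.
  apply/eqP; rewrite eq_le normsq_ge0 andbT -u0 /vnsq (bigD1 i)//= lerDl.
  by apply: sumr_ge0 => k _; exact: normsq_ge0.
move=> /eqP; rewrite /normsq paddr_eq0 ?sqr_ge0// !sqrf_eq0 => /andP[/eqP h1 /eqP h2].
exact: complexP.
Qed.

Lemma sqnorm_pol N y : sqnorm (pol N y) = \sum_(k < N) vnsq (y k).
Proof.
apply: complexI; rewrite -ip_self ip_pol; last exact: L2_pol.
rewrite rmorph_sum; apply: eq_bigr => k _.
by rewrite fourier_pol_nat ltn_ord vnsqE.
Qed.

Lemma coef_eq (u v : 'cV[C]_m) :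
  (forall e : 'cV[C]_m, (e^t* *m u) 0 0 = (e^t* *m v) 0 0) -> u = v.
Proof.
move=> h; apply/matrixP => i j; rewrite ord1.
have d (w : 'cV[C]_m) : ((delta_mx i 0 : 'cV[C]_m)^t* *m w) 0 0 = w i 0.
  rewrite dotE (bigD1 i)//= big1 => [|k ki].
    by rewrite mxE !eqxx rmorph1 mul1r addr0.
  by rewrite mxE (negbTE ki) rmorph0 mul0r.
by rewrite -(d u) -(d v) h.
Qed.

Lemma fourier_eq0 f k : L1 f -> (forall e, inner_prod f (mono k e) = 0) ->
  fourier f k = 0.
Proof.
by move=> hf h; apply: coef_eq => e; rewrite -ip_mono// h mulmx0 mxE.
Qed.

(** H2 is closed in L2: each Fourier coefficient is a continuous functional. *)
Lemma analytic_lim u f : (forall n, H2 (u n)) -> L2 f -> cvL2 u f -> H2 f.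
Proof.
move=> hu hf uf; split=> // k k0; apply: fourier_eq0; first exact: L2_L1.
move=> e; apply: (@ip_lim _ _ u f) => //.
- by move=> n; case: (hu n).
- exact: L2_mono.
- exists 0%N => n _; rewrite ip_mono; last by apply: L2_L1; case: (hu n).
  by have [_ ->] := hu n; rewrite ?mulmx0 ?mxE.
Qed.

Lemma H2_pol N y : H2 (pol N y).
Proof. by split; [exact: L2_pol|move=> k; exact: fourier_pol_neg]. Qed.

Definition vtrig (p : circle_fun R m 1) : Prop := exists s : seq (int * 'cV[C]_m),
  p = fun t => \sum_(ke <- s) mono ke.1 ke.2 t.

Lemma vtrig_dense f (e : R) : L2 f -> 0 < e ->
  exists2 p, vtrig p & sqnorm (fun t => f t - p t) < e.
Proof.
move=> hf e0.
have e1 : 0 < e / m.+1%:R by rewrite divr_gt0.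
have /choice[s hs] : forall i, exists s : seq (int * C),
    nsq (fun t => f t i 0 - \sum_(kc <- s) kc.2 * cis (kc.1%:~R * t)) < e / m.+1%:R.
  by move=> i; have [_ /(_ _ e1)[p [s ->] h]] := approx_L2 (hf i 0); exists s.
pose s' := flatten [seq [seq (kc.1, kc.2 *: delta_mx i 0 : 'cV[C]_m) | kc <- s i]
  | i <- enum 'I_m].
exists (fun t => \sum_(ke <- s') mono ke.1 ke.2 t); first by exists s'.
rewrite sqnormE; last first.
  by apply: L2B => //; apply: L2_sum => ke; exact: L2_mono.
apply: (@le_lt_trans _ _ (\sum_(i < m) e / m.+1%:R)); last first.
  rewrite sumr_const card_ord -[_ *+ m]mulr_natr mulrAC ltr_pdivrMr//.
  by rewrite ltr_pM2l// ltr_nat.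
apply: ler_sum => i _; apply: le_trans (ltW (hs i)).
rewrite le_eqVlt; apply/orP; left; apply/eqP; apply: eq_rmean => t _.
congr normsq; rewrite !mxE; congr (_ - _).
rewrite summxE /s' big_flatten /= big_map big_enum /= (bigD1 i)//= [X in _ + X]big1.
  rewrite addr0 big_map; apply: eq_bigr => kc _.
  by rewrite /mono !mxE !eqxx mulr1 mulrC.
move=> j ji; rewrite big_map big1// => kc _.
by rewrite /mono !mxE eq_sym (negbTE ji) /= !mulr0.
Qed.

(** Once n exceeds the degree of a trigonometric polynomial p close to f, the error
f - psum f n is orthogonal to psum f n and to every monomial of p, those of negative
frequency included since f is analytic; so it is no longer than f - p. *)
Lemma psum_cvg f : H2 f -> cvL2 (psum f) f.
Proof.
move=> [hf af] e e0; have [p [s pE] pe] := vtrig_dense hf e0.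
have hp : L2 p.
  rewrite pE; apply: (@L2_sum R m 1 _ s (fun ke => mono ke.1 ke.2)) => ke.
  exact: L2_mono.
exists (\sum_(ke <- s) (absz ke.1).+1)%N => n sn.
have hS : L2 (psum f n) by exact: L2_pol.
pose w : circle_fun R m 1 := fun t => f t - psum f n t.
have hB : L2 w by exact: L2B.
have four0 k : k < n%:Z -> fourier w k = 0.
  move=> kn; rewrite /w fourierB; try exact: L2_L1.
  have -> : fourier (psum f n) k = fourier f k; last by rewrite subrr.
  have [k0|k0] := ltP k 0; first by rewrite fourier_pol_neg ?af.
  move: kn k0; case: k => // k kn _; rewrite fourier_pol_nat.
  by rewrite -ltz_nat kn.
have orth_mono k v : (k < n%:Z) -> inner_prod w (mono k v) = 0.
  by move=> /four0 kn; rewrite ip_mono; [rewrite kn mulmx0 mxE|exact: L2_L1].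
have o1 : inner_prod w (psum f n) = 0.
  rewrite /psum ip_pol//; apply: big1 => k _.
  by rewrite four0 ?ltz_nat// mulmx0 mxE.
have o2 : inner_prod w p = 0.
  rewrite pE (@ip_sumr R m _ s (fun ke => mono ke.1 ke.2) _ _ hB); last first.
    by move=> k; exact: L2_mono.
  rewrite big_seq; apply: big1 => ke kes; apply: orth_mono.
  apply: (@lt_le_trans _ _ ((absz ke.1).+1)%:Z).
    by rewrite (intS (absz ke.1)) abszE (le_lt_trans (ler_norm _))// ltrDr.
  rewrite lez_nat (leq_trans _ sn)// (big_rem ke)//=; exact: leq_addr.
apply: le_lt_trans pe.
have hB2 : L2 (fun t => psum f n t - p t) by exact: L2B.
have := sqnormD hB hB2; rewrite (ipBr hS hp hB) o1 o2 subrr mulr0 addr0.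
rewrite (_ : (fun t => f t - psum f n t + (psum f n t - p t)) = (fun t => f t - p t)).
  by move=> ->; rewrite (sqnormBC (psum f n) f) lerDl sqnorm_ge0.
by apply/funext => t; rewrite addrA subrK.
Qed.

Lemma H2_L2 f : H2 f -> L2 f. Proof. by case. Qed.

Lemma H2D f g : H2 f -> H2 g -> H2 (fun t => f t + g t).
Proof.
move=> [hf af] [hg ag]; split; first exact: L2D.
by move=> k k0; rewrite fourierD ?af ?ag ?addr0//; exact: L2_L1.
Qed.

Lemma H2Z z f : H2 f -> H2 (fun t => z *: f t).
Proof.
move=> [hf af]; split; first exact: L2Z.
by move=> k k0; rewrite fourierZ ?af ?scaler0//; exact: L2_L1.
Qed.

Lemma H2_mono (k : nat) e : H2 (mono k%:Z e).
Proof.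
split; first exact: L2_mono.
by move=> l l0; rewrite fourier_mono lt_eqF ?scale0r// (lt_le_trans l0).
Qed.

Lemma H2_cisM (l : nat) f : H2 f -> H2 (fun t => cis (l%:Z%:~R * t) *: f t).
Proof.
move=> [hf af]; split; first exact: L2_cisM.
by move=> k k0; rewrite fourier_cisM af// (le_lt_trans _ k0)// gerBl.
Qed.

Lemma ip_psum_lim f g c : H2 f -> L2 g ->
  (exists N, forall n, (N <= n)%N -> inner_prod (psum f n) g = c) ->
  inner_prod f g = c.
Proof.
move=> hf hg h; apply: (@ip_lim _ _ (psum f)) => //.
- by move=> n; exact: L2_pol.
- exact: H2_L2.
- exact: psum_cvg.
Qed.

(** Analytic monomials are total in H2. *)
Lemma ip_psum_orth f g : H2 f -> L2 g ->
  (forall (k : nat) e, inner_prod (mono k%:Z e) g = 0) -> inner_prod f g = 0.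
Proof.
move=> hf hg h; apply: ip_psum_lim => //; exists 0%N => n _.
rewrite /psum ip_suml//; last by move=> k; exact: L2_mono.
by rewrite big1// => k _; exact: h.
Qed.

End Columns.

Lemma fourier_mul_mono m p (A : circle_fun R p m) (l k : int) (e : 'cV[C]_m) :
  L1 A -> fourier (mxmulf A (mono l e)) k = fourier A (k - l) *m e.
Proof.
move=> hA; apply: etrans (fourier_mulmx e (k - l) hA).
apply: etrans (fourier_cisM l (fun t => A t *m e) k).
by apply: eq_mxmean => t _; rewrite /mxmulf /mono -scalemxAr.
Qed.

Lemma fourier_mul_pol m r (A : circle_fun R m r) N y k : L1 A ->
  fourier (mxmulf A (pol N y)) k = \sum_(j < N) fourier A (k - j%:Z) *m y j.
Proof.
move=> hA.
have -> : mxmulf A (pol N y) = fun t => \sum_(j < N) mxmulf A (mono j%:Z (y j)) t.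
  by apply/funext => t; rewrite /mxmulf /pol mulmx_sumr.
rewrite fourier_sum; last first.
  move=> j; have -> : mxmulf A (mono j%:Z (y j)) =
      fun t => cis (j%:Z%:~R * t) *: (A t *m y j).
    by apply/funext => t; rewrite /mxmulf /mono scalemxAr.
  by apply: L1_cisM; exact: L1_mulmx.
by apply: eq_bigr => j _; exact: fourier_mul_mono.
Qed.

Lemma H2_Hinf_mul m p (A : circle_fun R p m) (f : circle_fun R m 1) :
  Hinf A -> H2 f -> H2 (mxmulf A f).
Proof.
move=> [hA aA] hf; have hf2 := H2_L2 hf.
apply: (@analytic_lim _ (fun n => mxmulf A (psum f n))).
- move=> n; split; first by apply: L2_Linf_mul => //; exact: L2_pol.
  move=> k k0; rewrite fourier_mul_pol; last by apply: L2_L1; exact: Linf_L2.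
  rewrite big1// => l _.
  have kl : k - (l : nat)%:Z < 0 by apply: le_lt_trans k0; rewrite gerBl.
  by rewrite (aA _ kl) mul0mx.
- exact: L2_Linf_mul.
- apply: cvL2_Linf => //; last exact: psum_cvg.
  by move=> n; exact: L2_pol.
Qed.

End Hardy.

(** * The Cauchy kernel on a real segment *)

Section Disc.
Context {R : realType}.
Local Notation C := R[i].
Local Notation D := (@circle_arc R).
Local Notation Re := complex.Re.
Local Notation Im := complex.Im.
Implicit Types (z w : C).

(** The l1 norm on the plane, submultiplicative and real-valued. *)
Definition norm1 z : R := `|Re z| + `|Im z|.

Lemma norm1_ge0 z : 0 <= norm1 z.
Proof. by rewrite addr_ge0. Qed.

Lemma norm1D z w : norm1 (z + w) <= norm1 z + norm1 w.
Proof. by rewrite /norm1 ReD ImD addrACA lerD// ler_normD. Qed.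

Lemma norm1M z w : norm1 (z * w) <= norm1 z * norm1 w.
Proof.
rewrite /norm1 ReM ImM; apply: le_trans (lerD (ler_normB _ _) (ler_normD _ _)) _.
by rewrite !normrM le_eqVlt; apply/orP; left; apply/eqP; ring.
Qed.

Lemma norm1N z : norm1 (- z) = norm1 z.
Proof. by rewrite /norm1 ReN ImN !normrN. Qed.

Lemma norm1_sum (I : Type) (s : seq I) (F : I -> C) :
  norm1 (\sum_(i <- s) F i) <= \sum_(i <- s) norm1 (F i).
Proof.
elim/big_rec2: _ => [|i y z _ h]; first by rewrite /norm1 /= normr0 addr0.
by apply: le_trans (norm1D _ _) _; rewrite lerD2l.
Qed.

Lemma norm1_eq0 z : norm1 z = 0 -> z = 0.
Proof.
move=> /eqP; rewrite paddr_eq0// !normr_eq0 => /andP[/eqP h1 /eqP h2].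
exact: complexP.
Qed.

Lemma norm1_real (x : R) : norm1 x%:C = `|x|.
Proof. by rewrite /norm1 /= normr0 addr0. Qed.

Lemma intR_norm1 (f : R -> C) : cint f -> intR (fun t => norm1 (f t)).
Proof. by move=> [i1 i2]; apply: intRD; exact: intR_norm. Qed.

Lemma norm1_cmean (f : R -> C) : cint f -> norm1 (cmean f) <= rmean (fun t => norm1 (f t)).
Proof.
move=> [i1 i2]; have norm1' := intR_norm i1; have n2' := intR_norm i2.
rewrite /norm1 rmeanD// cmeanE /=; apply: lerD; exact: rmean_norm_le.
Qed.

Definition ckern (x t : R) : C := (1 - x%:C * cis (- t))^-1.

(** For 0 <= x <= 1/2 the denominator is |1 - x e^{-it}|^2 >= (1 - x)^2. *)
Lemma ckern_den (x t : R) : 0 <= x <= 1 / 2 ->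
  1 / 4 <= (1 - x * cos t) ^+ 2 + (x * sin t) ^+ 2.
Proof.
move=> /andP[x0 x1]; have := cos2Dsin2 t; have := cos_le1 t; have := cos_geN1 t.
move: (cos t) (sin t) => c s c1 c2 cs.
have -> : (1 - x * c) ^+ 2 + (x * s) ^+ 2 = 1 - 2 * x * c + x ^+ 2 * (c ^+ 2 + s ^+ 2).
  by ring.
rewrite cs mulr1; have xc : x * c <= x by rewrite ler_piMr.
have : 0 <= (1 / 2 - x) * (3 / 2 - x) by apply: mulr_ge0; lra.
nra.
Qed.

Lemma ckernE (x t : R) : ckern x t =
  ((1 - x * cos t) / ((1 - x * cos t) ^+ 2 + (x * sin t) ^+ 2)) -i*
  ((x * sin t) / ((1 - x * cos t) ^+ 2 + (x * sin t) ^+ 2)).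
Proof.
rewrite /ckern (_ : 1 - x%:C * cis (- t) = (1 - x * cos t) +i* (x * sin t)) //.
apply: complexP; rewrite ?ReD ?ImD ?ReN ?ImN ?ReM ?ImM /= cosN sinN;
  by rewrite ?mul0r ?mulr0 ?subr0 ?addr0 ?add0r ?mulrN ?opprK.
Qed.

Lemma ckern_neq0 (x t : R) : 0 <= x <= 1 / 2 -> 1 - x%:C * cis (- t) != 0.
Proof.
move=> hx; apply/eqP => h; have := ckern_den t hx.
have := congr1 (@complex.Re R) h; have := congr1 (@complex.Im R) h.
rewrite ?ReD ?ImD ?ReN ?ImN ?ReM ?ImM /= cosN sinN.
rewrite !mul0r addr0 subr0 add0r mulrN opprK => -> ->.
by rewrite expr0n /= addr0; lra.
Qed.

Lemma norm1_ckern (x t : R) : 0 <= x <= 1 / 2 -> norm1 (ckern x t) <= 8.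
Proof.
move=> hx; rewrite ckernE /norm1 /= normrN !normrM.
have hd := ckern_den t hx; set q := _ ^+ 2 + _ in hd *.
have q0 : 0 < q by lra.
rewrite (ger0_norm (x := q^-1)) ?invr_ge0 ?(ltW q0)// -mulrDl ler_pdivrMr//.
move/andP: hx => [x0 x1].
have h1 : `|1 - x * cos t| <= 3 / 2.
  by have := cos_le1 t; have := cos_geN1 t; rewrite ler_norml; nra.
have h2 : `|x * sin t| <= 1 / 2.
  by have := sin_le1 t; have := sin_geN1 t; rewrite ler_norml; nra.
rewrite -[X in _ + X]normrM; lra.
Qed.

Lemma cmeas_ckern (x : R) : 0 <= x <= 1 / 2 -> cmeasurable (ckern x).
Proof.
move=> hx.
have cq : continuous (fun t : R => (1 - x * cos t) ^+ 2 + (x * sin t) ^+ 2).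
  under eq_fun do rewrite !expr2.
  move=> t; have c1 : x * cos u @[u --> t] --> x * cos t.
    by apply: cvgMr; exact: continuous_cos.
  have c2 : x * sin u @[u --> t] --> x * sin t.
    by apply: cvgMr; exact: continuous_sin.
  have c3 : 1 - x * cos u @[u --> t] --> 1 - x * cos t.
    by apply: cvgB => //; exact: cvg_cst.
  by apply: cvgD; apply: cvgM.
have mq : measurable_fun D (fun t => ((1 - x * cos t) ^+ 2 + (x * sin t) ^+ 2)^-1).
  apply: measurable_funTS; apply: continuous_measurable_fun => t; apply: cvgV.
    by rewrite gt_eqF//; have := ckern_den t hx; lra.
  exact: cq.
have mc : measurable_fun D (@cos R).
  by apply: measurable_funTS; apply: continuous_measurable_fun => t; exact: continuous_cos.
have ms : measurable_fun D (@sin R).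
  by apply: measurable_funTS; apply: continuous_measurable_fun => t; exact: continuous_sin.
split.
  under eq_fun do rewrite ckernE /=; apply: measurable_funM => //.
  by apply: measurable_funB => //; exact: measurable_funM.
under eq_fun do rewrite ckernE /=; apply: measurableT_comp => //.
by apply: measurable_funM => //; exact: measurable_funM.
Qed.

Lemma cint_ckern (x : R) (f : R -> C) : 0 <= x <= 1 / 2 -> cint f ->
  cint (fun t => ckern x t * f t).
Proof.
move=> hx hf; have i := intRZ 8 (intR_norm1 hf).
have [m1 m2] := cmeasM (cmeas_ckern hx) (cint_meas hf).
have b t : norm1 (ckern x t * f t) <= 8 * norm1 (f t).
  by apply: le_trans (norm1M _ _) _; rewrite ler_wpM2r ?norm1_ge0 ?norm1_ckern.
by split; apply: intR_le i => // t _; apply: le_trans (b t); rewrite /norm1 ?lerDl ?lerDr.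
Qed.

Section Tails.
Context {m n : nat}.
Implicit Types f : circle_fun R m n.

(** The N-th tail of the Taylor expansion of [disc f] at the real point x, divided
by x ^ N. *)
Definition tail f (N : nat) (x : R) : 'M[C]_(m, n) :=
  disc (fun t => cis (- (N%:Z%:~R * t)) *: f t) x%:C.

Lemma L1_tail f N : L1 f -> L1 (fun t => cis (- (N%:Z%:~R * t)) *: f t).
Proof. by move=> hf; under eq_fun do rewrite -mulNr; exact: L1_cisM. Qed.

Lemma L1_ckern f x : 0 <= x <= 1 / 2 -> L1 f ->
  L1 (fun t => (1 - x%:C * cis (- t))^-1 *: f t).
Proof.
move=> hx hf; apply/L1P => i j; under eq_fun do rewrite mxE.
by apply: cint_ckern => //; exact: hf.
Qed.

Lemma tail0 f x : tail f 0 x = disc f x%:C.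
Proof.
by apply: eq_mxmean => t _; rewrite mul0r oppr0 cis0 scale1r.
Qed.

Lemma tailS f N x : 0 <= x <= 1 / 2 -> L1 f ->
  tail f N x = fourier f N%:Z + x%:C *: tail f N.+1 x.
Proof.
move=> hx hf.
rewrite /tail /disc -mxmeanZ; last by apply: L1_ckern => //; exact: L1_tail.
rewrite -mxmeanD; last 2 first.
- exact: L1_tail.
- by apply: L1Z; apply: L1_ckern => //; exact: L1_tail.
apply: eq_mxmean => t _; rewrite !scalerA -scalerDl; congr (_ *: _).
have -> : cis (- (N.+1%:Z%:~R * t)) = cis (- t) * cis (- (N%:Z%:~R * t)) :> C.
  by rewrite -cisD; congr cis; rewrite intS intrD; ring.
have h := ckern_neq0 t hx.
move: h; move: (x%:C) (cis (- t)) (cis _) => a b c h.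
by field; exact: h.
Qed.

Lemma tail_bounded f N : L1 f -> exists2 K, 0 <= K &
  forall x, 0 <= x <= 1 / 2 -> forall i j, norm1 (tail f N x i j) <= K.
Proof.
move=> hf; pose g := fun t => cis (- (N%:Z%:~R * t)) *: f t.
have hg : L1 g by exact: L1_tail.
have p0 i j : 0 <= 8 * rmean (fun t => norm1 (g t i j)).
  by rewrite mulr_ge0// rmean_ge0// => t _; exact: norm1_ge0.
exists (\sum_i \sum_j 8 * rmean (fun t => norm1 (g t i j))).
  by apply: sumr_ge0 => i _; apply: sumr_ge0.
move=> x hx i j; rewrite mxE.
apply: (@le_trans _ _ (8 * rmean (fun t => norm1 (g t i j)))); last first.
  rewrite (bigD1 i)//= (bigD1 j)//= -addrA lerDl addr_ge0//.
    by apply: sumr_ge0.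
  by apply: sumr_ge0 => k _; apply: sumr_ge0.
have hc := cint_ckern hx (hg i j).
under eq_fun do rewrite mxE -/(ckern _ _).
apply: le_trans (norm1_cmean hc) _.
rewrite -rmeanZ; last exact/intR_norm1/hg.
apply: rmean_le; first exact: intR_norm1.
  by apply: intRZ; exact/intR_norm1/hg.
by move=> t _; apply: le_trans (norm1M _ _) _; rewrite ler_wpM2r ?norm1_ge0 ?norm1_ckern.
Qed.

End Tails.
End Disc.

(** * Taylor coefficients of the associated function *)

Section Coefficients.
Context {R : realType}.
Local Notation C := R[i].

(** Boundedness near the origin, uniformly on the segment where [ckern] is bounded. *)
Definition bdd {m n} (T : R -> 'M[C]_(m, n)) : Prop := exists2 K : R, 0 <= K &
  forall x, 0 <= x <= 1 / 2 -> forall i j, norm1 (T x i j) <= K.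

Lemma bdd_cst m n (A : 'M[C]_(m, n)) : bdd (fun=> A).
Proof.
exists (\sum_i \sum_j norm1 (A i j)).
  by apply: sumr_ge0 => i _; apply: sumr_ge0 => j _; exact: norm1_ge0.
move=> x _ i j; rewrite (bigD1 i)//= (bigD1 j)//= -addrA lerDl addr_ge0//.
  by apply: sumr_ge0 => k _; exact: norm1_ge0.
by apply: sumr_ge0 => k _; apply: sumr_ge0 => l _; exact: norm1_ge0.
Qed.

Lemma bddD m n (S T : R -> 'M[C]_(m, n)) : bdd S -> bdd T ->
  bdd (fun x => S x + T x).
Proof.
move=> [K K0 hK] [L L0 hL]; exists (K + L); first exact: addr_ge0.
move=> x hx i j; rewrite mxE; apply: le_trans (norm1D _ _) _.
by rewrite lerD ?hK ?hL.
Qed.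

Lemma bddN m n (S : R -> 'M[C]_(m, n)) : bdd S -> bdd (fun x => - S x).
Proof. by move=> [K K0 hK]; exists K => // x hx i j; rewrite mxE norm1N hK. Qed.

Lemma bddM m n p (S : R -> 'M[C]_(m, n)) (T : R -> 'M[C]_(n, p)) : bdd S -> bdd T ->
  bdd (fun x => S x *m T x).
Proof.
move=> [K K0 hK] [L L0 hL]; exists (n%:R * (K * L)).
  by rewrite mulr_ge0// mulr_ge0.
move=> x hx i j; rewrite mxE; apply: le_trans (norm1_sum _ _) _.
apply: (@le_trans _ _ (\sum_(k < n) K * L)); last first.
  by rewrite sumr_const card_ord mulr_natl.
apply: ler_sum => k _; apply: le_trans (norm1M _ _) _.
by rewrite ler_pM ?norm1_ge0 ?hK ?hL.
Qed.

Lemma bdd_sum m n k (S : nat -> R -> 'M[C]_(m, n)) : (forall i, bdd (S i)) ->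
  bdd (fun x => \sum_(i < k) S i x).
Proof.
move=> h; elim: k => [|k IH].
  by under eq_fun do rewrite big_ord0; exact: bdd_cst.
by under eq_fun do rewrite big_ord_recr; exact: bddD.
Qed.

(** Uniqueness of Taylor coefficients: a constant that is O(x) near 0 vanishes.
Iterated along the tails, it identifies coefficients one after the other. *)
Lemma bigO_cst_eq0 m n (M : 'M[C]_(m, n)) (T : R -> 'M[C]_(m, n)) d :
  0 < d <= 1 / 2 -> bdd T -> (forall x, 0 < x <= d -> M = x%:C *: T x) ->
  M = 0 /\ forall x, 0 < x <= d -> T x = 0.
Proof.
move=> /andP[d0 d1] [K K0 hK] h.
have M0 : M = 0.
  apply/matrixP => i j; rewrite [RHS]mxE; apply: norm1_eq0; apply/eqP.
  rewrite eq_le norm1_ge0 andbT leNgt; apply/negP => p.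
  pose x := Num.min d (norm1 (M i j) / (2 * (K + 1))).
  have x0 : 0 < x by rewrite lt_min d0 divr_gt0//; lra.
  have xd : x <= d by rewrite ge_min lexx.
  have xM : x * (2 * (K + 1)) <= norm1 (M i j).
    by rewrite -ler_pdivlMr ?ge_min ?lexx ?orbT//; lra.
  have hM : norm1 (M i j) <= x * K.
    rewrite {1}(h x) ?x0// mxE; apply: le_trans (norm1M _ _) _.
    rewrite norm1_real ger0_norm ?(ltW x0)// ler_wpM2l ?(ltW x0)//.
    by rewrite hK// (ltW x0) (le_trans xd).
  nra.
split=> // x hx; have := h x hx; rewrite M0 => /esym/eqP.
rewrite scaler_eq0 => /orP[/eqP/(congr1 (@complex.Re R)) /= x0|/eqP //].
by case/andP: hx; rewrite x0 ltxx.
Qed.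

(** A row vector v in the kernel satisfies v = - x v T, which forces v = 0 in l1 norm
as soon as x n K < 1, where K bounds the entries of T. *)
Lemma unitmx_near1 n (T : R -> 'M[C]_n) : bdd T ->
  exists2 d, 0 < d <= 1 / 2 & forall x, 0 < x <= d ->
    (1%:M + x%:C *: T x) \in unitmx.
Proof.
move=> [K K0 hK].
pose c := n%:R * K + 1; have c1 : 1 <= c by rewrite lerDr mulr_ge0.
exists (1 / (2 * c)).
  by rewrite divr_gt0//= ?ler_pdivrMr; lra.
move=> x /andP[x0 xd].
have xc : x * c <= 1 / 2.
  by move: xd; rewrite ler_pdivlMr; lra.
have x1 : 0 <= x <= 1 / 2 by apply/andP; split; nra.
rewrite -row_free_unit -kermx_eq0; apply/eqP; apply/row_matrixP => i.
set v := row i _.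
have hv : v *m (1%:M + x%:C *: T x) = 0 by rewrite /v -row_mul mulmx_ker row0.
rewrite row0; have ve : v = - (x%:C *: (v *m T x)).
  by move: hv; rewrite mulmxDr mulmx1 -scalemxAr => /eqP; rewrite addr_eq0 => /eqP.
pose s := \sum_j norm1 (v 0 j).
have s0 : 0 <= s by apply: sumr_ge0 => j _; exact: norm1_ge0.
have hs : s <= x * (n%:R * K) * s.
  apply: (@le_trans _ _ (\sum_(j < n) x * (K * s))); last first.
    by rewrite sumr_const card_ord -mulr_natl le_eqVlt; apply/orP; left; apply/eqP; ring.
  apply: ler_sum => j _; rewrite {1}ve mxE norm1N mxE; apply: le_trans (norm1M _ _) _.
  rewrite norm1_real ger0_norm ?(ltW x0)// ler_wpM2l ?(ltW x0)// mxE.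
  apply: le_trans (norm1_sum _ _) _; rewrite mulr_sumr; apply: ler_sum => k _.
  by apply: le_trans (norm1M _ _) _; rewrite mulrC ler_wpM2r ?norm1_ge0 ?hK.
have s00 : s = 0.
  apply/eqP; rewrite eq_le s0 andbT; rewrite /c in xc.
  by move: (n%:R * K) xc hs => w xc hs; nra.
apply/matrixP => a j; rewrite ord1 [RHS]mxE; apply: norm1_eq0; apply/eqP.
rewrite eq_le norm1_ge0 andbT -s00 /s (bigD1 j)//= lerDl.
by apply: sumr_ge0 => k _; exact: norm1_ge0.
Qed.

(** If b and E are the coefficients and the tails of a power series X, and E' the
tails of a power series Y, then X Y minus its Taylor polynomial of degree less than l
is z ^ l times [tail_prod b E E' l]. *)
Definition tail_prod {S : comPzRingType} {r} (b E E' : nat -> 'M[S]_r) l :=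
  \sum_(k < l) b k *m E' (l - k)%N + E l *m E' 0%N.

Lemma tail_prodS (S : comPzRingType) r (b a E E' : nat -> 'M[S]_r) (z : S) l :
  (forall k, E k = b k + z *: E k.+1) -> (forall k, E' k = a k + z *: E' k.+1) ->
  tail_prod b E E' l = \sum_(k < l.+1) b k *m a (l - k)%N + z *: tail_prod b E E' l.+1.
Proof.
move=> hE hE'; rewrite /tail_prod !big_ord_recr /= subnn subSnn.
rewrite {1}(hE l) mulmxDl {1}(hE' 0%N) mulmxDr -!scalemxAl -!scalemxAr !scalerDr.
have -> : \sum_(k < l) b k *m E' (l - k)%N =
    \sum_(k < l) b k *m a (l - k)%N + z *: \sum_(k < l) b k *m E' (l.+1 - k)%N.
  rewrite scaler_sumr -big_split /=; apply: eq_bigr => k _.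
  by rewrite hE' mulmxDr -scalemxAr subSn// ltnW.
rewrite -!addrA; congr (_ + _); rewrite addrCA; congr (_ + _).
Qed.

Section Associated.
Context {m r : nat} (G : circle_fun R m r) (B : circle_fun R r r).
Hypothesis L2G : L2 G.
Hypothesis meanG : mxmean (fun t => (G t)^t* *m G t) = 1%:M.
Hypothesis assocB : associated G B.

Definition gram : circle_fun R r r := fun t => (G t)^t* *m G t.

Lemma L1_gram : L1 gram.
Proof. by apply: (L1_mul (L2_adj L2G) L2G). Qed.

Lemma gram0 : fourier gram 0 = 1%:M.
Proof.
rewrite -meanG; apply: eq_mxmean => t _.
by rewrite mul0r oppr0 cis0 scale1r.
Qed.

(** (e^{it} + x) / (e^{it} - x) = 2 / (1 - x e^{-it}) - 1, and the mean of G^* G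
is 1: so F = 2 P - 1 with P = disc (G^* G). *)
Lemma herglotzE x : 0 <= x <= 1 / 2 ->
  herglotz G x%:C = 2%:R *: disc gram x%:C - 1%:M.
Proof.
move=> hx; rewrite -meanG /herglotz /disc -mxmeanZ; last first.
  by apply: L1_ckern => //; exact: L1_gram.
rewrite -mxmeanB; last 2 first.
- by apply: L1Z; apply: L1_ckern => //; exact: L1_gram.
- exact: L1_gram.
apply: eq_mxmean => t _.
transitivity ((2%:R * (1 - x%:C * cis (- t))^-1 - 1) *: gram t); last first.
  by rewrite scalerBl scale1r scalerA.
congr (_ *: _); have h := ckern_neq0 t hx.
have e : cis t * cis (- t) = 1 :> C by rewrite -cisD subrr cis0.
have h1 : cis t != 0 :> C.
  by apply/eqP => h0; move: e; rewrite h0 mul0r => /eqP; rewrite eq_sym oner_eq0.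
have ei : cis (- t) = (cis t)^-1 :> C by apply: (mulfI h1); rewrite e divff.
have h2 : cis t - x%:C != 0.
  have -> : cis t - x%:C = cis t * (1 - x%:C * cis (- t)).
    by rewrite mulrBr mulr1 mulrCA e mulr1.
  by rewrite mulf_neq0.
rewrite ei; move: h1 h2; move: (x%:C) (cis t) => a b h1 h2.
by field; rewrite h1 h2.
Qed.

(** (1 - B) P = 1 near the origin, where P is invertible since P(0) = 1:
indeed B = (F + 1)^-1 (F - 1) = P^-1 (P - 1). *)
Lemma assoc_disc : exists2 d, 0 < d <= 1 / 2 & forall x, 0 < x <= d ->
  (1%:M - disc B x%:C) *m disc gram x%:C = 1%:M.
Proof.
have [d hd hu] := unitmx_near1 (tail_bounded 1 L1_gram).
exists d => // x hx; have x1 : 0 <= x <= 1 / 2.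
  by case/andP: hx => x0 xd; case/andP: hd => d0 d1; rewrite ltW//= (le_trans xd).
have uP : disc gram x%:C \in unitmx.
  rewrite -tail0 tailS//; last exact: L1_gram.
  by rewrite gram0; exact: hu.
have [_ ->] := assocB; last first.
  rewrite normc_def /= expr0n addr0 sqrtr_sqr -[1]/(1%:C) ltcR.
  by case/andP: x1 => x0 x1; rewrite ger0_norm//; lra.
rewrite /assoc_B herglotzE//; set P := disc gram _ in uP *.
rewrite subrK; have -> : 2%:R *: P - 1%:M - 1%:M = 2%:R *: (P - 1%:M).
  by rewrite scalerBr -addrA -opprD; congr (_ - _); rewrite scaler_nat mulr2n.
have u2 : (2%:R : C) \is a GRing.unit by rewrite unitfE pnatr_eq0.
rewrite invmxZ ?unitmxZ// -scalemxAl -scalemxAr scalerA mulVf ?pnatr_eq0// scale1r.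
rewrite (mulmxBr (invmx P)) mulVmx// mulmx1.
by rewrite opprB addrC subrK mulVmx.
Qed.

(** The Taylor coefficients of 1 - B. *)
Definition bcoef (k : nat) : 'M[C]_r := (k == 0)%N%:R *: 1%:M - fourier B k%:Z.

(** The identity (1 - B) P = 1 coefficient by coefficient.  All the tails of the
product (1 - B) P are bounded near 0, so [bigO_cst_eq0] peels off the coefficients
one at a time. *)
Lemma assoc_coef n : \sum_(k < n.+1) bcoef k *m fourier gram (n - k)%N%:Z =
  (n == 0)%N%:R *: 1%:M.
Proof.
have L1B : L1 B by apply: L2_L1; apply: Linf_L2; case: assocB => -[].
have [d hd dE] := assoc_disc.
have hdx x : 0 < x <= d -> 0 <= x <= 1 / 2.
  by move=> /andP[x0 xd]; case/andP: hd => d0 d1; rewrite ltW//= (le_trans xd).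
pose E n x : 'M[C]_r := (n == 0)%N%:R *: 1%:M - tail B n x.
pose E' n x := tail gram n x.
have ES k x : 0 <= x <= 1 / 2 -> E k x = bcoef k + x%:C *: E k.+1 x.
  by move=> hx; rewrite /E tailS// /bcoef scale0r sub0r scalerN opprD addrA.
have ES' k x : 0 <= x <= 1 / 2 -> E' k x = fourier gram k%:Z + x%:C *: E' k.+1 x.
  by move=> hx; rewrite /E' tailS//; exact: L1_gram.
pose F n x := tail_prod bcoef (E ^~ x) (E' ^~ x) n.
have FS l x : 0 <= x <= 1 / 2 ->
    F l x = \sum_(k < l.+1) bcoef k *m fourier gram (l - k)%N%:Z + x%:C *: F l.+1 x.
  by move=> hx; apply: (@tail_prodS _ _ bcoef (fun k => fourier gram k%:Z)
    (E ^~ x) (E' ^~ x)) => k; [exact: ES|exact: ES'].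
have bF l : bdd (F l).
  apply: bddD.
    apply: (bdd_sum _ (S := fun k x => bcoef k *m E' (l - k)%N x)) => k.
    by apply: bddM; [exact: bdd_cst|apply: tail_bounded; exact: L1_gram].
  apply: bddM; last by apply: tail_bounded; exact: L1_gram.
  by apply: bddD; [exact: bdd_cst|apply: bddN; exact: tail_bounded].
have F0 x : 0 < x <= d -> F 0 x = 1%:M.
  move=> hx; rewrite /F /tail_prod big_ord0 add0r /E /E' !tail0 scale1r; exact: dE.
have step l M : (forall x, 0 < x <= d -> F l x = M) ->
    \sum_(k < l.+1) bcoef k *m fourier gram (l - k)%N%:Z = M /\
    forall x, 0 < x <= d -> F l.+1 x = 0.
  move=> h; have [|h1 h2] := @bigO_cst_eq0 _ _
    (M - \sum_(k < l.+1) bcoef k *m fourier gram (l - k)%N%:Z) (F l.+1) d hd (bF _).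
    by move=> x hx; rewrite -(h x hx) FS ?hdx// addrC addKr.
  by split=> //; apply/esym/eqP; rewrite -subr_eq0 h1.
have FSn l x : 0 < x <= d -> F l.+1 x = 0.
  move: x; elim: l => [|l IH].
    by have [_] := step 0%N _ F0.
  by have [_] := step _ _ IH.
case: n => [|n]; first by rewrite scale1r; have [] := step 0%N _ F0.
by rewrite scale0r; have [] := step n.+1 _ (FSn n).
Qed.

End Associated.

Lemma disc0 m n (f : circle_fun R m n) : disc f 0 = fourier f 0.
Proof.
apply: eq_mxmean => t _.
by rewrite !mul0r subr0 invr1 oppr0 cis0.
Qed.

End Coefficients.

(** * Triangular Toeplitz systems and the defect identity *)

Section Toeplitz.
Context {R : realType}.
Local Notation C := R[i].
Local Opaque inner_prod.

Lemma adjM m n p (A : 'M[C]_(m, n)) (B : 'M[C]_(n, p)) :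
  (A *m B)^t* = B^t* *m A^t*.
Proof. by rewrite trmx_mul map_mxM. Qed.

Lemma adj_sum (I : Type) (s : seq I) (P : pred I) m n (F : I -> 'M[C]_(m, n)) :
  (\sum_(i <- s | P i) F i)^t* = \sum_(i <- s | P i) (F i)^t*.
Proof. by rewrite raddf_sum /= raddf_sum. Qed.

Section Algebra.
Context {r : nat} (A b : nat -> 'M[C]_r).
Hypothesis hAb : forall n, \sum_(k < n.+1) b k *m A (n - k)%N = (n == 0)%N%:R *: 1%:M.
Implicit Types x y u : nat -> 'cV[C]_r.

(** When b is the sequence of coefficients of 1 - B, this is y = x - T_{B*} x for the
polynomial x with coefficients x_0, ..., x_{N-1}. *)
Definition backsol N x : nat -> 'cV[C]_r :=
  fun k => \sum_(j < N | (k <= j)%N) (b (j - k)%N)^t* *m x j.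

Lemma conv_window N j l : (l < N)%N ->
  \sum_(k < N | (j <= k <= l)%N) b (l - k)%N *m A (k - j)%N =
  (l == j)%N%:R *: 1%:M.
Proof.
move=> lN; have [jl|lj] := leqP j l; last first.
  rewrite big1 => [|k /andP[h1 h2]]; first by rewrite ltn_eqF// scale0r.
  by move: (leq_ltn_trans (leq_trans h1 h2) lj); rewrite ltnn.
have -> : \sum_(k < N | (j <= k <= l)%N) b (l - k)%N *m A (k - j)%N =
    \sum_(j <= k < l.+1) b (l - k)%N *m A (k - j)%N.
  rewrite (big_nat_widen _ _ N)// (big_nat_widenl _ 0%N)// big_mkord.
  by apply: eq_bigl => k; rewrite /= ltnS andbC.
rewrite -{1}[j]add0n big_addn big_mkord subSn//.
rewrite (reindex_inj rev_ord_inj) /=.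
have -> : (l == j) = (l - j == 0)%N by rewrite subn_eq0 eqn_leq jl andbT.
rewrite -hAb; apply: eq_bigr => i _; rewrite subSS addnK.
have il : (i <= l - j)%N by rewrite -ltnS ltn_ord.
by congr (b _ *m _); lia.
Qed.

(** The triangular system solved by y, in adjoint form: the sum over k >= j of
y_k^* A_{k-j} is x_j^*, because b is the convolution inverse of A. *)
Lemma backsolE N x j : (j < N)%N ->
  (x j)^t* = \sum_(k < N | (j <= k)%N) (backsol N x k)^t* *m A (k - j)%N.
Proof.
move=> jN.
have -> : \sum_(k < N | (j <= k)%N) (backsol N x k)^t* *m A (k - j)%N =
    \sum_(k < N | (j <= k)%N) \sum_(l < N | (k <= l)%N)
      (x l)^t* *m (b (l - k)%N *m A (k - j)%N).
  apply: eq_bigr => k _; rewrite /backsol adj_sum mulmx_suml.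
  by apply: eq_bigr => l _; rewrite adjM trmxCK mulmxA.
rewrite (exchange_big_dep xpredT)//=.
have -> : \sum_(l < N) \sum_(k < N | (j <= k)%N && (k <= l)%N)
      (x l)^t* *m (b (l - k)%N *m A (k - j)%N) =
    \sum_(l < N) (l == j :> nat)%:R *: (x l)^t*.
  apply: eq_bigr => l _; rewrite -mulmx_sumr conv_window//.
  by rewrite -scalemxAr mulmx1.
rewrite (bigD1 (Ordinal jN))//= eqxx scale1r big1 ?addr0// => l lj.
by have /negbTE := lj; rewrite -val_eqE /= => ->; rewrite scale0r.
Qed.

(** Pairing y with the lower triangular Toeplitz matrix of A applied to u is pairing
x with u. *)
Lemma backsol_pair N x u :
  \sum_(k < N) \sum_(j < N | (j <= k)%N)
    (backsol N x k)^t* *m (A (k - j)%N *m u j) =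
  \sum_(j < N) (x j)^t* *m u j.
Proof.
rewrite (exchange_big_dep xpredT)//=; apply: eq_bigr => j _.
rewrite (backsolE x (ltn_ord j)) mulmx_suml.
by apply: eq_bigr => k _; rewrite mulmxA.
Qed.

Lemma backsol_trunc N K x : (N <= K)%N ->
  forall k, backsol K (fun j => if (j < N)%N then x j else 0) k = backsol N x k.
Proof.
move=> NK k; rewrite /backsol.
rewrite -(big_mkord (fun j => (k <= j)%N) (fun j => (b (j - k)%N)^t* *m (if (j < N)%N then x j else 0))).
rewrite -(big_mkord (fun j => (k <= j)%N) (fun j => (b (j - k)%N)^t* *m x j)).
rewrite [RHS](big_nat_widen 0%N N K)// [LHS]big_mkcond [RHS]big_mkcond /=.
apply: eq_bigr => j _; case: (k <= j)%N => //=.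
by case: ltnP => //; rewrite mulmx0.
Qed.

Lemma backsolB N x u k :
  backsol N (fun j => x j - u j) k = backsol N x k - backsol N u k.
Proof. by rewrite /backsol -sumrB; apply: eq_bigr => j _; rewrite mulmxBr. Qed.

Lemma backsol_ge N x k : (N <= k)%N -> backsol N x k = 0.
Proof.
move=> Nk; rewrite /backsol big1// => j kj.
by have := leq_ltn_trans (leq_trans Nk kj) (ltn_ord j); rewrite ltnn.
Qed.

End Algebra.

(** A hermitian Toeplitz matrix with unit diagonal is the sum of its lower and upper
triangular parts minus the identity. *)
Lemma toeplitz_split r (a : int -> 'M[C]_r) N (u : nat -> 'cV[C]_r) (k : 'I_N) :
  a 0 = 1%:M -> (forall l, a (- l) = (a l)^t*) ->
  \sum_(j < N) a (k%:Z - j%:Z) *m u j =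
  \sum_(j < N | (j <= k)%N) a (k - j)%N%:Z *m u j +
  \sum_(j < N | (k <= j)%N) (a (j - k)%N%:Z)^t* *m u j - u k.
Proof.
move=> a0 aN; rewrite (bigID (fun j : 'I_N => (j <= k)%N))/= -addrA.
congr (_ + _); first by apply: eq_bigr => j jk; rewrite subzn.
rewrite [in RHS](bigD1 k)//= subnn a0 trmx1 map_mx1 mul1mx addrAC subrr add0r.
apply: eq_big => [j|j jk]; first by rewrite -ltnNge ltn_neqAle andbC eq_sym.
have kj : (k <= j)%N by rewrite ltnW// ltnNge.
by rewrite -aN; congr (a _ *m _); rewrite -subzn// opprB.
Qed.

Section Gram.
Context {m r : nat} (G : circle_fun R m r).
Hypothesis L2G : L2 G.

(** G^* G h: integrable as soon as G h is in L2, but in general not in L2. *)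
Definition gramapp (h : circle_fun R r 1) : circle_fun R r 1 :=
  mxmulf (mxadjf G) (mxmulf G h).

Lemma gramappE h : gramapp h = mxmulf (gram G) h.
Proof. by apply/funext => t; rewrite /gramapp /mxmulf /mxadjf /gram mulmxA. Qed.

Lemma fourier_gram_adj k : fourier (gram G) (- k) = (fourier (gram G) k)^t*.
Proof.
have gramK : mxadjf (gram G) = gram G.
  by apply/funext => t; rewrite /mxadjf /gram adjM trmxCK.
have := fourier_adj (- k) (L1_gram L2G); rewrite gramK => ->.
by rewrite (opprK k).
Qed.

Lemma L2_Gmono k e : L2 (mxmulf G (mono k e)).
Proof.
have -> : mxmulf G (mono k e) = fun t => cis (k%:~R * t) *: (G t *m e).
  by apply/funext => t; rewrite /mxmulf /mono scalemxAr.
by apply: L2_cisM; exact: L2_mulmx.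
Qed.

Lemma Gpol_sum N y : mxmulf G (pol N y) = fun t => \sum_(k < N) mxmulf G (mono k%:Z (y k)) t.
Proof. by apply/funext => t; rewrite /mxmulf /pol mulmx_sumr. Qed.

Lemma L2_Gpol N y : L2 (mxmulf G (pol N y)).
Proof. by rewrite Gpol_sum; apply: L2_sum => k; exact: L2_Gmono. Qed.

Lemma ip_Gmono h k e : L2 (mxmulf G h) ->
  inner_prod (mxmulf G h) (mxmulf G (mono k e)) =
  (e^t* *m fourier (gramapp h) k) 0 0.
Proof.
move=> hG.
have -> : mxmulf G (mono k e) = mxmulf (mxadjf (mxadjf G)) (mono k e).
  by apply/funext => t; rewrite /mxmulf /mxadjf trmxCK.
by rewrite -ip_adj ip_mono//; apply: L1_mul => //; exact: L2_adj.
Qed.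

Lemma ip_Gpol h N y : L2 (mxmulf G h) ->
  inner_prod (mxmulf G h) (mxmulf G (pol N y)) =
  \sum_(k < N) ((y k)^t* *m fourier (gramapp h) k%:Z) 0 0.
Proof.
move=> hG; rewrite Gpol_sum ip_sumr//; last by move=> k; exact: L2_Gmono.
by apply: eq_bigr => k _; exact: ip_Gmono.
Qed.

Lemma fourier_gramapp_pol N y k :
  fourier (gramapp (pol N y)) k = \sum_(j < N) fourier (gram G) (k - j%:Z) *m y j.
Proof. by rewrite gramappE; apply: fourier_mul_pol; exact: L1_gram. Qed.

End Gram.

Section Defect.
Local Opaque fourier.
Context {m r : nat} (G : circle_fun R m r) (b : nat -> 'M[C]_r).
Hypothesis L2G : L2 G.
Hypothesis gram0 : fourier (gram G) 0 = 1%:M.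
Hypothesis conv : forall n, \sum_(k < n.+1) b k *m fourier (gram G) (n - k)%N%:Z =
  (n == 0)%N%:R *: 1%:M.

Let A (k : nat) := fourier (gram G) k%:Z.
Let y N x := backsol b N x.

Lemma fourier_gram_split N (u : nat -> 'cV[C]_r) (k : 'I_N) :
  \sum_(j < N) fourier (gram G) (k%:Z - j%:Z) *m u j =
  \sum_(j < N | (j <= k)%N) A (k - j)%N *m u j +
  \sum_(j < N | (k <= j)%N) (A (j - k)%N)^t* *m u j - u k.
Proof.
exact: (@toeplitz_split r (fourier (gram G)) N u k gram0 (fourier_gram_adj L2G)).
Qed.

(** || G y ||^2 is the Toeplitz form of A at y.  By [toeplitz_split] and
[backsol_pair] its lower part is x^* y, its upper part the conjugate y^* x, and the
diagonal is subtracted once: x^* y + y^* x - y^* y = x^* x - (x - y)^* (x - y). *)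
Lemma defect N x : sqnorm (mxmulf G (pol N (y N x))) =
  \sum_(k < N) vnsq (x k) - \sum_(k < N) vnsq (x k - y N x k).
Proof.
apply: complexI; rewrite -ip_self ip_Gpol//; last exact: L2_Gpol.
set Y := y N x.
have h1 : \sum_(k < N) \sum_(j < N | (j <= k)%N) ((Y k)^t* *m (A (k - j)%N *m Y j)) =
    \sum_(j < N) (x j)^t* *m Y j.
  exact: (@backsol_pair r A b conv N x Y).
have h2 : \sum_(k < N) \sum_(j < N | (k <= j)%N) ((Y k)^t* *m ((A (j - k)%N)^t* *m Y j)) =
    \sum_(j < N) (Y j)^t* *m x j.
  have -> : \sum_(j < N) (Y j)^t* *m x j = (\sum_(j < N) (x j)^t* *m Y j)^t*.
    by rewrite adj_sum; apply: eq_bigr => j _; rewrite adjM trmxCK.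
  rewrite -h1 adj_sum (exchange_big_dep xpredT)//=; apply: eq_bigr => k _.
  by rewrite adj_sum; apply: eq_bigr => j _; rewrite !adjM trmxCK mulmxA.
have -> : \sum_(k < N) ((Y k)^t* *m fourier (gramapp G (pol N Y)) k%:Z) 0 0 =
    (\sum_(k < N) ((x k)^t* *m Y k + (Y k)^t* *m x k - (Y k)^t* *m Y k)) 0 0.
  rewrite -summxE; congr (fun_of_matrix _ 0 0).
  rewrite sumrB big_split /= -h1 -h2 -big_split -sumrB /=; apply: eq_bigr => k _.
  rewrite fourier_gramapp_pol// fourier_gram_split mulmxBr mulmxDr.
  by rewrite !mulmx_sumr.
rewrite summxE rmorphB !rmorph_sum -sumrB; apply: eq_bigr => k _ /=.
rewrite -!vnsqE.
have -> : (x k - Y k)^t* = (x k)^t* - (Y k)^t*.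
  by rewrite raddfB /= raddfB.
rewrite mulmxBr !mulmxBl.
by move: ((x k)^t* *m Y k) ((Y k)^t* *m x k) ((Y k)^t* *m Y k) ((x k)^t* *m x k)
  => P Q S T; rewrite !mxE; ring.
Qed.

(** If the coefficients of G^* G h are those of P h, the pairing of G h with G y
reduces to that of h with x. *)
Lemma ip_backsol h N x : L2 (mxmulf G h) ->
  (forall k, (k < N)%N -> fourier (gramapp G h) k%:Z =
     \sum_(j < N | (j <= k)%N) A (k - j)%N *m fourier h j%:Z) ->
  inner_prod (mxmulf G h) (mxmulf G (pol N (y N x))) =
  \sum_(j < N) ((x j)^t* *m fourier h j%:Z) 0 0.
Proof.
move=> hG hh; rewrite (ip_Gpol L2G _ _ hG).
have := congr1 (fun M : 'M[C]_1 => M 0 0)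
  (@backsol_pair r A b conv N x (fun j => fourier h j%:Z)).
rewrite !summxE => <-; apply: eq_bigr => k _.
by rewrite hh// mulmx_sumr.
Qed.

End Defect.

Lemma bessel r (w : circle_fun R r 1) N : L2 w ->
  \sum_(k < N) vnsq (fourier w k%:Z) <= sqnorm w.
Proof.
move=> hw; have hp : L2 (psum w N) by exact: L2_pol.
have := sqnorm_ge0 (fun t => w t - psum w N t).
rewrite sqnormB//.
have -> : inner_prod w (psum w N) = (sqnorm (psum w N))%:C.
  rewrite /psum ip_pol// sqnorm_pol rmorph_sum; apply: eq_bigr => k _.
  by rewrite vnsqE.
rewrite /psum sqnorm_pol /=; move: (sqnorm w) (\sum_(k < N) _) => a c; lra.
Qed.

End Toeplitz.

(** * Cutoffs of an unbounded multiplier *)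

Section Truncation.
Context {R : realType}.
Local Notation C := R[i].
Local Notation mu := (@lebesgue_measure R).
Local Notation D := (@circle_arc R).
Local Notation Re := complex.Re.
Local Opaque inner_prod.

Lemma intR_monotone (f_ : nat -> R -> R) (phi : R -> R) K :
  (forall n, intR (f_ n)) -> (forall n t, D t -> 0 <= f_ n t) ->
  (forall t, D t -> nondecreasing_seq (f_ ^~ t)) ->
  (forall t, D t -> f_ n t @[n --> \oo] --> phi t) ->
  measurable_fun D phi -> (forall n, rmean (f_ n) <= K) ->
  intR phi /\ rmean phi <= K.
Proof.
move=> fi f0 nd cv mphi fK.
have cvE t : D t -> EFin \o (f_ ^~ t) @ \oo --> (phi t)%:E.
  by move=> Dt; apply/fine_cvgP; split; [near=> n|exact: cv].
have phi0 t : D t -> 0 <= phi t.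
  move=> Dt; apply: (cvgr_to_ge (cv t Dt)).
  by near=> n; exact: f0.
have mE n : measurable_fun D (EFin \o f_ n).
  by apply/measurable_EFinP; exact: intR_meas.
have p0 n t : D t -> (0 <= (EFin \o f_ n) t)%E by move=> Dt; rewrite lee_fin f0.
have pnd t : D t -> {homo (fun n => (EFin \o f_ n) t) : n k / (n <= k)%N >-> (n <= k)%E}.
  by move=> Dt n k nk; rewrite lee_fin; exact: nd.
have cvI : (\int[mu]_(x in D) (EFin \o f_ n) x)%E @[n --> \oo] -->
    (\int[mu]_(x in D) (phi x)%:E)%E.
  rewrite (@eq_integral _ _ _ mu D (fun x => limn (fun n => (EFin \o f_ n) x))).
    exact: (cvg_monotone_convergence (mcircle (R := R)) mE p0 pnd).
  move=> t /set_mem Dt; apply/esym; apply: cvg_lim => //; exact: cvE.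
have le2 : (\int[mu]_(x in D) (phi x)%:E <= ((2 * pi) * K)%:E)%E.
  apply: (cvge_to_le cvI); near=> n.
  rewrite -(@fineK _ (integral _ _ _)); last exact: (integrable_fin_num (mcircle (R := R)) (fi n)).
  rewrite lee_fin; have := fK n; rewrite /rmean mulrC ler_pdivrMr ?twopi_gt0//.
  by rewrite [_ * (2 * pi)]mulrC.
have iphi : intR phi.
  apply/integrableP; split; first exact/measurable_EFinP.
  rewrite (@eq_integral _ _ _ mu D (fun x => (phi x)%:E)).
    by apply: le_lt_trans le2 _; rewrite ltry.
  by move=> t /set_mem Dt /=; rewrite ger0_norm ?phi0.
split=> //; rewrite /rmean mulrC ler_pdivrMr ?twopi_gt0// mulrC.
rewrite -lee_fin /Rintegral fineK//; exact: (integrable_fin_num (mcircle (R := R)) iphi).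
Unshelve. all: by end_near. Qed.

Section Cutoff.
Context {m r : nat} (G : circle_fun R m r).
Hypothesis L2G : L2 G.

Let S (t : R) : R := \sum_i \sum_j normsq (G t i j).

Let S_ge0 t : 0 <= S t.
Proof. by apply: sumr_ge0 => i _; apply: sumr_ge0 => j _; exact: normsq_ge0. Qed.

(** A continuous scalar cutoff, vanishing where |G|^2 exceeds l + 1. *)
Let cut (l : nat) (t : R) : R := Num.max 0 (1 - S t / l.+1%:R).

Let cut_itv l t : 0 <= cut l t <= 1.
Proof.
rewrite /cut le_max lexx /= ge_max ler01 /= gerBl.
by rewrite divr_ge0.
Qed.

Let meas_S : measurable_fun D S.
Proof.
have [+ _] : cmeasurable (fun t => \sum_i \sum_j (normsq (G t i j))%:C).
  apply: cmeas_sum => i; apply: cmeas_sum => j; split => /=.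
    by apply: meas_normsq; have [] := L2G i j.
  exact: measurable_cst.
apply: eq_measurable_fun => t _.
by rewrite Re_sum; apply: eq_bigr => i _; rewrite Re_sum.
Qed.

Let meas_cut l : measurable_fun D (cut l).
Proof.
apply: measurable_maxr => //; apply: measurable_funB => //.
exact: measurable_funM.
Qed.

Definition cutmx l : circle_fun R m r := fun t => (cut l t)%:C *: G t.

Lemma Linf_cutmx l : Linf (cutmx l).
Proof.
move=> i j; split.
  rewrite /cutmx; under eq_fun do rewrite mxE; apply: cmeasM; last by have [] := L2G i j.
  by split => /=; [exact: meas_cut|exact: measurable_cst].
exists l.+1%:R; apply: ae_circleT => t _; rewrite mxE normsqM.
have -> : normsq (cut l t)%:C = cut l t ^+ 2 by rewrite /normsq /= expr0n addr0.
have GS : normsq (G t i j) <= S t.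
  rewrite /S (bigD1 i)//= (bigD1 j)//= -addrA lerDl addr_ge0//.
    by apply: sumr_ge0 => k _; exact: normsq_ge0.
  by apply: sumr_ge0 => k _; apply: sumr_ge0 => a _; exact: normsq_ge0.
have G0 := normsq_ge0 (G t i j); have s0 := S_ge0 t.
have [c0 c1] := andP (cut_itv l t).
have [Sl|lS] := leP (S t) l.+1%:R.
  by apply: le_trans Sl; apply: le_trans GS; rewrite ler_piMl// exprn_ile1.
have -> : cut l t = 0; last by rewrite expr0n mul0r.
by rewrite /cut max_l// subr_le0 ler_pdivlMr// mul1r ltW.
Qed.

Lemma sqnorm_cutmx_le l w : L2 (mxmulf G w) -> sqnorm (mxmulf (cutmx l) w) <= sqnorm (mxmulf G w).
Proof.
move=> hw; have e t i : mxmulf (cutmx l) w t i 0 = (cut l t)%:C * mxmulf G w t i 0.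
  by rewrite /mxmulf /cutmx -scalemxAl mxE.
have h i : sL2 (fun t => (cut l t)%:C * mxmulf G w t i 0) /\
    nsq (fun t => (cut l t)%:C * mxmulf G w t i 0) <= nsq (fun t => mxmulf G w t i 0).
  have mc : cmeasurable (fun t => (cut l t)%:C).
    by split => /=; [exact: meas_cut|exact: measurable_cst].
  have bc : ae_on_circle (fun t => normsq (cut l t)%:C <= 1).
    apply: ae_circleT => t _; have [c0 c1] := andP (cut_itv l t).
    by rewrite /normsq /= expr0n addr0; nra.
  split; first exact: (sL2_mul mc bc (hw i 0)).
  by have := nsq_mul_le mc bc (hw i 0); rewrite mul1r.
have hc : L2 (mxmulf (cutmx l) w).
  apply/L2P => i j; rewrite ord1; under eq_fun do rewrite e.
  by have [] := h i.
rewrite (sqnormE hc) (sqnormE hw); apply: ler_sum => i _; have [_ hi] := h i.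
by under [X in nsq X]eq_fun do rewrite e.
Qed.

(** Monotone convergence: the cutoffs increase to 1 pointwise. *)
Lemma L2_of_cutmx w K : L2 w -> (forall l, sqnorm (mxmulf (cutmx l) w) <= K) ->
  L2 (mxmulf G w) /\ sqnorm (mxmulf G w) <= K.
Proof.
move=> hw hK; pose q t : R := \sum_i normsq (mxmulf G w t i 0).
have mG i j : cmeasurable (fun t => mxmulf G w t i j).
  rewrite /mxmulf; under eq_fun do rewrite mxE; apply: cmeas_sum => k.
  by apply: cmeasM; [have [] := L2G i k|have [] := hw k j].
have q0 t : 0 <= q t by apply: sumr_ge0 => i _; exact: normsq_ge0.
have e l t : Re (((mxmulf (cutmx l) w t)^t* *m mxmulf (cutmx l) w t) 0 0) =
    cut l t ^+ 2 * q t.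
  rewrite dot_self /= mulr_sumr; apply: eq_bigr => i _.
  rewrite /mxmulf /cutmx -scalemxAl mxE normsqM; congr (_ * _).
  by rewrite /normsq /= expr0n addr0.
have hc l : L2 (mxmulf (cutmx l) w) by apply: L2_Linf_mul => //; exact: Linf_cutmx.
have mq : measurable_fun D q.
  have [+ _] : cmeasurable (fun t => \sum_i (normsq (mxmulf G w t i 0))%:C).
    by apply: cmeas_sum => i; split; [exact: meas_normsq|exact: measurable_cst].
  by apply: eq_measurable_fun => t _; rewrite Re_sum.
have [||||//|l|iq qK] := @intR_monotone (fun l t => cut l t ^+ 2 * q t) q K.
- move=> l; have [+ _] := ip_cint (hc l) (hc l).
  by under eq_fun do rewrite e.
- by move=> l t _; rewrite mulr_ge0 ?sqr_ge0.
- move=> t _; apply/nondecreasing_seqP => l.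
  have [c0 c1] := andP (cut_itv l t); have [d0 d1] := andP (cut_itv l.+1 t).
  have cd : cut l t <= cut l.+1 t.
    rewrite /cut; apply: le_max2 => //; rewrite lerD2l lerN2 ler_wpM2l//.
    by rewrite lef_pV2 ?posrE// ler_nat.
  by rewrite ler_wpM2r// ler_sqr ?nnegrE.
- move=> t _; rewrite -[X in _ --> X]mul1r.
  have c1 : cut l t @[l --> \oo] --> (1 : R).
    have c0 : 1 - S t / l.+1%:R @[l --> \oo] --> (1 : R).
      rewrite -[X in _ --> X]subr0; apply: cvgB; first exact: cvg_cst.
      rewrite -[X in _ --> X](mulr0 (S t)); apply: cvgMr.
      exact: cvg_harmonic.
    apply: (squeeze_cvgr (f := fun l => 1 - S t / l.+1%:R) (h := fun=> 1)).
    - near=> l; have [_ c1] := andP (cut_itv l t).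
      by rewrite c1 andbT /cut le_max lexx orbT.
    - exact: c0.
    - exact: cvg_cst.
  have c2 : cut l t ^+ 2 @[l --> \oo] --> (1 : R).
    rewrite -[X in _ --> X](mulr1 1); under eq_fun do rewrite expr2.
    exact: cvgM.
  by apply: cvgMl.
- apply: le_trans (hK l); rewrite sqnorm_def ipE le_eqVlt; apply/orP; left; apply/eqP.
  by apply: eq_rmean => t _; rewrite e.
have hG : L2 (mxmulf G w).
  apply/L2P => i j; rewrite ord1; split; first exact: mG.
  apply: intR_le iq; first exact: meas_normsq.
  move=> t _; rewrite ger0_norm ?normsq_ge0// /q (bigD1 i)//= lerDl.
  by apply: sumr_ge0 => k _; exact: normsq_ge0.
split=> //; apply: le_trans qK; rewrite sqnorm_def ipE.
rewrite le_eqVlt; apply/orP; left; apply/eqP; apply: eq_rmean => t _.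
by rewrite dot_self.
Unshelve. all: by end_near. Qed.

End Cutoff.
End Truncation.

(** * Isometry on the kernel of the adjoint Toeplitz operator *)

Section Isometry.
Context {R : realType}.
Local Notation C := R[i].
Local Notation Re := complex.Re.
Local Opaque inner_prod fourier.

(** x - y is T_{B*} x, written with an abstract sequence beta in place of the Fourier
coefficients of B. *)
Lemma backsol_diff_coef r (beta : int -> 'M[C]_r) (N : nat) (x : nat -> 'cV[C]_r) (k : nat) :
  (k < N)%N -> (forall l, l < 0 -> beta l = 0) ->
  x k - backsol (fun n => (n == 0)%N%:R *: 1%:M - beta n%:Z) N x k =
  \sum_(j < N) (beta (j%:Z - k%:Z))^t* *m x j.
Proof.
move=> kN b0.
have -> : backsol (fun n => (n == 0)%N%:R *: 1%:M - beta n%:Z) N x k =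
    x k - \sum_(j < N | (k <= j)%N) (beta (j - k)%N%:Z)^t* *m x j.
  rewrite /backsol (eq_bigr (fun j : 'I_N => (j == Ordinal kN)%:R *: x j -
      (beta (j - k)%N%:Z)^t* *m x j)); last first.
    move=> j kj; rewrite raddfB /= raddfB /= mulmxBl; congr (_ - _).
    rewrite subn_eq0 -val_eqE /= [in RHS]eqn_leq kj andbT.
    by case: (j <= k)%N; rewrite ?scale1r ?scale0r ?trmx1 ?map_mx1 ?mul1mx
      ?trmx0 ?map_mx0 ?mul0mx.
  rewrite sumrB; congr (_ - _).
  rewrite (bigD1 (Ordinal kN))//= eqxx scale1r big1 ?addr0// => j /andP[_ jk].
  by rewrite (negbTE jk) scale0r.
rewrite opprB addrC subrK [RHS](bigID (fun j : 'I_N => (k <= j)%N))/= [X in _ = _ + X]big1.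
  by rewrite addr0; apply: eq_bigr => j kj; rewrite subzn.
move=> j; rewrite -ltnNge => jk; rewrite b0 ?trmx0 ?map_mx0 ?mul0mx//.
by rewrite subr_lt0 ltz_nat.
Qed.

Context {m r : nat} (G : circle_fun R m r) (B : circle_fun R r r).
Hypothesis H2G : H2 G.
Hypothesis meanG : mxmean (fun t => (G t)^t* *m G t) = 1%:M.
Hypothesis assocB : associated G B.

Let L2G : L2 G. Proof. by case: H2G. Qed.
Let LinfB : Linf B. Proof. by case: assocB => -[]. Qed.
Let L1B : L1 B. Proof. by apply: L2_L1; exact: Linf_L2. Qed.
Let aB k : k < 0 -> fourier B k = 0. Proof. by case: assocB => -[_ h] _ /h. Qed.
Let LinfBs : Linf (mxadjf B). Proof. exact: Linf_adj. Qed.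

Let A0 : fourier (gram G) 0 = 1%:M := gram0 meanG.
Let conv := assoc_coef L2G meanG assocB.

(** The coefficients of x_N - T_{B*} x_N for the partial sum x_N of h. *)
Definition approx_y h N : nat -> 'cV[C]_r :=
  backsol (bcoef B) N (fun k => fourier h k%:Z).

Lemma backsol_diff N x k : (k < N)%N ->
  x k - backsol (bcoef B) N x k = fourier (mxmulf (mxadjf B) (pol N x)) k%:Z.
Proof.
move=> kN; rewrite (backsol_diff_coef x kN aB).
rewrite fourier_mul_pol; last by apply: L2_L1; exact: Linf_L2.
apply: eq_bigr => j _.
have e : (j%:Z - k%:Z)%R = - (k%:Z - j%:Z) by rewrite opprB.
exact: (congr1 (fun M => M *m x j) (esym (etrans (fourier_adj _ L1B)
  (congr1 (fun l => (fourier B l)^t*) (esym e))))).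
Qed.

(** || T_{B*} x_N ||^2 for the partial sum x_N of h: the coefficients of B^* x_N of
index at least N vanish. *)
Definition defect_sum h N : R :=
  \sum_(k < N) vnsq (fourier (mxmulf (mxadjf B) (psum h N)) k%:Z).

Lemma sqnorm_approx h N : sqnorm (mxmulf G (pol N (approx_y h N))) =
  sqnorm (psum h N) - defect_sum h N.
Proof.
rewrite (defect L2G A0 conv) /psum sqnorm_pol; congr (_ - _).
by apply: eq_bigr => k _; rewrite -/(approx_y h N k) /approx_y backsol_diff.
Qed.

Lemma sqnorm_backsol_le N x : sqnorm (mxmulf G (pol N (backsol (bcoef B) N x))) <=
  \sum_(k < N) vnsq (x k).
Proof.
rewrite (defect L2G A0 conv) gerBl; apply: sumr_ge0 => k _; exact: vnsq_ge0.
Qed.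

(** T_{B*} is bounded and kills h, so T_{B*} x_N is T_{B*} of the error x_N - h. *)
Lemma defect_sum_le h : H2 h ->
  (forall k : nat, fourier (mxmulf (mxadjf B) h) k%:Z = 0) ->
  exists2 K, 0 <= K & forall N, defect_sum h N <= K * sqnorm (fun t => psum h N t - h t).
Proof.
move=> hh h0; have [K K0 hK] := Linf_bounded LinfBs; exists K => // N.
have hd : L2 (fun t => psum h N t - h t) by apply: L2B; [exact: L2_pol|exact: H2_L2].
apply: le_trans (hK _ hd); apply: le_trans (bessel N (L2_Linf_mul LinfBs hd)).
have e k : fourier (mxmulf (mxadjf B) (psum h N)) k%:Z =
    fourier (mxmulf (mxadjf B) (fun t => psum h N t - h t)) k%:Z.
  have l1 : L1 (mxmulf (mxadjf B) (psum h N)).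
    by apply: L2_L1; apply: L2_Linf_mul LinfBs _; exact: L2_pol.
  have l2 : L1 (mxmulf (mxadjf B) h).
    by apply: L2_L1; apply: L2_Linf_mul LinfBs _; exact: H2_L2.
  have e1 := fourierB k%:Z l1 l2.
  have e2 : (fun t => mxmulf (mxadjf B) (psum h N) t - mxmulf (mxadjf B) h t) =
      mxmulf (mxadjf B) (fun t => psum h N t - h t).
    by apply/funext => t; rewrite /mxmulf mulmxBr.
  by apply: esym; rewrite -e2 e1 h0 subr0.
rewrite /defect_sum; apply: ler_sum => k _.
by rewrite e.
Qed.

Let p h N := pol N (approx_y h N).

(** y_K - y_N comes from the truncation to frequencies below K of the error
h - x_N, so the defect identity bounds G (y_K - y_N) by this error. *)
Lemma approx_tail h N K : (N <= K)%N -> H2 h ->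
  sqnorm (mxmulf G (fun t => p h K t - p h N t)) <= sqnorm (fun t => h t - psum h N t).
Proof.
move=> NK hh; have hd : L2 (fun t => h t - psum h N t).
  by apply: L2B; [exact: H2_L2|exact: L2_pol].
pose x k : 'cV[C]_r := fourier h k%:Z - (if (k < N)%N then fourier h k%:Z else 0).
have -> : (fun t => p h K t - p h N t) = pol K (backsol (bcoef B) K x).
  rewrite /p -(pol_widen NK); last by move=> k; exact: backsol_ge.
  rewrite -polB; congr pol; apply/funext => k.
  rewrite /x backsolB /approx_y; congr (_ - _); apply/esym.
  exact: (@backsol_trunc _ _ (bcoef B) N K (fun k => fourier h k%:Z) NK k).
apply: le_trans (sqnorm_backsol_le K x) _.
apply: le_trans (bessel K hd); apply: ler_sum => k _.
have l1 : L1 h by apply: L2_L1; exact: H2_L2.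
have l2 : L1 (psum h N) by apply: L2_L1; exact: L2_pol.
have e1 := fourierB k%:Z l1 l2.
have e2 : fourier (psum h N) k%:Z = if (k < N)%N then fourier h k%:Z else 0.
  exact: fourier_pol_nat.
by rewrite e1 e2.
Qed.

Section Convergence.
Variable h : circle_fun R r 1.
Hypothesis hh : H2 h.
Hypothesis h0 : forall k : nat, fourier (mxmulf (mxadjf B) h) k%:Z = 0.

Let L2p N : L2 (p h N). Proof. exact: L2_pol. Qed.
Let L2h : L2 h. Proof. exact: H2_L2. Qed.

(** y_N = x_N - T_{B*} x_N, where x_N tends to h and T_{B*} x_N tends to 0. *)
Lemma approx_cvg : cvL2 (p h) h.
Proof.
move=> e e0; have [K K0 hK] := defect_sum_le hh h0.
have [|N hN] := psum_cvg hh (e := e / (2 * K + 3)).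
  by rewrite divr_gt0//; lra.
exists N => n /hN; have := hK n.
have L2s : L2 (psum h n) by exact: L2_pol.
have -> : sqnorm (fun t => p h n t - h t) =
    sqnorm (fun t => (psum h n t - h t) - (psum h n t - p h n t)).
  by congr sqnorm; apply/funext => t; rewrite opprB [RHS]addrC subrKA.
have L2a := L2B L2s L2h; have L2b := L2B L2s (L2p n).
have -> : defect_sum h n = sqnorm (fun t => psum h n t - p h n t).
  rewrite /p /psum -polB sqnorm_pol; apply: eq_bigr => k _.
  by rewrite (backsol_diff _ (ltn_ord k)).
have := sqnorm_ge0 (fun t => (psum h n t - h t) + (psum h n t - p h n t)).
rewrite (sqnormD L2a L2b) (sqnormB L2a L2b).
have := sqnorm_ge0 (fun t => psum h n t - h t).
move: (sqnorm (fun t => psum h n t - h t)) (sqnorm (fun t => psum h n t - p h n t)) (Re _).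
move=> a b c a0 h1 h2; rewrite ltr_pdivlMr; last lra.
nra.
Qed.

(** Letting K tend to infinity in [approx_tail] is legitimate behind each bounded
cutoff of G; the bound does not depend on the cutoff. *)
Lemma L2_tail N : L2 (mxmulf G (fun t => h t - p h N t)) /\
  sqnorm (mxmulf G (fun t => h t - p h N t)) <= sqnorm (fun t => h t - psum h N t).
Proof.
have L2d := L2B L2h (L2p N); apply: (L2_of_cutmx L2G L2d) => l.
have Lc := Linf_cutmx L2G l.
have L2K K : L2 (fun t => p h K t - p h N t) by exact: L2B.
have cv : cvL2 (fun K t => p h K t - p h N t) (fun t => h t - p h N t).
  move=> e /approx_cvg[M hM]; exists M => n /hM.
  have -> // : (fun t => p h n t - p h N t - (h t - p h N t)) = (fun t => p h n t - h t).
  by apply/funext => t; rewrite opprB addrA subrK.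
have L2c K : L2 (mxmulf (cutmx G l) (fun t => p h K t - p h N t)).
  exact: L2_Linf_mul Lc (L2K K).
have lim := sqnorm_lim L2c (L2_Linf_mul Lc L2d) (cvL2_Linf Lc L2K L2d cv).
apply: (cvgr_to_le lim); near=> K.
have hG : L2 (mxmulf G (fun t => p h K t - p h N t)).
  have -> : mxmulf G (fun t => p h K t - p h N t) =
      fun t => mxmulf G (p h K) t - mxmulf G (p h N) t.
    by apply/funext => t; rewrite /mxmulf mulmxBr.
  by apply: L2B; exact: L2_Gpol.
apply: le_trans (sqnorm_cutmx_le L2G l hG) _; apply: approx_tail => //.
by near: K; exact: nbhs_infty_ge.
Unshelve. all: by end_near. Qed.

(** G y_N tends to G h, and its squared norm || x_N ||^2 - || T_{B*} x_N ||^2 tends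
to || h ||^2. *)
Lemma toeplitz_ker_isometry : H2 (mxmulf G h) /\ sqnorm (mxmulf G h) = sqnorm h.
Proof.
have L2Gp N : L2 (mxmulf G (p h N)) by exact: L2_Gpol.
have L2Gh : L2 (mxmulf G h).
  have -> : mxmulf G h = fun t => mxmulf G (fun t => h t - p h 0 t) t + mxmulf G (p h 0) t.
    by apply/funext => t; rewrite /mxmulf mulmxBr subrK.
  by apply: L2D => //; have [] := L2_tail 0.
have cv : cvL2 (fun N => mxmulf G (p h N)) (mxmulf G h).
  move=> e e0; have [M hM] := psum_cvg hh e0; exists M => n /hM.
  have [_] := L2_tail n; rewrite (sqnormBC (psum h n) h).
  rewrite (sqnormBC (mxmulf G (p h n)) (mxmulf G h)).
  have -> : (fun t => mxmulf G h t - mxmulf G (p h n) t) = mxmulf G (fun t => h t - p h n t).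
    by apply/funext => t; rewrite /mxmulf mulmxBr.
  exact: le_lt_trans.
have H2Gp N : H2 (mxmulf G (p h N)).
  split=> // k k0.
  have -> : fourier (mxmulf G (p h N)) k =
      \sum_(j < N) fourier G (k - j%:Z) *m approx_y h N j.
    by apply: fourier_mul_pol; exact: L2_L1.
  rewrite big1// => j _; have [_ aG] := H2G.
  have kj : k - j%:Z < 0 by apply: le_lt_trans k0; rewrite gerBl.
  by rewrite (aG _ kj) mul0mx.
split; first exact: analytic_lim H2Gp L2Gh cv.
have lim1 := sqnorm_lim L2Gp L2Gh cv.
have L2s N : L2 (psum h N) by exact: L2_pol.
have lim2 := sqnorm_lim L2s L2h (psum_cvg hh).
have lim3 : defect_sum h N @[N --> \oo] --> (0 : R).
  have [K K0 hK] := defect_sum_le hh h0.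
  apply/cvgrPdist_lt => e e0.
  have [|N hN] := psum_cvg hh (e := e / (K + 1)); first by rewrite divr_gt0//; lra.
  exists N => // n /= /hN; have := hK n; have := sqnorm_ge0 (fun t => psum h n t - h t).
  have : 0 <= defect_sum h n by apply: sumr_ge0 => k _; exact: vnsq_ge0.
  move: (sqnorm _) (defect_sum h n) => a d d0 a0 da; rewrite ltr_pdivlMr; last lra.
  by rewrite sub0r normrN ger0_norm// => h1; nra.
have lim4 : sqnorm (psum h N) - defect_sum h N @[N --> \oo] --> sqnorm h.
  by rewrite -[X in _ --> X]subr0; exact: cvgB lim2 lim3.
have e4 : (fun N => sqnorm (mxmulf G (p h N))) = (fun N => sqnorm (psum h N) - defect_sum h N).
  by apply/funext => N; exact: sqnorm_approx.
move: lim1; rewrite e4 => lim1.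
by rewrite -(cvg_lim (@Rhausdorff R) lim1) (cvg_lim (@Rhausdorff R) lim4).
Qed.

End Convergence.

End Isometry.

(** * Model spaces and backward shifts *)

Section ModelSpace.
Context {R : realType}.
Local Notation C := R[i].
Local Notation conjC := (@Num.conj C).
Local Opaque inner_prod fourier.

(** Polarization of a complex quadratic form. *)
Lemma form_eq0 n (M : 'M[C]_n) :
  (forall v : 'cV[C]_n, (v^t* *m M *m v) 0 0 = 0) -> M = 0.
Proof.
move=> h; pose q (u v : 'cV[C]_n) := (u^t* *m M *m v) 0 0.
have qE u v (c : C) : c * q u v + conjC c * q v u = 0.
  have := h (u + c *: v).
  have -> : (u + c *: v)^t* = u^t* + conjC c *: v^t*.
    by apply/matrixP => i j; rewrite !mxE rmorphD rmorphM.
  rewrite !mulmxDl !mulmxDr -!scalemxAl -!scalemxAr.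
  move: (h u) (h v); rewrite /q.
  move: (u^t* *m M *m u) (v^t* *m M *m v) (u^t* *m M *m v) (v^t* *m M *m u).
  by move=> S T X Y S0 T0; rewrite !mxE S0 T0 !mulr0 addr0 add0r.
apply/matrixP => i j; rewrite [RHS]mxE.
have -> : M i j = q (delta_mx i 0) (delta_mx j 0).
  rewrite /q mxE (bigD1 j)//= big1 ?addr0 => [|k kj]; last first.
    by rewrite [X in _ * X]mxE (negbTE kj) mulr0.
  rewrite [X in _ * X]mxE !eqxx mulr1 mxE (bigD1 i)//= big1 ?addr0 => [|k ki].
    by rewrite !mxE !eqxx rmorph1 mul1r.
  by rewrite !mxE (negbTE ki) rmorph0 mul0r.
have := qE (delta_mx i 0) (delta_mx j 0) 1.
have := qE (delta_mx i 0) (delta_mx j 0) (0 +i* 1).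
move: (q _ _) (q _ _) => [a b] [c d].
rewrite -[conjC (0 +i* 1)]/(0 +i* (-1)) rmorph1 !mul1r.
move=> /eqP; rewrite eq_complex /= => /andP[/eqP h1 /eqP h2].
move=> /eqP; rewrite eq_complex /= => /andP[/eqP h3 /eqP h4].
by apply: complexP => /=; lra.
Qed.

(** At full rank the initial space of the partial isometry is the whole space. *)
Lemma inner_unitary r (U : circle_fun R r r) : inner_of_rank U r ->
  ae_on_circle (fun t => (U t)^t* *m U t = 1%:M /\ U t *m (U t)^t* = 1%:M).
Proof.
case=> _ [K [E h]]; apply: ae_circleS h => t _ [pU _ _ rk].
have Uu : U t \in unitmx by rewrite -row_free_unit /row_free rk.
have iso (v : 'cV[C]_r) : (U t *m v)^t* *m (U t *m v) = v^t* *m v.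
  apply: pU => w Uw; have -> : w = 0 by rewrite -(mulKmx Uu w) Uw mulmx0.
  by rewrite trmx0 map_mx0 mul0mx.
have e : (U t)^t* *m U t = 1%:M.
  apply/eqP; rewrite -subr_eq0; apply/eqP; apply: form_eq0 => v.
  rewrite mulmxBr mulmxBl mulmx1 mulmxA -adjM -mulmxA iso.
  by rewrite subrr mxE.
by split => //; exact: mulmx1C.
Qed.

Context {r : nat} (U : circle_fun R r r).
Hypothesis HinfU : Hinf U.

Let LinfU : Linf U. Proof. by case: HinfU. Qed.
Let H2U (f : circle_fun R r 1) : H2 f -> H2 (mxmulf U f). Proof. exact: H2_Hinf_mul. Qed.

Lemma model_spaceP h : H2 h ->
  (forall f, H2 f -> inner_prod h (mxmulf U f) = 0) -> model_space U h.
Proof.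
move=> hh ho; split=> // g [f hf gf]; rewrite -(ho f hf).
by apply: ae_eq_ip => //; exact: ae_circleT.
Qed.

Lemma model_space_H2 h : model_space U h -> H2 h.
Proof. by case. Qed.

Lemma model_space_ip h f : model_space U h -> H2 f -> inner_prod h (mxmulf U f) = 0.
Proof. by move=> [_ ho] hf; apply: ho; exists f => //; exact: ae_circleT. Qed.

Lemma model_spaceD h g (c : C) : model_space U h -> model_space U g ->
  model_space U (fun t => h t + c *: g t).
Proof.
move=> mh mg; have hh := model_space_H2 mh; have hg := model_space_H2 mg.
apply: model_spaceP; first by apply: H2D => //; exact: H2Z.
move=> f hf; have L2Uf := H2_L2 (H2U hf).
rewrite (ipDl (H2_L2 hh) (L2Z c (H2_L2 hg)) L2Uf) (ipZl c (H2_L2 hg) L2Uf).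
by rewrite (model_space_ip mh hf) (model_space_ip mg hf) mulr0 addr0.
Qed.

Lemma ip_mono_l (f : circle_fun R r 1) k e : L2 f -> fourier f k = 0 ->
  inner_prod (mono k e) f = 0.
Proof.
move=> hf f0; rewrite (ipC hf (L2_mono k e)) ip_mono; last exact: L2_L1.
by rewrite f0 mulmx0 mxE rmorph0.
Qed.

(** U H2 has no constant term when U(0) = 0. *)
Lemma mono_model_space e : fourier U 0 = 0 -> model_space U (mono 0 e).
Proof.
move=> U0; apply: model_spaceP; first exact: (@H2_mono _ _ 0%N).
move=> f hf; apply: ip_mono_l; first exact: H2_L2 (H2U hf).
apply: fourier_eq0; first exact: L2_L1 (H2_L2 (H2U hf)).
move=> e'; rewrite ip_adj; apply: (ip_psum_orth hf).
  by apply: L2_Linf_mul; [exact: Linf_adj|exact: L2_mono].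
move=> k v; rewrite -ip_adj ip_mono; last first.
  by apply: L2_L1; apply: L2_Linf_mul => //; exact: L2_mono.
have -> : fourier (mxmulf U (mono k%:Z v)) 0 = fourier U (0 - k%:Z) *m v.
  by apply: fourier_mul_mono; apply: L2_L1; exact: Linf_L2.
have -> : fourier U (0 - k%:Z) = 0; last by rewrite mul0mx mulmx0 mxE.
have [_ aU] := HinfU; have [k0|k0] := eqVneq k 0%N; first by rewrite k0 subr0.
by apply: aU; rewrite sub0r oppr_lt0 ltz_nat lt0n.
Qed.

(** The n-th power of the backward shift. *)
Definition bshift (w : circle_fun R r 1) (n : nat) : circle_fun R r 1 :=
  fun t => cis ((- n%:Z)%:~R * t) *: (w t - psum w n t).

Lemma fourier_bshift w n k : L2 w ->
  fourier (bshift w n) k = fourier w (k + n%:Z) - fourier (psum w n) (k + n%:Z).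
Proof.
move=> hw; apply: etrans (fourier_cisM _ _ _) _; rewrite opprK.
by apply: fourierB; apply: L2_L1 => //; exact: L2_pol.
Qed.

Lemma H2_bshift w n : H2 w -> H2 (bshift w n).
Proof.
move=> hw; have L2w := H2_L2 hw; split.
  by apply: L2_cisM; apply: L2B => //; exact: L2_pol.
move=> k k0; rewrite (fourier_bshift _ _ L2w).
have [kn|kn] := ltP (k + n%:Z) 0.
  have [_ aw] := hw; have [_ ap] := H2_pol n (fun k => fourier w k%:Z).
  by rewrite (aw _ kn) (ap _ kn) subrr.
have e : fourier (psum w n) (absz (k + n%:Z))%:Z = fourier w (absz (k + n%:Z))%:Z.
  apply: etrans (fourier_pol_nat _ _ _) _; rewrite ifT//.
  by rewrite -ltz_nat gez0_abs// gtrDr.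
by move: e; rewrite gez0_abs// => ->; rewrite subrr.
Qed.

(** The functions U z^n f have no coefficient of index below n, so removing these
coefficients from w does not affect the pairing.  Besides w in K_U, this covers the
columns w of U, for n > 0. *)
Lemma bshift_model_space w n : H2 w ->
  (forall f, H2 f ->
    inner_prod w (mxmulf U (fun t => cis (n%:Z%:~R * t) *: f t)) = 0) ->
  model_space U (bshift w n).
Proof.
move=> hw ho; apply: model_spaceP; first exact: H2_bshift.
move=> f hf; pose g t := cis (n%:Z%:~R * t) *: f t.
have hg : H2 g by exact: H2_cisM.
have L2Ug := H2_L2 (H2U hg); have L2w := H2_L2 hw.
have -> : inner_prod (bshift w n) (mxmulf U f) =
    inner_prod (fun t => w t - psum w n t) (mxmulf U g).
  rewrite !ipE; apply: eq_cmean => t _; rewrite /bshift /mxmulf /g.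
  rewrite -scalemxAr -[in RHS]scalemxAr.
  have -> : (cis (n%:~R * t) *: (U t *m f t))^t* =
      cis ((- n%:Z)%:~R * t) *: (U t *m f t)^t*.
    by apply/matrixP => i j; rewrite !mxE rmorphM /= conj_cis intrN mulNr.
  by rewrite -scalemxAl.
rewrite ipBl//; last exact: L2_pol.
rewrite (ho f hf) /psum ip_suml//; last by move=> k; exact: L2_mono.
rewrite big1 ?subr0// => k _; apply: ip_mono_l => //.
have -> : mxmulf U g = fun t => cis (n%:Z%:~R * t) *: mxmulf U f t.
  by apply/funext => t; rewrite /mxmulf /g -scalemxAr.
apply: etrans (fourier_cisM _ _ _) _; have [_ aUf] := H2U hf.
by apply: aUf; rewrite subr_lt0 ltz_nat.
Qed.

End ModelSpace.

(** * The equivalence *)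

Section Characterization.
Context {R : realType}.
Local Notation C := R[i].
Local Notation Re := complex.Re.
Local Notation Im := complex.Im.
Local Notation conjC := (@Num.conj C).
Local Opaque inner_prod fourier.

Lemma L2norm_sqnorm m (f : circle_fun R m 1) : L2norm f = Num.sqrt (sqnorm f).
Proof. by rewrite sqnorm_def. Qed.

Lemma Re_conjM_i (z : C) : Re (conjC (0 +i* 1) * z) = Im z.
Proof. by case: z => a b; rewrite -[conjC (0 +i* 1)]/(0 +i* (-1)) ReM /=; ring. Qed.

(** Polarization of the isometry on the span of h and k. *)
Lemma isometry_inner_prod m r (G : circle_fun R m r) (h k : circle_fun R r 1) :
  L2 h -> L2 k -> L2 (mxmulf G h) -> L2 (mxmulf G k) ->
  (forall c : C, sqnorm (mxmulf G (fun t => h t + c *: k t)) = sqnorm (fun t => h t + c *: k t)) ->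
  sqnorm (mxmulf G h) = sqnorm h -> sqnorm (mxmulf G k) = sqnorm k ->
  inner_prod (mxmulf G h) (mxmulf G k) = inner_prod h k.
Proof.
move=> hh hk hGh hGk iso eh ek.
have e c : Re (conjC c * inner_prod (mxmulf G h) (mxmulf G k)) =
    Re (conjC c * inner_prod h k).
  have := iso c.
  have -> : mxmulf G (fun t => h t + c *: k t) =
      fun t => mxmulf G h t + c *: mxmulf G k t.
    by apply/funext => t; rewrite /mxmulf mulmxDr scalemxAr.
  rewrite (sqnormD hGh (L2Z c hGk)) (sqnormD hh (L2Z c hk)) (sqnormZ c hGk) (sqnormZ c hk).
  rewrite (ipZr c hGk hGh) (ipZr c hk hh) eh ek.
  by move/addrI; apply: mulfI; rewrite pnatr_eq0.
have := e 1; have := e (0 +i* 1).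
rewrite !Re_conjM_i rmorph1 !mul1r => h1 h2.
exact: complexP.
Qed.

Lemma toeplitz_adj0P r (B : circle_fun R r r) h : Linf B -> H2 h ->
  is_toeplitz (mxadjf B) h (fun=> 0) <->
  forall k : nat, fourier (mxmulf (mxadjf B) h) k%:Z = 0.
Proof.
move=> hB hh; split=> [[_ _ h0] k|h0].
  have := h0 k%:Z; rewrite (fourier0 k%:Z) => e.
  by move: e; rewrite le0z_nat => ->.
split.
- by apply: L2_L1; apply: L2_Linf_mul; [exact: Linf_adj|exact: H2_L2].
- by apply: L2_L1; exact: L2_cst.
- move=> k; rewrite (fourier0 k).
  by case: k => // k; rewrite le0z_nat h0.
Qed.

Section Equivalence.
Context {m r : nat} (G : circle_fun R m r) (B U : circle_fun R r r).
Hypothesis H2G : H2 G.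
Hypothesis meanG : mxmean (fun t => (G t)^t* *m G t) = 1%:M.
Hypothesis assocB : associated G B.
Hypothesis HinfU : Hinf U.
Hypothesis unitU : ae_on_circle (fun t => (U t)^t* *m U t = 1%:M /\ U t *m (U t)^t* = 1%:M).
Hypothesis U0 : fourier U 0 = 0.

Let L2G : L2 G. Proof. by case: H2G. Qed.
Let HinfB : Hinf B. Proof. by case: assocB. Qed.
Let LinfB : Linf B. Proof. by case: HinfB. Qed.
Let LinfBs : Linf (mxadjf B). Proof. exact: Linf_adj. Qed.
Let LinfU : Linf U. Proof. by case: HinfU. Qed.
Let LinfUs : Linf (mxadjf U). Proof. exact: Linf_adj. Qed.
Let conv := assoc_coef L2G meanG assocB.
Let A0 : fourier (gram G) 0 = 1%:M := gram0 meanG.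

Section Necessity.
Hypothesis iso : forall h, model_space U h ->
  H2 (mxmulf G h) /\ sqnorm (mxmulf G h) = sqnorm h.

(** The isometry polarized against the constants, which belong to K_U. *)
Lemma gramapp_coef0 h : model_space U h ->
  fourier (gramapp G h) 0 = fourier h 0.
Proof.
move=> mh; apply: coef_eq => e.
have me := mono_model_space HinfU e U0.
have [h1 h2] := iso mh; have [e1 e2] := iso me.
have L2h := H2_L2 (model_space_H2 mh); have L2e := H2_L2 (model_space_H2 me).
have <- := ip_mono 0 e (L2_L1 L2h).
have <- := ip_Gmono L2G 0 e (H2_L2 h1).
apply: isometry_inner_prod => //; try exact: H2_L2.
by move=> c; have [] := iso (model_spaceD HinfU c mh me).
Qed.

(** G^* G h and P h have the same k-th coefficient: apply [gramapp_coef0] to the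
k-th backward shift of h, and move the removed partial sum to the other side. *)
Lemma gramapp_coef h (k : nat) : model_space U h ->
  fourier (gramapp G h) k%:Z =
  \sum_(j < k.+1) fourier (gram G) (k%:Z - j%:Z) *m fourier h j%:Z.
Proof.
move=> mh; have hh := model_space_H2 mh; have L2h := H2_L2 hh.
have [hGh _] := iso mh.
have mk : model_space U (bshift h k).
  by apply: bshift_model_space => // f hf; apply: model_space_ip => //; exact: H2_cisM.
have := gramapp_coef0 mk.
have -> : fourier (bshift h k) 0 = fourier h k%:Z.
  rewrite (fourier_bshift _ _ L2h) add0r.
  have -> : fourier (psum h k) k%:Z = 0; last by rewrite subr0.
  by apply: etrans (fourier_pol_nat _ _ _) _; rewrite ltnn.
have l1 : L1 (gramapp G h) by apply: L1_mul; [exact: L2_adj|exact: H2_L2].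
have l2 : L1 (gramapp G (psum h k)) by apply: L1_mul; [exact: L2_adj|exact: L2_Gpol].
have -> : gramapp G (bshift h k) =
    fun t => cis ((- k%:Z)%:~R * t) *: (gramapp G h t - gramapp G (psum h k) t).
  by apply/funext => t; rewrite /gramapp /mxmulf /bshift -!scalemxAr !mulmxBr.
have -> : fourier (fun t => cis ((- k%:Z)%:~R * t) *:
      (gramapp G h t - gramapp G (psum h k) t)) 0 =
    fourier (gramapp G h) k%:Z - fourier (gramapp G (psum h k)) k%:Z.
  apply: etrans (fourier_cisM _ _ _) _; rewrite opprK add0r.
  exact: fourierB.
have -> : fourier (gramapp G (psum h k)) k%:Z =
    \sum_(j < k) fourier (gram G) (k%:Z - j%:Z) *m fourier h j%:Z.
  exact: fourier_gramapp_pol.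
move=> /eqP; rewrite subr_eq addrC => /eqP ->.
by rewrite big_ord_recr /= subrr A0 mul1mx.
Qed.

(** Expansion of || G h - G y_N ||^2 >= 0, where G h has the norm of h, the pairing
of G h with G y_N is || x_N ||^2, and || G y_N ||^2 is given by the defect identity. *)
Lemma defect_sum_tail h N : model_space U h ->
  defect_sum B h N <= sqnorm h - sqnorm (psum h N).
Proof.
move=> mh; have hh := model_space_H2 mh; have L2h := H2_L2 hh.
have [hGh eGh] := iso mh; have L2Gh := H2_L2 hGh.
have L2p : L2 (mxmulf G (pol N (approx_y B h N))) by exact: L2_Gpol.
have := sqnorm_ge0 (fun t => mxmulf G h t - mxmulf G (pol N (approx_y B h N)) t).
rewrite (sqnormB L2Gh L2p) (sqnorm_approx H2G meanG assocB h N) eGh.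
have -> : inner_prod (mxmulf G h) (mxmulf G (pol N (approx_y B h N))) =
    (sqnorm (psum h N))%:C.
  have coef k : (k < N)%N -> fourier (gramapp G h) k%:Z =
      \sum_(j < N | (j <= k)%N) fourier (gram G) (k - j)%N%:Z *m fourier h j%:Z.
    move=> kN; rewrite (gramapp_coef k mh).
    rewrite -(big_mkord xpredT (fun j => fourier (gram G) (k%:Z - j%:Z) *m fourier h j%:Z)).
    rewrite -(big_mkord (fun j => (j <= k)%N)
      (fun j => fourier (gram G) (k - j)%N%:Z *m fourier h j%:Z)).
    rewrite (big_nat_widen _ _ _ _ _ kN); apply: eq_big => j.
      by rewrite ltnS.
    by rewrite ltnS => jk; rewrite subzn.
  rewrite (ip_backsol L2G conv (fun k => fourier h k%:Z) L2Gh coef).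
  rewrite /psum sqnorm_pol rmorph_sum; apply: eq_bigr => k _.
  exact: vnsqE.
rewrite /=; move: (sqnorm h) (sqnorm (psum h N)) (defect_sum B h N) => a b c; lra.
Qed.

(** The k-th coefficient of B^* h is that of B^* x_N up to the error h - x_N; the first
is at most || T_{B*} x_N ||, controlled by [defect_sum_tail]. *)
Lemma isometry_toeplitz h (k : nat) : model_space U h ->
  fourier (mxmulf (mxadjf B) h) k%:Z = 0.
Proof.
move=> mh; have hh := model_space_H2 mh; have L2h := H2_L2 hh.
have [K K0 hK] := Linf_bounded LinfBs.
have L2s N : L2 (psum h N) by exact: L2_pol.
have lim := sqnorm_lim L2s L2h (psum_cvg hh).
apply: vnsq_eq0; apply/eqP; rewrite eq_le vnsq_ge0 andbT.
apply/ler_addgt0Pr => e e0; rewrite add0r.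
have K2 : 0 < 2 * K + 2 by lra.
(* the partial sum will contribute 2 e1 to the bound, the error 2 K e1 *)
have e1 : 0 < e / (2 * K + 2) by rewrite divr_gt0.
have e3 : e = (2 * K + 2) * (e / (2 * K + 2)) by field; exact: lt0r_neq0.
have arith (v v1 v2 D d x : R) : v <= 2 * v1 + 2 * v2 -> v1 <= D -> v2 <= K * d ->
    D < x -> d < x -> v <= (2 * K + 2) * x.
  by move=> h1 h2 h3 h4 h5; nra.
have [N1 hN1] := psum_cvg hh e1.
have /cvgrPdist_lt/(_ _ e1)[M2 _ hM2] := lim.
pose N := maxn k.+1 (maxn N1 M2).
have := hN1 N; have := hM2 N; rewrite /= !leq_max !leqnn !orbT => /(_ isT) b1 /(_ isT) b2.
have b3 := defect_sum_tail N mh.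
have L2d := L2B (L2s N) L2h.
have l1 : L2 (mxmulf (mxadjf B) (psum h N)) by exact: L2_Linf_mul.
have l2 : L2 (mxmulf (mxadjf B) h) by exact: L2_Linf_mul.
have l3 : L2 (mxmulf (mxadjf B) (fun t => psum h N t - h t)) by exact: L2_Linf_mul.
have kN : (k < N)%N by rewrite leq_max leqnn.
have e2 : fourier (mxmulf (mxadjf B) h) k%:Z = fourier (mxmulf (mxadjf B) (psum h N)) k%:Z -
    fourier (mxmulf (mxadjf B) (fun t => psum h N t - h t)) k%:Z.
  have h1 := fourierB k%:Z (L2_L1 l1) (L2_L1 l3).
  rewrite -h1; apply: ae_eq_fourier; apply: ae_circleT => t _.
  by rewrite /mxmulf mulmxBr opprB addrC subrK.
have c1 : vnsq (fourier (mxmulf (mxadjf B) (psum h N)) k%:Z) <= defect_sum B h N.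
  rewrite /defect_sum (bigD1 (Ordinal kN))//= lerDl; apply: sumr_ge0 => j _.
  exact: vnsq_ge0.
have c2 : vnsq (fourier (mxmulf (mxadjf B) (fun t => psum h N t - h t)) k%:Z) <=
    K * sqnorm (fun t => psum h N t - h t).
  apply: le_trans (hK _ L2d); apply: le_trans (bessel N l3).
  rewrite (bigD1 (Ordinal kN))//= lerDl; apply: sumr_ge0 => j _.
  exact: vnsq_ge0.
have := vnsqD_le (fourier (mxmulf (mxadjf B) (psum h N)) k%:Z)
  (- fourier (mxmulf (mxadjf B) (fun t => psum h N t - h t)) k%:Z).
rewrite vnsqN -e2.
move=> b0; have b4 := le_lt_trans (le_trans b3 (ler_norm _)) b1.
by rewrite e3; exact: arith b0 c1 c2 b4 b2.
Qed.

End Necessity.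

(** As U is unitary a.e., B f = U (U^* B f), and the point is that U^* B f is analytic.
Its coefficient of index -n pairs B f with z^{-n} U e, which splits into the n-th
backward shift of U e, an element of K_U, and terms of negative frequency, orthogonal
to B f.  The pairing of B f with an element q of K_U is that of f with B^* q, zero by
hypothesis. *)
Lemma toeplitz_mulH2 :
  (forall h, model_space U h -> forall k : nat, fourier (mxmulf (mxadjf B) h) k%:Z = 0) ->
  mulH2 B `<=` mulH2 U.
Proof.
move=> hB f [h0 hh0 fB]; pose w := mxmulf B h0; pose h1 := mxmulf (mxadjf U) w.
have hw : H2 w by exact: H2_Hinf_mul.
have L2w := H2_L2 hw; have L2h1 : L2 h1 by exact: L2_Linf_mul.
have adjK : mxadjf (mxadjf U) = U by apply/funext => t; rewrite /mxadjf trmxCK.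
exists h1; last first.
  apply: ae_circleS (ae_circleI fB unitU) => t _ [-> [_ UU]].
  by rewrite /h1 /mxmulf mulmxA UU mul1mx.
split=> // k k0; apply: fourier_eq0; first exact: L2_L1.
move=> e; rewrite /h1 ip_adj adjK; pose n := absz k.
have nk : - n%:Z = k by rewrite /n ltz0_abs// opprK.
have n0 : (0 < n)%N by rewrite absz_gt0 lt_eqF.
have he : H2 (mono 0 e) := @H2_mono _ _ 0%N e.
pose u := mxmulf U (mono 0 e).
have hu : H2 u := H2_Hinf_mul HinfU he.
have L2u := H2_L2 hu.
have mq : model_space U (bshift u n).
  apply: (bshift_model_space HinfU hu) => g hg.
  pose cg := fun t => cis (n%:Z%:~R * t) *: g t.
  have L2cg : L2 cg by apply: L2_cisM; exact: H2_L2.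
  have e1 : inner_prod u (mxmulf U cg) =
      inner_prod (mono 0 e) (mxmulf (mxadjf U) (mxmulf U cg)) := ip_adj _ _ _.
  have e2 : inner_prod (mono 0 e) (mxmulf (mxadjf U) (mxmulf U cg)) =
      inner_prod (mono 0 e) cg.
    apply: ae_eq_ip; first exact: ae_circleT.
    by apply: ae_circleS unitU => t _ [UU _]; rewrite /mxmulf /mxadjf mulmxA UU mul1mx.
  apply: etrans e1 _; apply: etrans e2 _; apply: (ip_mono_l _ L2cg).
  apply: etrans (fourier_cisM _ _ _) _; have [_ ag] := hg.
  by apply: ag; rewrite sub0r oppr_lt0 ltz_nat.
have L2q := H2_L2 (model_space_H2 mq).
pose s t := \sum_(j < n) mono (j%:Z - n%:Z) (fourier u j%:Z) t.
have L2s : L2 s by apply: L2_sum => j; exact: L2_mono.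
have -> : mxmulf U (mono k e) = fun t => bshift u n t + s t.
  apply/funext => t.
  have -> : s t = cis ((- n%:Z)%:~R * t) *: psum u n t.
    rewrite /s /psum /pol scaler_sumr; apply: eq_bigr => j _.
    rewrite /mono scalerA -cisD; congr (cis _ *: _).
    by rewrite addrC intrD mulrDl.
  rewrite /bshift -scalerDr subrK /u /mxmulf /mono -nk.
  by rewrite mul0r cis0 scale1r scalemxAr.
rewrite (ipDr L2q L2s L2w).
have -> : inner_prod w (bshift u n) = 0.
  apply: etrans (ip_adj _ _ _) _.
  have L2Bq : L2 (mxmulf (mxadjf B) (bshift u n)) := L2_Linf_mul LinfBs L2q.
  by apply: (ip_psum_orth hh0 L2Bq) => l v; apply: (ip_mono_l _ L2Bq); exact: hB.
rewrite add0r /s ip_sumr; [|by move=> j; exact: L2_mono|exact: L2w].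
apply: big1 => j _; have [_ aw] := hw.
have jn : j%:Z - n%:Z < 0 by rewrite subr_lt0 ltz_nat.
by rewrite (ip_mono _ _ (L2_L1 L2w)) (aw _ jn) mulmx0 mxE.
Qed.

(** The coefficients of B^* h are the pairings of h with B z^k e. *)
Lemma mulH2_toeplitz : mulH2 B `<=` mulH2 U -> forall h, model_space U h ->
  forall k : nat, fourier (mxmulf (mxadjf B) h) k%:Z = 0.
Proof.
move=> BU h [hh ho] k; have L2h := H2_L2 hh.
have adjBK : mxadjf (mxadjf B) = B by apply/funext => t; rewrite /mxadjf trmxCK.
apply: fourier_eq0; first by apply: L2_L1; exact: L2_Linf_mul.
move=> e; apply: etrans (ip_adj _ _ _) _; rewrite adjBK; apply: ho; apply: BU.
by exists (mono k%:Z e); [exact: H2_mono|exact: ae_circleT].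
Qed.

End Equivalence.
End Characterization.

Lemma L2norm_sqnorm_eq (R : realType) m n (f : circle_fun R m 1) (h : circle_fun R n 1) :
  L2norm f = L2norm h <-> sqnorm f = sqnorm h.
Proof.
rewrite !L2norm_sqnorm; split=> [|->//] e.
by rewrite -(sqr_sqrtr (sqnorm_ge0 f)) e sqr_sqrtr ?sqnorm_ge0.
Qed.

Theorem theorem3p5 (R : realType) (m r : nat) (F : set (circle_fun R m 1))
    (g : 'I_r -> circle_fun R m 1) (B U : circle_fun R r r) :
  nearly_Sstar_invariant F -> nontrivial F ->
  orthonormal_basis g (wandering F) ->
  associated (of_columns g) B ->
  inner_of_rank U r -> disc U 0 = 0 ->
  [<-> forall h, model_space U h ->
         H2 (mxmulf (of_columns g) h) /\
         L2norm (mxmulf (of_columns g) h) = L2norm h;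
       forall h, model_space U h -> is_toeplitz (mxadjf B) h (fun=> 0);
       mulH2 B `<=` mulH2 U].
Proof.
move=> [[FH2 _ _ _] _] _ [gW gON _] assocB innU U0; set G := of_columns g.
have H2g i : H2 (g i) by have [Fg _] := gW i; exact: FH2.
have H2G : H2 G.
  split=> [|k k0].
    apply/L2P => i j; have -> : (fun t => G t i j) = fun t => g j t i 0.
      by apply/funext => t; rewrite /G mxE.
    exact: (H2_L2 (H2g j)).
  apply/matrixP => i j; have [_ /(_ k k0)] := H2g j.
  move=> /(congr1 (fun M : 'M[R[i]]_(m, 1) => M i 0)); rewrite !mxE => <-.
  by apply: eq_cmean => t _; rewrite !mxE.
have meanG : mxmean (fun t => (G t)^t* *m G t) = 1%:M.
  apply/matrixP => i j; rewrite !mxE eq_sym -gON; apply: eq_cmean => t _.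
  by rewrite !mxE; apply: eq_bigr => k _; rewrite !mxE.
have [HinfU _] := innU; have unitU := inner_unitary innU.
have LinfB : Linf B by have [[]] := assocB.
rewrite disc0 in U0.
split=> [iso h mh|].
  apply/(toeplitz_adj0P LinfB (model_space_H2 mh)) => k.
  apply: (isometry_toeplitz H2G meanG assocB HinfU U0 _ k mh) => h' /iso[h1 h2].
  by split => //; exact/L2norm_sqnorm_eq.
have toep0 : (forall h, model_space U h -> is_toeplitz (mxadjf B) h (fun=> 0)) ->
    forall h, model_space U h -> forall k : nat, fourier (mxmulf (mxadjf B) h) k%:Z = 0.
  by move=> hB h mh; apply/(toeplitz_adj0P LinfB (model_space_H2 mh)); exact: hB.
split=> [/toep0|BU h mh]; first exact: toeplitz_mulH2 assocB HinfU unitU.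
have [h1 h2] := toeplitz_ker_isometry H2G meanG assocB (model_space_H2 mh)
  (mulH2_toeplitz assocB BU mh).
by split => //; exact/L2norm_sqnorm_eq.
Qed.
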